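(* The $\gamma_{soh}$-tensor product, $(\mathcal{S},\mathcal{T})\mapsto\mathcal{S}\otimes_{\gamma_{soh}}\mathcal{T}=(\mathcal{S}\otimes\mathcal{T},\{\mathcal{C}_n^{\gamma}(\mathcal{S},\mathcal{T})\}_{n=1}^\infty,1_{\mathcal{S}}\otimes1_{\mathcal{T}})$, defines a functorial operator system tensor product structure in the category of finite dimensional operator systems.
   Context: $SOH(n)$: $OH(n)$ is Pisier's self-dual operator space of dimension $n$, with orthonormal basis $e_1,\dots,e_n$ satisfying $\|\sum_i A_i\otimes e_i\|=\|\sum_i A_i\otimes\overline{A_i}\|^{1/2}$ for all $m$ and $A_i\in M_m$ ($\overline{A}$ = entrywise conjugate, norm on the right in $M_{m^2}$). Fix a completely isometric inclusion $OH(n)\subseteq B(\mathcal{H})$; let $H_0=I_{\mathcal{H}\oplus\mathcal{H}}$, $H_i=\begin{pmatrix}0&e_i\\ e_i^*&0\end{pmatrix}$; $SOH(n)=\mathrm{span}\{H_0,\dots,H_n\}\subseteq B(\mathcal{H}\oplus\mathcal{H})$, an operator system. Dual: $\mathcal{S}^d$ is the dual of $\mathcal{S}$ with $(f_{ij})\in M_n(\mathcal{S}^d)^+$ iff $v\mapsto(f_{ij}(v))$ is completely positive from $\mathcal{S}$ to $M_n$. Let $\mathcal{S},\mathcal{T}$ be finite dimensional operator systems. For $u=\sum_i x_i\otimes y_i\in\mathcal{S}\otimes\mathcal{T}$ let $\hat u:\mathcal{S}^d\to\mathcal{T}$, $\hat u(f)=\sum_i f(x_i)y_i$. A map $\hat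 u:\mathcal{S}^d\to\mathcal{T}$ factors through $SOH$ approximately if there are nets of completely positive maps $\phi_\lambda:\mathcal{S}^d\to M_{p_\lambda}(SOH(n_\lambda))$ and $\psi_\lambda:M_{p_\lambda}(SOH(n_\lambda))\to\mathcal{T}$ such that $\psi_\lambda\circ\phi_\lambda\to\hat u$ in the point-norm topology. $\mathcal{C}_1^\gamma(\mathcal{S},\mathcal{T})$ is the set of $u\in\mathcal{S}\otimes\mathcal{T}$ such that $\hat u$ factors through $SOH$ approximately; identifying $M_n(\mathcal{S}\otimes\mathcal{T})$ with $\mathcal{S}\otimes M_n(\mathcal{T})$, $\mathcal{C}_n^\gamma(\mathcal{S},\mathcal{T})=\mathcal{C}_1^\gamma(\mathcal{S},M_n(\mathcal{T}))$. A tensor product structure $\tau$ on a category of operator systems assigns to each pair $(\mathcal{S},\mathcal{T})$ a matrix order on $\mathcal{S}\otimes\mathcal{T}$ such that: (T1) with these cones and unit $1_{\mathcal{S}}\otimes1_{\mathcal{T}}$, $\mathcal{S}\otimes_\tau\mathcal{T}$ is an operator system; (T2) $P\in M_n(\mathcal{S})^+$, $Q\in M_m(\mathcal{T})^+$ imply $P\otimes Q\in M_{nm}(\mathcal{S}\otimes_\tau\mathcal{T})^+$; (T3) if $\phi:\mathcal{S}\to M_n$ and $\psi:\mathcal{T}\to M_k$ are unital completely positive, then $\phi\otimes\psi:\mathcal{S}\otimes_\tau\mathcal{T}\to M_{nk}$ is (unital) completely positive. It is functorial if for all completely positive $\rho:\mathcal{S}\to\mathcal{V}$, $\kappa:\mathcal{T}\to\mathcal{W}$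 between objects of the category, $\rho\otimes\kappa:\mathcal{S}\otimes_\tau\mathcal{T}\to\mathcal{V}\otimes_\tau\mathcal{W}$ is completely positive. *)

(* Defs.v *)
From HB Require Import structures.
From mathcomp Require Import all_boot all_order all_algebra.
From mathcomp Require Import complex mxtens.
From mathcomp Require Import all_classical all_reals all_analysis.

Set Implicit Arguments.
Unset Strict Implicit.
Unset Printing Implicit Defensive.
Import Order.TTheory GRing.Theory Num.Theory.
Import numFieldNormedType.Exports.
Import VectorInternalTheory.
Local Open Scope classical_set_scope.
Local Open Scope ring_scope.

(* Complex scalars are R[i] for R : realType; 0 <= z on R[i] means that z is
   real and nonnegative. *)

Section MatrixOrders.
Context {R : realType}.
Notation C := R[i].

(* Only the vector space and the cones M_k(V)^+ are recorded: this is all that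
   complete positivity refers to. *)
Record moSpace := MOSpace {
  mo_sort :> vectType C;
  mo_pos : forall k, set 'M[mo_sort]_k }.

(* Complete positivity; linearity is carried by the type of f where needed. *)
Definition cp (V W : moSpace) (f : V -> W) : Prop :=
  forall k (X : 'M[V]_k), mo_pos X -> mo_pos (map_mx f X).

Definition psd k (A : 'M[C]_k) : Prop :=
  forall x : 'I_k -> C, 0 <= \sum_a \sum_b Num.conj (x a) * A a b * x b.

(* M_l(M_p(V)) = M_(l * p)(V); the pair (outer index, inner index) is encoded
   by mxtens_index, as in the Kronecker product *t of mxtens. *)
Definition flat_mx (U V : Type) (p l : nat) (ent : U -> 'I_p -> 'I_p -> V)
    (X : 'M[U]_l) : 'M[V]_(l * p) :=
  \matrix_(a, b) ent (X (mxtens_unindex a).1 (mxtens_unindex b).1)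
                     (mxtens_unindex a).2 (mxtens_unindex b).2.

Definition scalarMat (p : nat) : moSpace :=
  @MOSpace 'M[C]_p
    (fun l X => psd (flat_mx (fun (A : 'M[C]_p) i j => A i j) X)).

(* The space underlying M_p(V) is {ffun 'I_p * 'I_p -> V}, because 'M[V]_p has
   no vector space structure when V is a vector space. *)
Definition ampMO (p : nat) (V : moSpace) : moSpace :=
  @MOSpace {ffun 'I_p * 'I_p -> V}
    (fun l X => mo_pos
       (flat_mx (fun (A : {ffun 'I_p * 'I_p -> V}) i j => A (i, j)) X)).

Definition dualMO (S : moSpace) : moSpace :=
  @MOSpace 'Hom(S, C^o)
    (fun k F => cp (V := S) (W := scalarMat k)
       (fun v => map_mx (fun f : 'Hom(S, C^o) => f v : C) F)).

Record osData := OSData {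
  os_mo :> moSpace;
  os_star : os_mo -> os_mo;
  os_one : os_mo }.

Definition diag_one (S : osData) k : 'M[S]_k :=
  \matrix_(a, b) (os_one S *+ (a == b)).

Definition star_mx (S : osData) k (X : 'M[S]_k) : 'M[S]_k :=
  map_mx (@os_star S) X^T.

(* alpha^* X alpha *)
Definition congr_mx (V : lmodType C) k l (al : 'M[C]_(k, l)) (X : 'M[V]_k) :
    'M[V]_l :=
  \matrix_(a, b) \sum_c \sum_d (Num.conj (al c a) * al d b) *: X c d.

(* Abstract operator systems: matrix-ordered *-vector spaces with an
   Archimedean matrix order unit. *)
Record is_opsys (S : osData) : Prop := IsOpSys {
  os_star_antilinear : forall (a : C) (x y : S),
    os_star (a *: x + y) = Num.conj a *: os_star x + os_star y;
  os_starK : forall x : S, os_star (os_star x) = x;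
  os_pos_herm : forall k (X : 'M[S]_k), mo_pos X -> star_mx X = X;
  os_posD : forall k (X Y : 'M[S]_k), mo_pos X -> mo_pos Y -> mo_pos (X + Y);
  os_posZ : forall k (r : C) (X : 'M[S]_k), 0 <= r ->
    mo_pos X -> mo_pos (map_mx ( *:%R r) X);
  os_pos_proper : forall k (X : 'M[S]_k), mo_pos X -> mo_pos (- X) -> X = 0;
  os_pos_congr : forall k l (al : 'M[C]_(k, l)) (X : 'M[S]_k),
    mo_pos X -> mo_pos (congr_mx al X);
  os_one_herm : os_star (os_one S) = os_one S;
  os_order_unit : forall k (X : 'M[S]_k), star_mx X = X ->
    exists2 r : C, 0 < r & mo_pos (map_mx ( *:%R r) (diag_one S k) + X);
  os_archimedean : forall k (X : 'M[S]_k), star_mx X = X ->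
    (forall r : C, 0 < r -> mo_pos (map_mx ( *:%R r) (diag_one S k) + X)) ->
    mo_pos X }.

(* Finite dimensionality is built into vectType. *)
Record fdOpSys := FdOpSys {
  fd_data :> osData;
  fd_opsys : is_opsys fd_data }.

Definition ampOS (p : nat) (S : osData) : osData :=
  @OSData (ampMO p S)
    (fun X : {ffun 'I_p * 'I_p -> S} => [ffun ab => os_star (X (ab.2, ab.1))])
    [ffun ab : 'I_p * 'I_p => os_one S *+ (ab.1 == ab.2)].

(* The norm of an operator system: the least r >= 0 such that the 2 x 2 matrix
   (r 1, x; x^*, r 1) is positive. *)
Definition os_norm (S : osData) (x : S) : R :=
  inf [set r : R | 0 <= r /\
    mo_pos (\matrix_(a < 2, b < 2)
      if a == b then (r%:C)%C *: os_one S
      else if (a < b)%N then x else os_star x)].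

End MatrixOrders.

Arguments moSpace : clear implicits.
Arguments osData : clear implicits.
Arguments fdOpSys : clear implicits.

Section TensorProduct.
Context {R : realType}.
Notation C := R[i].

Definition vbas (S : vectType C) (i : 'I_(dim S)) : S := r2v (delta_mx 0 i).

(* The algebraic tensor product in coordinates: u stands for
   \sum_(i, j) u i j (vbas i (x) vbas j). Lemmas tlift_tens and tensor_ext
   below are its universal property. *)
Definition tensor (S T : vectType C) : vectType C := 'M[C]_(dim S, dim T).

Definition tens (S T : vectType C) (x : S) (y : T) : tensor S T :=
  (v2r x)^T *m v2r y.

Definition tlift (S T Z : vectType C) (be : S -> T -> Z) (u : tensor S T) : Z :=
  \sum_i \sum_j u i j *: be (vbas i) (vbas j).

Lemma tlift_is_linear (S T Z : vectType C) (be : S -> T -> Z) :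
  linear (tlift be).
Proof.
move=> a u v; rewrite /tlift scaler_sumr -big_split; apply: eq_bigr => i _ /=.
rewrite scaler_sumr -big_split; apply: eq_bigr => j _ /=.
by rewrite !mxE scalerDl scalerA.
Qed.

HB.instance Definition _ (S T Z : vectType C) (be : S -> T -> Z) :=
  GRing.isLinear.Build C (tensor S T) Z *:%R (tlift be) (tlift_is_linear be).

Lemma vbas_sum (S : vectType C) (x : S) : x = \sum_i v2r x 0 i *: vbas i.
Proof.
rewrite -[LHS]v2rK [X in r2v X]row_sum_delta linear_sum.
by apply: eq_bigr => i _; rewrite linearZ.
Qed.

Lemma tlift_tens (S T Z : vectType C) (be : S -> T -> Z)
    (bel : forall y, linear (be ^~ y)) (ber : forall x, linear (be x)) x y :
  tlift be (tens x y) = be x y.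
Proof.
have suml I (r : seq I) (F : I -> S) (c : I -> C) z :
    be (\sum_(i <- r) c i *: F i) z = \sum_(i <- r) c i *: be (F i) z.
  pose g := HB.pack (be ^~ z) (GRing.isLinear.Build C S Z *:%R _ (bel z))
    : {linear S -> Z}.
  rewrite -[LHS]/(g _) linear_sum; apply: eq_bigr => i _.
  exact: (linearZ_LR g).
have sumr I (r : seq I) (F : I -> T) (c : I -> C) z :
    be z (\sum_(i <- r) c i *: F i) = \sum_(i <- r) c i *: be z (F i).
  pose g := HB.pack (be z) (GRing.isLinear.Build C T Z *:%R _ (ber z))
    : {linear T -> Z}.
  rewrite -[LHS]/(g _) linear_sum; apply: eq_bigr => i _.
  exact: (linearZ_LR g).
rewrite [in RHS](vbas_sum x) [in RHS](vbas_sum y) suml.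
apply: eq_bigr => i _; rewrite sumr scaler_sumr; apply: eq_bigr => j _.
by rewrite scalerA /tens !mxE big_ord1 !mxE.
Qed.

Lemma tens_bas (S T : vectType C) i j :
  tens (vbas (S := S) i) (vbas (S := T) j) = delta_mx i j.
Proof. by rewrite /tens /vbas !r2vK trmx_delta mul_delta_mx. Qed.

Lemma tensor_ext (S T Z : vectType C) (f g : {linear tensor S T -> Z}) :
  (forall x y, f (tens x y) = g (tens x y)) -> f =1 g.
Proof.
move=> fg u; rewrite [u]matrix_sum_delta !linear_sum; apply: eq_bigr => i _.
rewrite !linear_sum; apply: eq_bigr => j _.
by rewrite !linearZ -tens_bas fg.
Qed.

(* \hat u (f) = \sum_k f(x_k) y_k for u = \sum_k x_k (x) y_k *)
Definition hat (S T : osData R) (u : tensor S T) (f : dualMO S) : T :=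
  tlift (fun x y => (f : 'Hom(S, C^o)) x *: y) u.

Lemma hat_tens (S T : osData R) x y (f : dualMO S) :
  hat (T := T) (tens x y) f = (f : 'Hom(S, C^o)) x *: y.
Proof.
rewrite /hat tlift_tens// => [z a v w|v a z w].
  by rewrite linearP scalerDl scalerA.
by rewrite scalerDr !scalerA mulrC.
Qed.

Definition tensor_map (S T V W : vectType C) (rho : S -> V) (ka : T -> W) :
    {linear tensor S T -> tensor V W} :=
  tlift (fun x y => tens (rho x) (ka y)).

(* phi (x) psi into M_n (x) M_k = M_(n * k) *)
Definition tensor_map_mx (S T : vectType C) n k
    (phi : S -> 'M[C]_n) (psi : T -> 'M[C]_k) :
    {linear tensor S T -> 'M[C]_(n * k)} :=
  tlift (fun x y => phi x *t psi y).

(* The antilinear involution with (x (x) y)^* = x^* (x) y^*, see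
   tensor_star_tens. *)
Definition tensor_star (S T : osData R) (u : tensor S T) : tensor S T :=
  tlift (fun x y => tens (os_star x) (os_star y)) (map_mx Num.conj u).

Lemma tensor_star_tens (S T : fdOpSys R) (x : S) (y : T) :
  tensor_star (S := S) (T := T) (tens x y) = tens (os_star x) (os_star y).
Proof.
have star0 (U : fdOpSys R) : os_star (0 : U) = 0.
  have := os_star_antilinear (fd_opsys U) 1 0 0.
  by rewrite !rmorph1 !scale1r addr0 => /eqP; rewrite -subr_eq0 opprD addNKr
    oppr_eq0 => /eqP.
have star_sum (U : fdOpSys R) (z : U) :
    os_star z = \sum_i Num.conj (v2r z 0 i) *: os_star (vbas i).
  rewrite {1}(vbas_sum z).
  elim/big_rec2: _ => [|i u v _ <-]; first exact: star0.
  exact: (os_star_antilinear (fd_opsys U)).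
rewrite (star_sum S x) (star_sum T y) /tensor_star /tlift /tens.
rewrite linear_sum /= linear_sum /= mulmx_suml.
apply: eq_bigr => i _; rewrite linear_sum mulmx_sumr.
apply: eq_bigr => j _; rewrite !linearZ /= -scalemxAl scalerA.
by rewrite !mxE big_ord1 !mxE rmorphM mulrC.
Qed.

(* The identification M_n(S (x) T) = S (x) M_n(T). *)
Definition tensor_amp (S T : osData R) n (U : 'M[tensor S T]_n) :
    tensor S (ampOS n T) :=
  \sum_a \sum_b tlift (fun (x : S) (y : T) =>
    tens x ([ffun ij => y *+ (ij == (a, b))] : ampOS n T)) (U a b).

(* P (x) Q in M_(n * m)(S (x) T) *)
Definition tens_mx (S T : vectType C) n m (P : 'M[S]_n) (Q : 'M[T]_m) :
    'M[tensor S T]_(n * m) :=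
  \matrix_(a, b) tens (P (mxtens_unindex a).1 (mxtens_unindex b).1)
                      (Q (mxtens_unindex a).2 (mxtens_unindex b).2).

End TensorProduct.

Section SOH.
Context {R : realType}.
Notation C := R[i].

Record hilbert := Hilbert {
  hs_sort :> completeNormedModType C;
  hs_ip : {dot hs_sort for Num.conj};
  hs_normE : forall x, hs_ip x x = `|x| ^+ 2 }.

(* Norm and operator norm on V^m = V (+) ... (+) V, for the Hilbert sum norm
   (the library norm on products is the sup norm). The norm of a normed
   C-module is C-valued, whence Re. *)
Definition l2norm (V : normedModType C) m (x : 'I_m -> V) : R :=
  Num.sqrt (\sum_a (complex.Re `|x a|) ^+ 2).

Definition l2opnorm (V : normedModType C) m
    (T : ('I_m -> V) -> ('I_m -> V)) : R :=
  sup [set l2norm (T x) | x in [set x | l2norm x <= 1]].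

Definition mx_opnorm m (A : 'M[C]_m) : R :=
  l2opnorm (fun (x : 'I_m -> C^o) a => \sum_b A a b *: x b).

(* \sum_i A_i (x) e_i acting on H^m *)
Definition amp_op (H : lmodType C) n m (e : 'I_n -> H -> H)
    (A : 'I_n -> 'M[C]_m) (x : 'I_m -> H) : 'I_m -> H :=
  fun a => \sum_i \sum_b A i a b *: e i (x b).

(* A completely isometric inclusion of OH(n) in B(H): bounded operators
   e_1, ..., e_n on H (with their adjoints) satisfying Pisier's norm formula. *)
Record OHrep (n : nat) := OHRep {
  oh_H :> hilbert;
  oh_e : 'I_n -> {linear oh_H -> oh_H};
  oh_e_adj : 'I_n -> {linear oh_H -> oh_H};
  oh_e_bounded : forall i, continuous (oh_e i);
  oh_adjE : forall i (x y : oh_H),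
    hs_ip oh_H (oh_e i x) y = hs_ip oh_H x (oh_e_adj i y);
  oh_norm : forall m (A : 'I_n -> 'M[C]_m),
    l2opnorm (amp_op (fun i => oh_e i) A) =
    Num.sqrt (mx_opnorm (\sum_i (A i *t map_mx Num.conj (A i)))) }.

(* H_0, ..., H_n as operators on H (+) H *)
Definition soh_gen n (E : OHrep n) (i : 'I_n.+1) (z : E * E) : E * E :=
  if unlift ord0 i is Some j then (oh_e E j z.2, oh_e_adj E j z.1) else z.

Definition soh_op n (E : OHrep n) (x : 'rV[C]_n.+1) (z : E * E) : E * E :=
  \sum_i x 0 i *: soh_gen i z.

Lemma OHrep_coord_eq0 n (E : OHrep n) (c : 'I_n -> C) :
  (forall y : E, \sum_i c i *: oh_e E i y = 0) -> forall i, c i = 0.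
Proof.
move=> ce0.
have l2cst (V : normedModType C) (x : 'I_1 -> V) : l2norm (V := V) x = complex.Re `|x ord0|.
  rewrite /l2norm big_ord1 sqrtr_sqr ger0_norm//.
  by have := normr_ge0 (x ord0); rewrite complex.lecE => /andP[].
have Re_ler_piMr (w z : C) :
    0 <= w -> 0 <= z -> complex.Re z <= 1 -> complex.Re (w * z) <= complex.Re w.
  case: w z => a b [u v].
  rewrite !complex.lecE /= => /andP[/eqP -> a0] /andP[/eqP -> u0] u1.
  by rewrite mulr0 subr0 ler_piMr.
pose A i : 'M[C]_1 := (c i)%:M.
have lhs0 : l2opnorm (amp_op (fun i => oh_e E i) A) = 0.
  rewrite /l2opnorm [X in sup X](_ : _ = [set 0]) ?sup1//.
  have amp0 x : l2norm (amp_op (fun i => oh_e E i) A x) = 0.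
    rewrite l2cst /amp_op; under eq_bigr do rewrite big_ord1 mxE eqxx mulr1n.
    by rewrite ce0 normr0.
  apply/seteqP; split => [_ [x _ <-] //|_ ->]; exists (fun=> 0); last exact: amp0.
  by rewrite /= l2cst normr0.
have := oh_norm E A; rewrite lhs0 => /esym/eqP; rewrite sqrtr_eq0 => le0.
pose s : C := \sum_i c i * Num.conj (c i).
have mxE1 (x : 'I_1 -> C^o) a :
    \sum_(b < 1) (\sum_i A i *t map_mx Num.conj (A i)) a b *: x b = s * x ord0.
  rewrite big_ord1 summxE ; congr (_ * _); apply: eq_bigr => i _.
  by rewrite !mxE !ord1 eqxx !mulr1n.
have s_ge0 : 0 <= s by apply: sumr_ge0 => i _; exact: mul_conjC_ge0.
have s0 : complex.Re s <= 0.
  apply: le_trans le0; apply: sup_upper_bound; last first.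
    exists (fun=> 1); first by rewrite /= l2cst normr1.
    by rewrite l2cst mxE1 mulr1 ger0_norm.
  split; first by exists 0, (fun=> 0); rewrite /= ?l2cst ?mxE1 ?mulr0 normr0.
  exists (complex.Re s) => _ [x + <-]; rewrite /= !l2cst mxE1 normrM ger0_norm//.
  exact: Re_ler_piMr.
have {}s0 : s = 0.
  apply/eqP; rewrite eq_le s_ge0 andbT complex.lecE s0 andbT.
  by move: s_ge0; rewrite complex.lecE => /andP[/eqP <-].
move=> i; apply/eqP; rewrite -mul_conjC_eq0.
move/eqP: s0; rewrite psumr_eq0 => [/allP/(_ i)|j _]; last exact: mul_conjC_ge0.
by rewrite mem_index_enum => /(_ isT).
Qed.

Lemma soh_op_inj n (E : OHrep n) (x : 'rV[C]_n.+1) :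
  (0 < n)%N -> (forall z, soh_op (E := E) x z = 0) -> x = 0.
Proof.
move=> n_gt0 x0.
have fst_op z : (soh_op (E := E) x z).1 =
    x 0 ord0 *: z.1 + \sum_i x 0 (lift ord0 i) *: oh_e E i z.2.
  rewrite /soh_op (raddf_sum (@fst E E)) big_ord_recl /= /soh_gen unlift_none.
  by congr (_ + _); apply: eq_bigr => i _; rewrite liftK.
have xS : forall i, x 0 (lift ord0 i) = 0.
  apply: (@OHrep_coord_eq0 _ E) => y.
  by have := fst_op (0, y); rewrite x0 scaler0 add0r => <-.
have xO : x 0 ord0 = 0.
  apply/eqP; apply: contraT => xn0.
  have E0 (y : E) : y = 0.
    have := fst_op (y, 0); rewrite x0 big1 => [|i _]; last by rewrite xS scale0r.
    by rewrite addr0 => /esym/eqP; rewrite scaler_eq0 (negPf xn0) => /eqP.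
  have /(_ (Ordinal n_gt0))/eqP := @OHrep_coord_eq0 _ E (fun=> 1) (fun y => E0 _).
  by rewrite oner_eq0.
apply/rowP => i; rewrite mxE; case: (unliftP ord0 i) => [j|] ->; [exact: xS|].
exact: xO.
Qed.
Definition ip2 (H : hilbert) (z w : H * H) : C :=
  hs_ip H z.1 w.1 + hs_ip H z.2 w.2.

(* span {H_0, ..., H_n}, an element being given by its coordinates (unique when
   n > 0, see soh_op_inj), with the matrix order of B(H (+) H). *)
Definition SOH n (E : OHrep n) : moSpace R :=
  @MOSpace R 'rV[C]_n.+1 (fun k X =>
    forall z : 'I_k -> E * E,
      0 <= \sum_a \sum_b ip2 (soh_op (X a b) (z b)) (z a)).

End SOH.

Arguments hilbert : clear implicits.
Arguments OHrep : clear implicits.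

Section Gamma.
Context {R : realType}.
Notation C := R[i].
Variable oh : forall n, OHrep R n.

Definition net_directed (L : Type) (le : L -> L -> Prop) : Prop :=
  [/\ inhabited L, forall a, le a a,
      forall a b c, le a b -> le b c -> le a c &
      forall a b, exists c, le a c /\ le b c].

Definition factors_SOH (S T : osData R) (h : dualMO S -> T) : Prop :=
  exists (L : Type) (le : L -> L -> Prop) (p n : L -> nat)
    (phi : forall l, {linear dualMO S -> ampMO (p l) (SOH (oh (n l)))})
    (psi : forall l, {linear ampMO (p l) (SOH (oh (n l))) -> T}),
    [/\ net_directed le,
        forall l, (0 < p l)%N /\ (0 < n l)%N,
        forall l, cp (phi l),
        forall l, cp (psi l) &
        forall (f : dualMO S) (eps : R), 0 < eps ->
          exists l0, forall l, le l0 l ->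
            os_norm (psi l (phi l f) - h f) < eps].

Definition gamma1 (S T : osData R) : set (tensor S T) :=
  [set u | factors_SOH (hat u)].

Definition gamma_soh (S T : osData R) k : set 'M[tensor S T]_k :=
  [set U | gamma1 (tensor_amp U)].

End Gamma.

Section TensorStructures.
Context {R : realType}.
Notation C := R[i].
Variable tau : forall (S T : fdOpSys R) k, set 'M[tensor S T]_k.

Definition tensorMO (S T : fdOpSys R) : moSpace R :=
  @MOSpace R (tensor S T) (@tau S T).

Definition tensorOS (S T : fdOpSys R) : osData R :=
  @OSData R (tensorMO S T) (@tensor_star R S T) (tens (os_one S) (os_one T)).

Record tensor_structure : Prop := TensorStructure {
  tensor_opsys : forall S T : fdOpSys R, is_opsys (tensorOS S T);
  tensor_pos : forall (S T : fdOpSys R) n m (P : 'M[S]_n) (Q : 'M[T]_m),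
    mo_pos P -> mo_pos Q -> mo_pos (m := tensorMO S T) (tens_mx P Q);
  tensor_ucp : forall (S T : fdOpSys R) n k
      (phi : {linear S -> 'M[C]_n}) (psi : {linear T -> 'M[C]_k}),
    cp (V := S) (W := scalarMat n) phi -> phi (os_one S) = 1%:M ->
    cp (V := T) (W := scalarMat k) psi -> psi (os_one T) = 1%:M ->
    cp (V := tensorMO S T) (W := scalarMat (n * k)) (tensor_map_mx phi psi) /\
    tensor_map_mx phi psi (tens (os_one S) (os_one T)) = 1%:M }.

Definition functorial : Prop :=
  forall (S T V W : fdOpSys R) (rho : {linear S -> V}) (ka : {linear T -> W}),
    cp rho -> cp ka ->
    cp (V := tensorMO S T) (W := tensorMO V W) (tensor_map rho ka).

End TensorStructures.

(* Main.v *)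
Require Import Defs.
From HB Require Import structures.
From mathcomp Require Import all_boot all_order all_algebra.
From mathcomp Require Import complex mxtens.
From mathcomp Require Import all_classical all_reals all_analysis.
From mathcomp Require Import ring lra.

Set Implicit Arguments.
Unset Strict Implicit.
Unset Printing Implicit Defensive.
Import Order.TTheory GRing.Theory Num.Theory.
Import numFieldNormedType.Exports.
Import VectorInternalTheory.
Local Open Scope classical_set_scope.
Local Open Scope ring_scope.

(** Write h for the map attached to an element of M_k(S (x) T); it goes from
    the dual of S to M_k(T), and lies in the cone exactly when it is a
    pointwise limit of maps that factor completely positively through some
    M_p(SOH(n)).  Four facts carry the proof.

    Maps with an exact factorization form a convex cone, stable under
    composition with completely positive maps on either side, and containing
    every map that factors completely positively through a matrix algebra M_p
    ([exactD], [exact_comp], [exact_scalar]).  Matrix algebras are handled by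
    A |-> A (x) H_0, inverted by the coordinate along H_0.  For sums one has
    to put SOH(n) and SOH(m) inside SOH(n + m) as completely positive retracts
    ([cp_soh_map]).  The inclusion is completely positive because positivity
    of A_0 (x) H_0 + sum_i A_i (x) H_i means that the A_i are hermitian and
    that, once A_0 is made positive definite and normalized to 1, the operator
    sum_i A_i (x) e_i is a contraction; by Pisier's formula this depends only
    on sum_i A_i (x) conj(A_i) ([soh_transfer]), hence is invariant under real
    isometries.  The projection onto a coordinate subspace is the average of
    the identity and a reflection, so it is completely positive as well.

    Limits of completely positive maps into an operator system are completely
    positive ([opsys_closed], [approx_cp]), because its cones are closed for
    the order norm.  So the elements of the cone induce completely positive
    maps; this makes the cones hermitian, and phi (x) psi positive on them when
    phi and psi are completely positive maps into matrix algebras.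

    Positive functionals separate the points of S ([pos1_separate], a finite
    Hahn-Banach argument with the gauge of the positive cone), so h, and hence
    the tensor, is determined by the values of h at positive functionals; this
    gives properness ([hat_separate]).

    The order unit comes from
    2 (ab 1 (x) 1 + x (x) y)
      = (a + x) (x) (b + y) + (a - x) (x) (b - y),
    whose right-hand side is a sum of elementary tensors of positive elements
    when -a <= x <= a and -b <= y <= b ([exact_unit]).  *)

(** * Positive semidefinite kernels *)

Section PSD.
Context {R : realType}.
Notation C := R[i].

(** [psd] for kernels over an arbitrary finite type, so that blocks can be
    indexed by pairs instead of by [mxtens_index]. *)
Definition fpsd (I : finType) (A : I -> I -> C) : Prop :=
  forall x : I -> C, 0 <= \sum_i \sum_j Num.conj (x i) * A i j * x j.

Lemma ge0_eq (x y : C) : 0 <= x -> x = y -> 0 <= y.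
Proof. by move=> x0 <-. Qed.

Lemma real_eq (x y : C) : 0 <= x -> x = y -> y \is Num.real.
Proof. by move=> x0 <-; exact: ger0_real. Qed.

(** Polarization: p and q are the diagonal values of a sesquilinear form at a
    pair of vectors, u and v its off-diagonal ones, and the form is real at the
    sum of the two vectors, before and after multiplying one of them by 'i. *)
Lemma polar_conj (p q u v : C) : p \is Num.real -> q \is Num.real ->
  p + q + (u + v) \is Num.real -> p + q + ('i * u - 'i * v) \is Num.real ->
  v = Num.conj u.
Proof.
move=> rp rq r1 r2.
have h1 : u + v \is Num.real.
  by rewrite -[u + v](addKr (p + q)) rpredD // rpredN rpredD.
have h2 : 'i * u - 'i * v \is Num.real.
  by rewrite -['i * u - _](addKr (p + q)) rpredD // rpredN rpredD.
have := CrealP h1; have := CrealP h2.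
rewrite !rmorphD !rmorphN !rmorphM /= conjCi => h3 h4.
have h5 : Num.conj u + Num.conj v = u + v by [].
have h6 : - (Num.conj u) + Num.conj v = u - v.
  apply: (mulfI (neq0Ci C)); rewrite mulrDr mulrN mulrBr -h3; ring.
have : (2 : C) * v = 2 * Num.conj u.
  have -> : 2 * v = (u + v) - (u - v) by ring.
  by rewrite -h5 -h6; ring.
by move/mulfI; apply; rewrite pnatr_eq0.
Qed.

Lemma sum_two (I : finType) (V : lmodType C) (c d : C) (i j : I) (F : I -> V) :
  \sum_k (c *+ (k == i) + d *+ (k == j)) *: F k = c *: F i + d *: F j.
Proof.
under eq_bigr do rewrite scalerDl.
rewrite big_split /= (bigD1 i) //= eqxx mulr1n big1; last first.
  by move=> k /negPf ->; rewrite mulr0n scale0r.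
rewrite addr0 (bigD1 j) //= eqxx mulr1n big1 ?addr0 //.
by move=> k /negPf ->; rewrite mulr0n scale0r.
Qed.

Lemma fpsd_two (I : finType) (A : I -> I -> C) i j (c d : C) : fpsd A ->
  0 <= Num.conj c * c * A i i + Num.conj c * d * A i j +
       (Num.conj d * c * A j i + Num.conj d * d * A j j).
Proof.
move=> /(_ (fun k => c *+ (k == i) + d *+ (k == j)))/ge0_eq; apply.
transitivity (\sum_i0 Num.conj (c *+ (i0 == i) + d *+ (i0 == j)) *
   (c * A i0 i + d * A i0 j)).
  apply: eq_bigr => k _; rewrite -(sum_two c d i j (A k : I -> C^o)) mulr_sumr.
  by apply: eq_bigr => l _; rewrite -mulrA [A k l * _]mulrC.
under eq_bigr do rewrite rmorphD !rmorphMn.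
rewrite (sum_two (Num.conj c) (Num.conj d) i j
  (fun k => c * A k i + d * A k j : C^o)) /GRing.scale /=; ring.
Qed.

Lemma fpsd_herm (I : finType) (A : I -> I -> C) i j :
  fpsd A -> A j i = Num.conj (A i j).
Proof.
move=> Ap.
have h00 k : A k k \is Num.real.
  apply: real_eq (fpsd_two k k 1 0 Ap) _; rewrite rmorph1 rmorph0; ring.
apply: (@polar_conj (A i i) (A j j)) => //.
  by apply: real_eq (fpsd_two i j 1 1 Ap) _; rewrite rmorph1; ring.
apply: real_eq (fpsd_two i j 1 'i Ap) _; rewrite rmorph1 conjCi.
have -> : - 'i * 'i = 1 :> C by rewrite mulNr -expr2 sqrCi opprK.
ring.
Qed.

Lemma fpsd_reindex (I J : finType) (A : I -> I -> C) (g : J -> I) :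
  fpsd A -> fpsd (fun a b => A (g a) (g b)).
Proof.
move=> Ap x; apply: ge0_eq (Ap (fun i => \sum_(k | g k == i) x k)) _.
rewrite [RHS](partition_big g xpredT) //=; apply: eq_bigr => i _.
rewrite rmorph_sum; under eq_bigr do rewrite !mulr_suml.
rewrite exchange_big /=; apply: eq_bigr => k /eqP <-.
rewrite [RHS](partition_big g xpredT) //=; apply: eq_bigr => j _.
by rewrite mulr_sumr; apply: eq_bigr => l /eqP <-.
Qed.

(** The square root comes from the spectral decomposition. *)
Lemma psd_factor k (A : 'M[C]_k) : fpsd (fun i j => A i j) ->
  exists G : 'M[C]_k, A = (map_mx Num.conj G)^T *m G.
Proof.
move=> Ap.
have Ah : A \is hermsymmx.
  apply/is_hermitianmxP; rewrite expr0 scale1r; apply/matrixP => i j.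
  by rewrite !mxE; apply: (@fpsd_herm _ (fun i j => A i j)).
have /orthomx_spectralP := hermitian_normalmx Ah.
set P := spectralmx A; set D := spectral_diag A => AE.
have Pu : P \is unitarymx by apply: spectral_unitarymx.
have D0 i : 0 <= D 0 i.
  have h : diag_mx D = P *m A *m (map_mx Num.conj P)^T.
    rewrite AE map_trmx -[map_mx _ _]/(P ^t*)%sesqui -(invmx_unitary Pu).
    by rewrite !mulmxA mulmxV ?unitarymx_unit // mul1mx mulmxK ?unitarymx_unit.
  have /matrixP /(_ i i) := h; rewrite !mxE eqxx mulr1n => ->.
  apply: ge0_eq (Ap (fun j => Num.conj (P i j))) _; rewrite exchange_big /=.
  apply: eq_bigr => j _; rewrite !mxE mulr_suml; apply: eq_bigr => l _.
  by rewrite conjCK.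
exists (diag_mx (map_mx sqrtC D) *m P); rewrite {1}AE map_mxM trmx_mul.
rewrite map_diag_mx -map_mx_comp tr_diag_mx invmx_unitary //.
rewrite map_trmx !mulmxA; congr (_ *m _); rewrite -mulmxA; congr (_ *m _).
rewrite mulmx_diag; congr diag_mx; apply/rowP => i; rewrite !mxE /=.
have /CrealP -> : sqrtC (D 0 i) \is Num.real by rewrite ger0_real // sqrtC_ge0.
by rewrite -expr2 sqrtCK.
Qed.

Lemma fpsd_factor (I : finType) (A : I -> I -> C) : fpsd A ->
  exists k (G : 'I_k -> I -> C), forall i j,
    A i j = \sum_c Num.conj (G c i) * G c j.
Proof.
move=> Ap.
pose B : 'M[C]_#|I| := \matrix_(i, j) A (enum_val i) (enum_val j).
have [G GE] : exists G : 'M[C]_#|I|, B = (map_mx Num.conj G)^T *m G.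
  apply: (@psd_factor _ B) => x.
  have /ge0_eq := fpsd_reindex (@enum_val I xpredT) Ap x; apply.
  by apply: eq_bigr => i _; apply: eq_bigr => j _; rewrite mxE.
exists #|I|, (fun c i => G c (enum_rank i)) => i j.
have /matrixP /(_ (enum_rank i) (enum_rank j)) := GE.
by rewrite !mxE !enum_rankK => ->; apply: eq_bigr => c _; rewrite !mxE.
Qed.

End PSD.

(** * Matrix cones over finite index types *)

Section FPos.
Context {R : realType}.
Notation C := R[i].

(** The part of the axioms of a matrix order shared by operator systems and
    the spaces SOH(n). *)
Record mcone (V : moSpace R) : Prop := MCone {
  mcone0 : forall k, mo_pos (0 : 'M[V]_k);
  mconeD : forall k (X Y : 'M[V]_k), mo_pos X -> mo_pos Y -> mo_pos (X + Y);
  mcone_congr : forall k l (al : 'M[C]_(k, l)) (X : 'M[V]_k),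
    mo_pos X -> mo_pos (congr_mx al X) }.

(** Positivity of a kernel over any type, tested on all finite families of
    indices, repetitions allowed.  Reindexing along an arbitrary function is
    then immediate, and M_k(M_p(V)) can be indexed by 'I_k * 'I_p. *)
Definition fpos (V : moSpace R) (I : Type) (X : I -> I -> V) : Prop :=
  forall k (g : 'I_k -> I), mo_pos (\matrix_(a, b) X (g a) (g b)).

Lemma fpos_ext (V : moSpace R) (I : Type) (X Y : I -> I -> V) :
  fpos X -> (forall i j, X i j = Y i j) -> fpos Y.
Proof.
by move=> + XY k g => /(_ k g); congr mo_pos; apply/matrixP => a b; rewrite !mxE XY.
Qed.

Lemma fpos_reindex (V : moSpace R) (I J : Type) (g : J -> I) (X : I -> I -> V) :
  fpos X -> fpos (fun a b => X (g a) (g b)).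
Proof. by move=> Xp k h; exact: (Xp k (g \o h)). Qed.

Lemma fpos_mo (V : moSpace R) k (X : 'M[V]_k) : fpos (fun i j => X i j) -> mo_pos X.
Proof. by move/(_ k id); congr mo_pos; apply/matrixP => a b; rewrite !mxE. Qed.

Lemma cp_fpos (V W : moSpace R) (f : V -> W) (I : Type) (X : I -> I -> V) :
  cp f -> fpos X -> fpos (fun i j => f (X i j)).
Proof.
move=> fcp Xp k g; have := fcp _ _ (Xp k g).
by congr mo_pos; apply/matrixP => a b; rewrite !mxE.
Qed.

Lemma sum_only (V : nmodType) (I : finType) (i0 : I) (F : I -> V) :
  (forall i, i != i0 -> F i = 0) -> \sum_i F i = F i0.
Proof. by move=> F0; rewrite (bigD1 i0) //= big1 ?addr0. Qed.

Lemma congr_scalar (V : lmodType C) k (r : C) (X : 'M[V]_k) : 0 <= r ->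
  congr_mx (sqrtC r)%:M X = map_mx ( *:%R r) X.
Proof.
move=> r0; apply/matrixP => a b; rewrite !mxE.
rewrite (sum_only (i0 := a)) => [|c /negPf ca]; last first.
  by rewrite big1 // => d _; rewrite !mxE ca rmorph0 mul0r scale0r.
rewrite (sum_only (i0 := b)) => [|c /negPf ca]; last first.
  by rewrite !mxE ca mulr0 scale0r.
rewrite !mxE !eqxx !mulr1n; congr (_ *: _).
by rewrite geC0_conj ?sqrtC_ge0 // -expr2 sqrtCK.
Qed.

Lemma sum_mxtens (V : nmodType) k p (F : 'I_(k * p) -> V) :
  \sum_c F c = \sum_i \sum_j F (mxtens_index (i, j)).
Proof.
rewrite pair_bigA (reindex (@mxtens_index k p)) /=; last first.
  by apply/onW_bij; exists (@mxtens_unindex k p);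
    [exact: mxtens_indexK|exact: mxtens_unindexK].
by apply: eq_bigr => -[].
Qed.

Section MCone.
Variables (V : moSpace R) (Vc : mcone V).

Lemma fpos0 (I : Type) : fpos (fun _ _ : I => 0 : V).
Proof.
move=> k g; have := mcone0 Vc k.
by congr mo_pos; apply/matrixP => a b; rewrite !mxE.
Qed.

Lemma fposD (I : Type) (X Y : I -> I -> V) :
  fpos X -> fpos Y -> fpos (fun i j => X i j + Y i j).
Proof.
move=> Xp Yp k g; have := mconeD Vc (Xp k g) (Yp k g).
by congr mo_pos; apply/matrixP => a b; rewrite !mxE.
Qed.

Lemma fpos_sum (I : Type) (J : Type) (r : seq J) (P : pred J) (X : J -> I -> I -> V) :
  (forall c, P c -> fpos (X c)) -> fpos (fun i j => \sum_(c <- r | P c) X c i j).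
Proof.
move=> Xp; elim: r => [|c r ih].
  by apply: fpos_ext (@fpos0 I) _ => i j; rewrite big_nil.
have [Pc|nPc] := boolP (P c); last first.
  by apply: fpos_ext ih _ => i j; rewrite big_cons (negPf nPc).
by apply: fpos_ext (fposD (Xp c Pc) ih) _ => i j; rewrite big_cons Pc.
Qed.

Lemma fpos_congr (I : finType) (J : Type) (al : I -> J -> C) (X : I -> I -> V) :
  fpos X ->
  fpos (fun i j => \sum_c \sum_d (Num.conj (al c i) * al d j) *: X c d).
Proof.
move=> Xp k g.
have := mcone_congr Vc (\matrix_(c, a) al (enum_val c) (g a)) (Xp #|I| enum_val).
congr mo_pos; apply/matrixP => a b; rewrite !mxE.
rewrite (reindex (@enum_val I xpredT)) /=; last exact/onW_bij/enum_val_bij.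
apply: eq_bigr => c _.
rewrite [RHS](reindex (@enum_val I xpredT)) /=; last exact/onW_bij/enum_val_bij.
by apply: eq_bigr => d _; rewrite !mxE.
Qed.

Lemma mo_fpos k (X : 'M[V]_k) : mo_pos X -> fpos (fun i j => X i j).
Proof.
move=> Xp l g; have := mcone_congr Vc (\matrix_(c, a) (c == g a)%:R) Xp.
congr mo_pos; apply/matrixP => a b; rewrite !mxE.
rewrite (bigD1 (g a)) //= [X in _ + X]big1 => [|i ni]; last first.
  by rewrite big1 // => j _; rewrite !mxE (negPf ni) rmorph0 mul0r scale0r.
rewrite (bigD1 (g b)) //= big1 => [|i ni]; last first.
  by rewrite !mxE (negPf ni) mulr0 scale0r.
by rewrite !mxE !eqxx rmorph1 mulr1 scale1r !addr0.
Qed.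

(** Writing A as a Gram kernel exhibits the tensor product with X as a sum of
    congruences of X. *)
Lemma fpos_tens (I J : finType) (A : I -> I -> C) (X : J -> J -> V) :
  fpsd A -> fpos X -> fpos (fun ij kl : I * J => A ij.1 kl.1 *: X ij.2 kl.2).
Proof.
move=> /fpsd_factor[k [G GE]] Xp.
have h c : fpos (fun ij kl : I * J =>
    (Num.conj (G c ij.1) * G c kl.1) *: X ij.2 kl.2).
  pose al (d : J) (ij : I * J) := G c ij.1 * (d == ij.2)%:R.
  apply: fpos_ext (fpos_congr al Xp) _ => -[i j] [i' j'] /=.
  rewrite (bigD1 j) //= [X in _ + X]big1 => [|l nl]; last first.
    rewrite big1 // => m _.
    by rewrite /al (negPf nl) mulr0 rmorph0 mul0r scale0r.
  rewrite (bigD1 j') //= big1 => [|l nl]; last first.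
    by rewrite /al /= (negPf nl) !mulr0 scale0r.
  by rewrite /al /= !eqxx !mulr1 !addr0.
apply: fpos_ext (@fpos_sum _ _ (index_enum 'I_k) xpredT _ (fun c _ => h c)) _.
by move=> ij kl; rewrite GE scaler_suml.
Qed.

(** A block diagonal kernel is the sum of the congruences that extend each
    block by zero. *)
Lemma fpos_blockdiag (I J : finType) (X : I -> I -> V) (Y : J -> J -> V) :
  fpos X -> fpos Y -> fpos (fun s t => match s, t with
    | inl i, inl i' => X i i' | inr j, inr j' => Y j j' | _, _ => 0 end).
Proof.
move=> Xp Yp.
pose al (c : I) (s : I + J) : C := (inl c == s)%:R.
pose be (c : J) (s : I + J) : C := (inr c == s)%:R.
apply: fpos_ext (fposD (fpos_congr al Xp) (fpos_congr be Yp)) _.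
have h0 (K : finType) (h : K -> I + J) (Z : K -> K -> V) s t :
    (forall c, h c != s) ->
    \sum_c \sum_d (Num.conj (h c == s)%:R * (h d == t)%:R) *: Z c d = 0.
  by move=> hs; rewrite big1 // => c _; rewrite big1 // => d _;
    rewrite (negPf (hs c)) rmorph0 mul0r scale0r.
have h1 (K : finType) (h : K -> I + J) (Z : K -> K -> V) s t :
    (forall c, h c != t) ->
    \sum_c \sum_d (Num.conj (h c == s)%:R * (h d == t)%:R) *: Z c d = 0.
  by move=> hs; rewrite big1 // => c _; rewrite big1 // => d _;
    rewrite (negPf (hs d)) mulr0 scale0r.
have h2 (K : finType) (h : K -> I + J) (Z : K -> K -> V) k l : injective h ->
    \sum_c \sum_d (Num.conj (h c == h k)%:R * (h d == h l)%:R) *: Z c d = Z k l.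
  move=> hI; rewrite (bigD1 k) //= [X in _ + X]big1 => [|c nc]; last first.
    by rewrite big1 // => d _; rewrite (inj_eq hI) (negPf nc) rmorph0 mul0r scale0r.
  rewrite (bigD1 l) //= big1 => [|c nc]; last first.
    by rewrite !(inj_eq hI) (negPf nc) mulr0 scale0r.
  by rewrite !eqxx rmorph1 mulr1 scale1r !addr0.
move=> [i|j] [i'|j']; rewrite /al /be.
- by rewrite h2 ?h0 ?addr0 //; move=> ? ? [].
- by rewrite h1 ?h0 ?addr0.
- by rewrite h0 ?h1 ?addr0.
- by rewrite h0 ?h2 ?add0r //; move=> ? ? [].
Qed.

Lemma fpos_ampE (I : finType) p (X : I -> I -> ampMO p V) :
  fpos X <->
  fpos (fun s t : I * 'I_p =>
    (X s.1 t.1 : {ffun 'I_p * 'I_p -> V}) (s.2, t.2)).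
Proof.
split=> Xp.
  have := mo_fpos (Xp #|I| enum_val).
  move=> /(fpos_reindex (fun s : I * 'I_p => mxtens_index (enum_rank s.1, s.2))).
  by move/fpos_ext; apply=> s t; rewrite !mxE !mxtens_indexK /= !enum_rankK.
move=> k g.
have := Xp (k * p)%N (fun c => (g (mxtens_unindex c).1, (mxtens_unindex c).2)).
by rewrite /=; congr mo_pos; apply/matrixP => a b; rewrite !mxE.
Qed.

Lemma amp_mcone p : mcone (ampMO p V).
Proof.
split=> [k|k X Y|k l al X].
- have := mcone0 Vc (k * p)%N; rewrite /=; congr mo_pos.
  by apply/matrixP => a b; rewrite !mxE ffunE.
- move=> Xp Yp; have := mconeD Vc Xp Yp; rewrite /=; congr mo_pos.
  by apply/matrixP => a b; rewrite !mxE ffunE.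
move=> /mo_fpos.
move/(fpos_congr (fun (s : 'I_(k * p)) (t : 'I_(l * p)) =>
   al (mxtens_unindex s).1 (mxtens_unindex t).1 *
   ((mxtens_unindex s).2 == (mxtens_unindex t).2)%:R)) => h.
rewrite /=.
apply: fpos_mo; apply: fpos_ext h _ => s t.
rewrite mxE mxE sum_ffunE sum_mxtens.
apply: eq_bigr => i _; rewrite sum_ffunE.
rewrite (sum_only (i0 := (mxtens_unindex s).2)) => [|j nj]; last first.
  rewrite big1 // => d _; rewrite mxtens_indexK (negPf nj).
  by rewrite mulr0 rmorph0 mul0r scale0r.
rewrite sum_mxtens; apply: eq_bigr => i' _.
rewrite (sum_only (i0 := (mxtens_unindex t).2)) => [|j nj]; last first.
  by rewrite !mxtens_indexK (negPf nj) !mulr0 scale0r.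
by rewrite !mxE !mxtens_indexK /= !eqxx !mulr1 ffunE.
Qed.

End MCone.

Lemma cp_from_fpos (V W : moSpace R) (f : V -> W) : mcone V ->
  (forall (I : finType) (X : I -> I -> V), fpos X -> fpos (fun i j => f (X i j))) ->
  cp f.
Proof.
move=> Vc fp k X /(mo_fpos Vc)/fp h; apply: fpos_mo.
by apply: fpos_ext h _ => i j; rewrite mxE.
Qed.

Lemma fpos_scalarE (I : finType) p (X : I -> I -> scalarMat p) :
  fpos X <-> fpsd (fun s t : I * 'I_p => (X s.1 t.1 : 'M[C]_p) s.2 t.2).
Proof.
split=> Xp.
  have h : fpsd (fun a b => flat_mx (fun (A : 'M[C]_p) i j => A i j)
     (\matrix_(a, b) X (@enum_val I xpredT a) (enum_val b)) a b) := Xp #|I| enum_val.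
  move=> x; have /ge0_eq := fpsd_reindex (fun s : I * 'I_p =>
    mxtens_index (enum_rank s.1, s.2)) h x; apply.
  apply: eq_bigr => s _; apply: eq_bigr => t _.
  by rewrite !mxE !mxtens_indexK /= !enum_rankK.
move=> k g x /=; have /ge0_eq := fpsd_reindex (fun c : 'I_(k * p) =>
  (g (mxtens_unindex c).1, (mxtens_unindex c).2)) Xp x; apply.
by apply: eq_bigr => s _; apply: eq_bigr => t _; rewrite !mxE.
Qed.

Lemma mo_scalarP k p (X : 'M[scalarMat p]_k) :
  mo_pos X <-> fpos (fun i j => X i j).
Proof.
split; last exact: fpos_mo.
move=> Xp; apply/fpos_scalarE => x.
have /ge0_eq := fpsd_reindex (fun s : 'I_k * 'I_p => mxtens_index s)
  (A := fun a b => flat_mx (fun (A : 'M[C]_p) i j => A i j) X a b) Xp x; apply.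
apply: eq_bigr => -[i j] _; apply: eq_bigr => -[i' j'] _.
by rewrite !mxE !mxtens_indexK.
Qed.

End FPos.

(** * The order norm of an operator system *)

Section OpSys.
Context {R : realType}.
Notation C := R[i].
Variables (S : osData R) (So : is_opsys S).
Local Notation one := (os_one S).
Local Notation star := (@os_star _ S).

Lemma star0 : star 0 = 0.
Proof.
have := os_star_antilinear So 1 0 0.
by rewrite !rmorph1 !scale1r addr0 => /eqP; rewrite -subr_eq0 opprD addNKr
  oppr_eq0 => /eqP.
Qed.

Lemma starD : {morph star : x y / x + y}.
Proof.
by move=> x y; have := os_star_antilinear So 1 x y; rewrite rmorph1 !scale1r.
Qed.

Lemma starZ (c : C) (x : S) : star (c *: x) = Num.conj c *: star x.
Proof. by have := os_star_antilinear So c x 0; rewrite star0 !addr0. Qed.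

Lemma starN (x : S) : star (- x) = - star x.
Proof. by rewrite -scaleN1r starZ rmorphN1 scaleN1r. Qed.

Lemma star_sum (I : Type) (r : seq I) (P : pred I) (F : I -> S) :
  star (\sum_(i <- r | P i) F i) = \sum_(i <- r | P i) star (F i).
Proof.
by elim/big_rec2: _ => [|i u v _ <-]; [exact: star0|exact: starD].
Qed.

Lemma opsys_diag k : mo_pos (diag_one S k).
Proof.
have h0 : star_mx (0 : 'M[S]_k) = 0 by apply/matrixP => i j; rewrite !mxE star0.
have [r r0] := os_order_unit So h0; rewrite addr0.
move=> /(os_posZ So (ltW (y := r^-1) (x := 0) _)).
rewrite invr_gt0 => /(_ r0); congr mo_pos; apply/matrixP => i j; rewrite !mxE.
by rewrite scalerA mulVf ?scale1r // gt_eqF.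
Qed.

Lemma opsys_mcone : mcone S.
Proof.
split=> [k|k X Y|k l al X]; [|exact: os_posD|exact: os_pos_congr].
have := os_posZ So (lexx 0) (opsys_diag k); congr mo_pos.
by apply/matrixP => i j; rewrite !mxE scale0r.
Qed.
Let Sc := opsys_mcone.

Lemma opsys_fposZ (I : Type) (r : C) (X : I -> I -> S) : 0 <= r ->
  fpos X -> fpos (fun i j => r *: X i j).
Proof.
move=> r0 Xp k g; have := os_posZ So r0 (Xp k g); congr mo_pos.
by apply/matrixP => a b; rewrite !mxE.
Qed.

Lemma opsys_fpos_herm (I : Type) (X : I -> I -> S) i j : fpos X ->
  star (X i j) = X j i.
Proof.
move=> /(_ 2 (fun a => if a == 0 then i else j)) /(os_pos_herm So).
by move/matrixP => /(_ 1 0); rewrite !mxE.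
Qed.

Lemma opsys_fpos_one (I : finType) : fpos (fun i j : I => one *+ (i == j)).
Proof.
apply: fpos_ext (fpos_reindex enum_rank (mo_fpos Sc (opsys_diag #|I|))) _.
by move=> i j; rewrite mxE (inj_eq enum_rank_inj).
Qed.

(** Indexing by booleans makes the four entries computable by case analysis. *)
Definition near_mx (r : R) (z : S) (a b : bool) : S :=
  match a, b with
  | false, true => z
  | true, false => star z
  | _, _ => (r%:C)%C *: one
  end.

(** The condition inside the infimum that defines [os_norm]; it is easier to
    manipulate than the norm itself. *)
Definition onear (r : R) (z : S) : Prop := 0 <= r /\ fpos (near_mx r z).

(** Compressing the 2 x 2 matrix by two vectors u and v; the rotation,
    adjoint and entrywise-to-matrix estimates below are special cases. *)
Lemma onear_pair (J : Type) (u v : J -> C) r z : onear r z ->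
  fpos (fun i j => (Num.conj (u i) * u j + Num.conj (v i) * v j) *: ((r%:C)%C *: one)
     + (Num.conj (u i) * v j) *: z + (Num.conj (v i) * u j) *: star z).
Proof.
move=> [_ /(fpos_congr Sc (fun (c : bool) i => if c then v i else u i))].
move/fpos_ext; apply => i j; rewrite !big_bool /= scalerDl.
set a := _ *: _; set b := _ *: _; set c := _ *: _; set d := _ *: _.
by rewrite addrC (addrC c d) -!addrA (addrCA c).
Qed.

Lemma onearD r s z w : onear r z -> onear s w -> onear (r + s) (z + w).
Proof.
move=> [r0 zp] [s0 wp]; split; first exact: addr_ge0.
apply: fpos_ext (fposD Sc zp wp) _ => -[] [] /=; rewrite ?starD //.
all: by rewrite rmorphD scalerDl.
Qed.

Lemma onear_ge0 r z : onear r z -> 0 <= r. Proof. by case. Qed.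

Lemma onear0 r : 0 <= r -> onear r 0.
Proof.
move=> r0; split => //.
have r0' : 0 <= (r%:C)%C :> C by rewrite ler0c.
apply: fpos_ext (opsys_fposZ r0' (@opsys_fpos_one bool)) _ => -[] [] /=;
  by rewrite ?mulr1n ?mulr0n ?scaler0 ?star0.
Qed.

Lemma onear_le r s z : r <= s -> onear r z -> onear s z.
Proof.
move=> rs h; have -> : s = r + (s - r) by rewrite addrC subrK.
by rewrite -[z]addr0; apply: onearD => //; apply: onear0; rewrite subr_ge0.
Qed.

Lemma onear_phase (c : C) r z : `|c| = 1 -> onear r z -> onear r (c *: z).
Proof.
move=> c1 h; split; first by case: h.
have cc : Num.conj c * c = 1 by rewrite mulrC -normCK c1 expr1n.
have := onear_pair (fun a : bool => if a then 0 else 1)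
  (fun a : bool => if a then c else 0) h.
by move/fpos_ext; apply=> -[] [] /=;
  rewrite ?(rmorph0, rmorph1, mul0r, mul1r, mulr0, mulr1, addr0, add0r,
   scale0r, scale1r, cc, starZ).
Qed.

Lemma onearN r z : onear r z -> onear r (- z).
Proof. by rewrite -scaleN1r; apply: onear_phase; rewrite normrN1. Qed.

Lemma onearC r z w : onear r (z - w) -> onear r (w - z).
Proof. by move/onearN; rewrite opprB. Qed.

Lemma onear_star r z : onear r z -> onear r (star z).
Proof.
move=> h; split; first by case: h.
have := fpos_reindex negb (proj2 h).
by move/fpos_ext; apply=> -[] [] //=; rewrite (os_starK So).
Qed.

Lemma onearZ (c : C) r z : onear r z -> onear (complex.Re `|c| * r) (c *: z).
Proof.
have c0 : 0 <= complex.Re `|c| by rewrite -ler0c RRe_real.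
move=> h; have rr := onear_ge0 h.
have [->|cn] := eqVneq c 0; first by rewrite scale0r normr0 mul0r; apply: onear0.
have c1 : `|c / `|c| | = 1 by rewrite normf_div normr_id divff ?normr_eq0.
have [_ hp] := onear_phase c1 h.
split; first exact: mulr_ge0.
have cE : (((complex.Re `|c|) * r)%:C)%C = `|c| * (r%:C)%C :> C.
  by rewrite rmorphM; congr (_ * _); apply: RRe_real.
have e1 : `|c| * (c / `|c|) = c by rewrite mulrC divfK // normr_eq0.
have e2 : `|c| * Num.conj (c / `|c|) = Num.conj c.
  by rewrite -{1}(geC0_conj (normr_ge0 c)) -rmorphM e1.
apply: fpos_ext (opsys_fposZ (normr_ge0 c) hp) _ => -[] []; rewrite /near_mx.
all: by rewrite ?cE ?starZ ?scalerA ?scalerA ?e2 ?e1.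
Qed.

Lemma onear_ex z : exists r, onear r z.
Proof.
pose X : 'M[S]_2 := \matrix_(a, b)
  (if a == b then 0 else if (a < b)%N then z else star z).
have Xh : star_mx X = X.
  apply/matrixP => a b; rewrite !mxE eq_sym.
  have [|ab] := eqVneq a b; first by rewrite star0.
  by case: ltngtP => // [_|/ord_inj/eqP]; rewrite ?(os_starK So) // eq_sym (negPf ab).
have [r r0] := os_order_unit So Xh.
move=> /(mo_fpos Sc)/(fpos_reindex (fun b : bool => if b then 1 else 0)) h.
exists (complex.Re r).
have rE : ((complex.Re r)%:C)%C = r by rewrite RRe_real // gtr0_real.
split; first by rewrite -ler0c rE ltW.
apply: fpos_ext h _ => -[] []; rewrite !mxE /= ?addr0 ?scaler0 ?add0r ?rE //.
Qed.

Lemma os_norm_lt z (e : R) : os_norm z < e <-> exists2 r, r < e & onear r z.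
Proof.
rewrite /os_norm; set A := [set r | _].
have AE r : A r <-> onear r z.
  split=> -[r0].
    move=> /(mo_fpos Sc)/(fpos_reindex (fun b : bool => if b then 1 else 0)) h.
    by split=> //; apply: fpos_ext h _ => -[] []; rewrite !mxE.
  move=> h; split => //; have := h 2 (fun a => a == 1).
  congr mo_pos; apply/matrixP => a b; rewrite !mxE.
  by case: a => -[|[]] // ?; case: b => -[|[]] // ?.
have Al : has_lbound A by exists 0 => r [].
have An : A !=set0 by have [r /AE h] := onear_ex z; exists r.
split=> [|[r re /AE Ar]]; last by apply: le_lt_trans re; exact: ge_inf.
by move/(inf_lt An) => [r /AE]; exists r.
Qed.

(** The archimedean axiom lets e tend to 0; the 2 x 2 matrices with zero
    diagonal and corners z and - z are then both positive, and opposite. *)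
Lemma onear_eq0 z : (forall e : R, 0 < e -> onear e z) -> z = 0.
Proof.
pose X w : 'M[S]_2 := \matrix_(a, b) near_mx 0 w (a == 1) (b == 1).
suff X0 w : (forall e : R, 0 < e -> onear e w) -> mo_pos (X w).
  move=> h; have h' e : 0 < e -> onear e (- z) by move/h/onearN.
  have h0 := X0 _ h; have h1 := X0 _ h'.
  have : X z = 0.
    apply: (os_pos_proper So h0); move: h1; congr mo_pos; apply/matrixP => a b.
    by rewrite !mxE; case: (a == 1); case: (b == 1);
      rewrite /= ?scale0r ?oppr0 ?starN.
  by move/matrixP/(_ 0 1); rewrite !mxE.
move=> h; apply: (os_archimedean So).
  apply/matrixP => a b; rewrite !mxE.
  by case: (a == 1); case: (b == 1);
      rewrite /= ?scale0r ?star0 ?(os_starK So).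
move=> r r0; have rE : ((complex.Re r)%:C)%C = r by rewrite RRe_real // gtr0_real.
have [|_ hr] := h (complex.Re r); first by rewrite -ltcR rE.
have := hr 2 (fun a => a == 1).
congr mo_pos; apply/matrixP => a b; rewrite !mxE.
by case: a => -[|[]] // ?; case: b => -[|[]] // ?; rewrite /= ?rE ?scale0r ?scaler0 ?addr0 ?add0r.
Qed.

(** Place the 2 x 2 matrix with corner Z a b in rows and columns a, b and sum
    over all a, b: each diagonal place is hit 2 k times, and each entry of Z
    twice, once through Z a b and once through the adjoint of Z b a. *)
Lemma onear_mx k (Z : 'M[S]_k) (r : R) : star_mx Z = Z ->
  (forall a b, onear r (Z a b)) ->
  mo_pos (map_mx ( *:%R (k%:R * r)%:C%C) (diag_one S k) + Z).
Proof.
move=> Zh Zn.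
pose e (a : 'I_k) (i : 'I_k) : C := (a == i)%:R.
have h : fpos (fun i j => \sum_ab ((Num.conj (e ab.1 i) * e ab.1 j +
     Num.conj (e ab.2 i) * e ab.2 j) *: ((r%:C)%C *: one)
     + (Num.conj (e ab.1 i) * e ab.2 j) *: Z ab.1 ab.2
     + (Num.conj (e ab.2 i) * e ab.1 j) *: star (Z ab.1 ab.2))).
  by apply: (fpos_sum Sc) => ab _; apply: onear_pair.
have h2 : 0 <= 2^-1 :> C by rewrite invr_ge0 ler0n.
apply: fpos_mo; apply: fpos_ext (opsys_fposZ h2 h) _ => i j.
rewrite !mxE -(pair_bigA _ (fun a b => (Num.conj (e a i) * e a j +
     Num.conj (e b i) * e b j) *: ((r%:C)%C *: one)
     + (Num.conj (e a i) * e b j) *: Z a b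
     + (Num.conj (e b i) * e a j) *: star (Z a b))) /=.
have eE a b : Num.conj (e a i) * e b j = ((a == i) && (b == j))%:R.
  by rewrite /e rmorph_nat -natrM mulnb.
under eq_bigr do under eq_bigr do rewrite !eE.
under eq_bigr do rewrite !big_split /=.
rewrite !big_split /=.
have -> : \sum_a \sum_b ((a == i) && (b == j))%:R *: Z a b = Z i j.
  rewrite (sum_only (i0 := i)) => [|a /negPf ->]; last first.
    by rewrite big1 // => b _; rewrite scale0r.
  rewrite (sum_only (i0 := j)) => [|a /negPf ->]; last by rewrite andbF scale0r.
  by rewrite !eqxx scale1r.
have -> : \sum_a \sum_b ((b == i) && (a == j))%:R *: star (Z a b) = Z i j.
  rewrite (sum_only (i0 := j)) => [|a /negPf ->]; last first.
    by rewrite big1 // => b _; rewrite andbF scale0r.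
  rewrite (sum_only (i0 := i)) => [|a /negPf ->]; last by rewrite scale0r.
  by rewrite !eqxx scale1r -[in RHS]Zh !mxE.
have -> : \sum_a \sum_b (((a == i) && (a == j))%:R + ((b == i) && (b == j))%:R) *:
    ((r%:C)%C *: one) = 2 *: ((k%:R * r)%:C%C *: (one *+ (i == j))).
  have cnt : \sum_(a < k) \sum_(b < k) ((a == i) && (a == j))%:R
      = k%:R * (i == j)%:R :> C.
    rewrite (sum_only (i0 := i)) => [|a /negPf ->]; last first.
      by rewrite big1.
    by rewrite eqxx sumr_const card_ord -[_ *+ k]mulr_natl.
  under eq_bigr do rewrite -scaler_suml; rewrite -scaler_suml.
  under eq_bigr do rewrite big_split /=; rewrite big_split /= cnt.
  rewrite exchange_big /= cnt -[one *+ _]scaler_nat !scalerA; congr (_ *: _).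
  by rewrite [(_ * _)%:C%C]rmorphM /= rmorph_nat; ring.
rewrite -addrA -mulr2n -[Z i j *+ 2]scaler_nat -scalerDr scalerA.
by rewrite mulVf ?scale1r // pnatr_eq0.
Qed.

End OpSys.

(** * Closed cones, matrix amplifications *)

Section ClosedCones.
Context {R : realType}.
Notation C := R[i].

(** The cones are closed in the order norm: the archimedean axiom absorbs the
    error, which [onear_mx] bounds by a small multiple of the unit. *)
Lemma opsys_closed (S : osData R) (So : is_opsys S) k (Y : 'M[S]_k) :
  (forall e : R, 0 < e -> exists2 X : 'M[S]_k, mo_pos X &
     forall a b, onear e (X a b - Y a b)) -> mo_pos Y.
Proof.
move=> Yl.
have Yh : star_mx Y = Y.
  apply/matrixP => a b; rewrite !mxE; apply/eqP; rewrite -subr_eq0; apply/eqP.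
  apply: (onear_eq0 So) => e e0.
  have e2 : 0 < e / 2 by rewrite divr_gt0.
  have [X /(os_pos_herm So)/matrixP/(_ a b) + h] := Yl _ e2; rewrite !mxE => Xp.
  have := onearD So (h a b) (onearN So (onear_star So (h b a))).
  rewrite -splitr.
  by rewrite (starD So) (starN So) Xp opprB addrC addrA subrK.
apply: (os_archimedean So) => // r r0.
have rE : ((complex.Re r)%:C)%C = r by rewrite RRe_real // gtr0_real.
have r0' : 0 < complex.Re r by rewrite -ltcR rE.
(* r = k e + e: k e pays for the error, and k.+1 avoids dividing by 0 *)
pose e := complex.Re r / k.+1%:R.
have e0 : 0 < e by rewrite divr_gt0.
have [X Xp h] := Yl _ e0.
have Zh : star_mx (Y - X) = Y - X.
  move/matrixP: (os_pos_herm So Xp) => Xh; move/matrixP: Yh => Yh.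
  apply/matrixP => a b; have := Xh a b; have := Yh a b; rewrite !mxE => Yab Xab.
  by rewrite (starD So) (starN So) Yab Xab.
have Zp : mo_pos (map_mx ( *:%R (k%:R * e)%:C%C) (diag_one S k) + (Y - X)).
  by apply: (onear_mx So) => // a b; rewrite !mxE; apply/(onearC So)/h.
have e0' : 0 <= e%:C%C :> C by rewrite ler0c ltW.
have := os_posD So (os_posD So (os_posZ So e0' (opsys_diag So k)) Zp) Xp.
congr mo_pos; rewrite -addrA -[_ + (Y - X) + X]addrA subrK addrA; congr (_ + _).
apply/matrixP => a b; rewrite !mxE -scalerDl -rmorphD /=; congr (_ *: _).
rewrite -[in RHS]rE; congr (_%:C)%C; rewrite /e.
by rewrite -{1}[_ / _]mul1r -mulrDl addrC natr1 mulrC divfK.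
Qed.

(** A completely positive map is bounded by any c with f 1 <= c 1. *)
Lemma onear_cp (S T : osData R) (So : is_opsys S) (To : is_opsys T)
    (f : {linear S -> T}) : cp f ->
  exists2 c : R, 0 <= c & forall r z, onear r z -> onear (c * r) (f z).
Proof.
move=> fcp.
pose one_f := f (os_one S).
have f1p : fpos (fun i j : bool => one_f *+ (i == j)).
  apply: fpos_ext (cp_fpos fcp (@opsys_fpos_one _ _ So bool)) _ => i j.
  by rewrite raddfMn.
have f1h : os_star one_f = one_f by have := opsys_fpos_herm To true true f1p.
pose X : 'M[T]_1 := \matrix_(_, _) - one_f.
have Xh : star_mx X = X by apply/matrixP => a b; rewrite !mxE (starN To) f1h.
have [c c0 /(mo_fpos (opsys_mcone To)) cp1] := os_order_unit To Xh.
have cE : ((complex.Re c)%:C)%C = c by rewrite RRe_real // gtr0_real.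
have c0' : 0 <= complex.Re c by rewrite -ler0c cE ltW.
have cp2 : fpos (fun i j : bool => (c *: os_one T - one_f) *+ (i == j)).
  have h : fpsd (fun i j : bool => (i == j)%:R : C).
    move=> x; rewrite !big_bool /= !(mulr1, mulr0, mul0r, addr0, add0r).
    by rewrite addr_ge0 // mulrC mul_conjC_ge0.
  have := fpos_tens (opsys_mcone To) h cp1.
  move/(fpos_reindex (fun b : bool => (b, ord0))).
  by move/fpos_ext; apply => i j; rewrite !mxE /= scaler_nat.
exists (complex.Re c) => // r z [r0 zp]; split; first exact: mulr_ge0.
have r0' : 0 <= (r%:C)%C :> C by rewrite ler0c.
have h := fposD (opsys_mcone To) (cp_fpos fcp zp) (opsys_fposZ To r0' cp2).
have fs : f (os_star z) = os_star (f z).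
  have := opsys_fpos_herm To false true (cp_fpos fcp zp).
  by rewrite /= => <-.
have rc : ((complex.Re c * r)%:C)%C = (r%:C)%C * c.
  by rewrite rmorphM /= mulrC; congr (_ * _); exact: cE.
have f1E : f ((r%:C)%C *: os_one S) = (r%:C)%C *: one_f by rewrite linearZ.
apply: fpos_ext h _ => -[] []; rewrite /near_mx ?f1E ?fs ?rc.
all: by rewrite ?mulr1n ?mulr0n ?scaler0 ?addr0 // scalerBr scalerA addrC subrK.
Qed.

Lemma amp_opsys (S : osData R) p : is_opsys S -> is_opsys (ampOS p S).
Proof.
move=> So.
pose flat k (X : 'M[ampOS p S]_k) : 'M[S]_(k * p) :=
  flat_mx (fun (A : {ffun 'I_p * 'I_p -> S}) i j => A (i, j)) X.
have flatI k (X Y : 'M[ampOS p S]_k) : flat k X = flat k Y -> X = Y.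
  move=> XY; apply/matrixP => a b; apply/ffunP => -[i j].
  have /matrixP/(_ (mxtens_index (a, i)) (mxtens_index (b, j))) := XY.
  by rewrite !mxE !mxtens_indexK.
have flatD k (X Y : 'M[ampOS p S]_k) : flat k (X + Y) = flat k X + flat k Y.
  by apply/matrixP => a b; rewrite !mxE ffunE.
have flatN k (X : 'M[ampOS p S]_k) : flat k (- X) = - flat k X.
  by apply/matrixP => a b; rewrite !mxE ffunE.
have flatZ k r (X : 'M[ampOS p S]_k) :
    flat k (map_mx ( *:%R r) X) = map_mx ( *:%R r) (flat k X).
  by apply/matrixP => a b; rewrite !mxE ffunE.
have flat1 k : flat k (diag_one (ampOS p S) k) = diag_one S (k * p).
  apply/matrixP => a b; rewrite !mxE.
  rewrite (_ : (a == b) = ((mxtens_unindex a).1 == (mxtens_unindex b).1) &&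
      ((mxtens_unindex a).2 == (mxtens_unindex b).2)); last first.
    rewrite -xpair_eqE -!surjective_pairing.
    by rewrite (can_eq (@mxtens_unindexK k p)).
  by case: (_ == _); rewrite ?mulr0n ?mulr1n ffunE.
have flat_star k (X : 'M[ampOS p S]_k) : flat k (star_mx X) = star_mx (flat k X).
  by apply/matrixP => a b; rewrite !mxE ffunE.
have flat_herm k (X : 'M[ampOS p S]_k) : star_mx X = X -> star_mx (flat k X) = flat k X.
  by move=> Xh; rewrite -flat_star Xh.
have Ac := amp_mcone (opsys_mcone So) p.
split.
- move=> a x y; apply/ffunP => ij; rewrite !ffunE.
  exact: (os_star_antilinear So).
- move=> x; apply/ffunP => -[i j]; rewrite !ffunE /=; exact: (os_starK So).
- move=> k X Xp; apply: flatI; rewrite flat_star; exact: (os_pos_herm So Xp).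
- exact: (mconeD Ac).
- move=> k r X r0 Xp; rewrite [mo_pos _]/(mo_pos (flat _ _)) flatZ.
  exact: (os_posZ So).
- move=> k X Xp Xn; apply: flatI.
  have -> : flat k 0 = 0 by apply/matrixP => a b; rewrite !mxE ffunE.
  apply: (os_pos_proper So Xp); rewrite -flatN; exact: Xn.
- exact: (mcone_congr Ac).
- apply/ffunP => -[i j]; rewrite !ffunE /= eq_sym.
  by case: (_ == _); rewrite ?mulr0n ?mulr1n ?(star0 So) ?(os_one_herm So).
- move=> k X Xh; have [r r0 rp] := os_order_unit So (flat_herm _ _ Xh).
  by exists r => //; rewrite [mo_pos _]/(mo_pos (flat _ _)) flatD flatZ flat1.
- move=> k X Xh Xp; apply: (os_archimedean So (flat_herm _ _ Xh)) => r r0.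
  have : mo_pos (flat _ (map_mx ( *:%R r) (diag_one (ampOS p S) k) + X)) := Xp r r0.
  by rewrite flatD flatZ flat1.
Qed.

End ClosedCones.

(** * A finite Hahn-Banach theorem *)

Section Sublinear.
Context {R : realType}.
Notation C := R[i].
Variable V : lmodType C.
Local Notation "t *' x" := ((t%:C)%C *: x) (at level 40).

Record sublinear (q : V -> R) : Prop := Sublinear {
  sublinearD : forall x y, q (x + y) <= q x + q y;
  sublinearZ : forall t x, 0 <= t -> q (t *' x) <= t * q x }.

Lemma sublinear_0 q : sublinear q -> q 0 = 0.
Proof.
move=> qs; apply/eqP; rewrite eq_le; apply/andP; split.
  by have := sublinearZ qs 0 (lexx 0); rewrite scaler0 mul0r.
by have := sublinearD qs 0 0; rewrite addr0 -[X in X <= _]addr0 lerD2l.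
Qed.

Lemma sublinearZE q t x : sublinear q -> 0 <= t -> q (t *' x) = t * q x.
Proof.
move=> qs; rewrite le0r => /predU1P[->|t0].
  by rewrite scale0r mul0r sublinear_0.
apply/eqP; rewrite eq_le (sublinearZ qs _ (ltW t0)) /=.
have ti : 0 <= t^-1 by rewrite invr_ge0 ltW.
have := sublinearZ qs (t *' x) ti.
by rewrite scalerA -rmorphM mulVf ?gt_eqF // rmorph1 scale1r ler_pdivlMl.
Qed.

Lemma sublinear_subr q x y : sublinear q -> q x - q y <= q (x - y).
Proof. by move=> qs; have := sublinearD qs (x - y) y; rewrite subrK lerBlDr. Qed.

(** The largest sublinear functional below q whose value at - v is at most
    - q v. *)
Definition sub_step (v : V) (q : V -> R) (x : V) : R :=
  inf [set q (x + t *' v) - t * q v | t in [set t | 0 <= t]].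

Lemma sub_stepP v q : sublinear q ->
  [/\ sublinear (sub_step v q), forall x, sub_step v q x <= q x &
      sub_step v q (- v) <= - q v].
Proof.
move=> qs.
pose A x := [set q (x + t *' v) - t * q v | t in [set t | 0 <= t]].
have An x : A x !=set0 by exists (q (x + 0 *' v) - 0 * q v), 0 => /=.
have Al x : has_lbound (A x).
  exists (- q (- x)) => _ [t t0 <-].
  have e : x + t *' v - x = t *' v by rewrite addrC addKr.
  by have := sublinearD qs (x + t *' v) (- x); rewrite e (sublinearZE v qs t0); lra.
have leA x t : 0 <= t -> sub_step v q x <= q (x + t *' v) - t * q v.
  by move=> t0; apply: (ge_inf (Al x)); exists t.
have geA x c : (forall t, 0 <= t -> c <= q (x + t *' v) - t * q v) ->
    c <= sub_step v q x.
  by move=> h; apply: (lb_le_inf (An x)) => _ [t t0 <-]; exact: h.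
have leq x : sub_step v q x <= q x.
  by have := leA x 0 (lexx 0); rewrite scale0r addr0 mul0r subr0.
split=> //; last first.
  by have := leA (- v) 1 ler01; rewrite rmorph1 scale1r addNr mul1r sublinear_0 // sub0r.
split=> [x y|s x s0].
  rewrite -lerBlDr; apply: (geA) => t t0; rewrite lerBlDr -lerBlDl.
  apply: (geA) => u u0; rewrite lerBlDl.
  have := leA (x + y) (t + u) (addr_ge0 t0 u0); move/le_trans; apply.
  rewrite rmorphD scalerDl addrACA.
  have := sublinearD qs (x + t *' v) (y + u *' v); lra.
have [->|sn] := eqVneq s 0.
  by rewrite rmorph0 scale0r mul0r; have := leq 0; rewrite (sublinear_0 qs).
have sp : 0 < s by rewrite lt_def sn.
rewrite mulrC -ler_pdivrMr //; apply: (geA) => t t0; rewrite ler_pdivrMr //.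
have := leA (s *' x) (s * t) (mulr_ge0 s0 t0); move/le_trans; apply.
rewrite rmorphM -scalerA -scalerDr.
have := sublinearZ qs (x + t *' v) s0; lra.
Qed.

Lemma sub_chain (vs : seq V) q : sublinear q ->
  exists q', [/\ sublinear q', forall x, q' x <= q x &
     forall v, v \in vs -> q' (- v) <= - q' v].
Proof.
elim: vs q => [|v vs ih] q qs; first by exists q; split.
have [ss sle sv] := sub_stepP v qs.
have [q' [qs' le' q'v]] := ih _ ss.
exists q'; split=> // [x|w]; first exact: le_trans (le' x) (sle x).
rewrite inE => /orP[/eqP->|/q'v //].
apply: le_trans (le' _) _; apply: le_trans sv _.
by rewrite lerN2; exact: le_trans (le' _) (sle _).
Qed.

(** One step per element of a spanning list makes the functional linear;
    starting with x0 keeps the value there.  The span hypothesis is phrased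
    as an induction principle because V is a complex space, whereas the
    combinations are real. *)
Lemma hahn_banach_span (vs : seq V) q x0 : sublinear q ->
  (forall P : V -> Prop, (forall v, v \in vs -> P v) -> P 0 ->
     (forall x y, P x -> P y -> P (x + y)) ->
     (forall t x, P x -> P (t *' x)) -> forall x, P x) ->
  exists g : V -> R, [/\ forall x y, g (x + y) = g x + g y,
    forall t x, g (t *' x) = t * g x, forall x, g x <= q x & g x0 = q x0].
Proof.
move=> qs span.
have [ss sle sv] := sub_stepP x0 qs.
have [g [gs le' gv]] := sub_chain vs ss.
pose lin v := g (- v) <= - g v.
have linE v : lin v -> g (- v) = - g v.
  move=> lv; apply/eqP; rewrite eq_le (lv : g (- v) <= - g v) /=.
  by have := sublinear_subr 0 v gs; rewrite sublinear_0 // !sub0r.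
have linD v w : lin v -> g (w + v) = g w + g v.
  move=> lv; apply/eqP; rewrite eq_le (sublinearD gs) /=.
  by have := sublinearD gs (w + v) (- v); rewrite addrK (linE _ lv); lra.
have linZ v t : lin v -> lin (t *' v) /\ g (t *' v) = t * g v.
  move=> lv.
  have pos s w : lin w -> 0 <= s -> lin (s *' w) /\ g (s *' w) = s * g w.
    move=> lw s0; have h := sublinearZ gs w s0.
    have := sublinearZ gs (- w) s0; rewrite scalerN linE // => h2.
    have := sublinear_subr 0 (s *' w) gs; rewrite sublinear_0 // !sub0r => h3.
    split; first by rewrite /lin; lra.
    by apply/eqP; rewrite eq_le; apply/andP; split; lra.
  have linN w : lin w -> lin (- w).
    by move=> lw; rewrite /lin opprK (linE _ lw) opprK.
  have [t0|t0] := leP 0 t; first exact: pos.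
  have [|h1 h2] := pos (- t) (- v) (linN _ lv); first by rewrite oppr_ge0 ltW.
  have tE : (- t) *' (- v) = t *' v by rewrite rmorphN scaleNr scalerN opprK.
  by rewrite -tE; split=> //; rewrite h2 linE // mulrNN.
have linall x : lin x.
  apply: (span lin) => // [|y z ly lz|t y ly]; last exact: (linZ _ _ ly).1.
    by rewrite /lin oppr0 (sublinear_0 gs) oppr0.
  have lnz : lin (- z) by rewrite /lin opprK (linE _ lz) opprK.
  have e1 : g (y + z) = g y + g z by apply: linD.
  have e2 : g (- y - z) = g (- y) + g (- z) by apply: linD.
  by rewrite /lin opprD e1 e2 (linE _ ly) (linE _ lz); lra.
exists g; split=> [x y|t x|x|]; first exact: linD.
- exact: (linZ _ _ (linall x)).2.
- exact: le_trans (le' x) (sle x).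
- apply/eqP; rewrite eq_le (le_trans (le' _) (sle _)) /=.
  by have := le_trans (le' (- x0)) sv; rewrite linE // lerN2.
Qed.

End Sublinear.

(** * Positive functionals separate points *)

Section Separation.
Context {R : realType}.
Notation C := R[i].
Variables (S : osData R) (So : is_opsys S).
Local Notation one := (os_one S).
Local Notation star := (@os_star _ S).
Local Notation "t *' x" := ((t%:C)%C *: x) (at level 40).

Definition pos1 (x : S) : Prop := fpos (fun _ _ : unit => x).

Lemma pos1D x y : pos1 x -> pos1 y -> pos1 (x + y).
Proof. by move=> xp yp; exact: (fposD (opsys_mcone So) xp yp). Qed.

Lemma pos1Z (r : C) x : 0 <= r -> pos1 x -> pos1 (r *: x).
Proof. by move=> r0 xp; exact: (opsys_fposZ So r0 xp). Qed.

Lemma pos1_one : pos1 one.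
Proof.
by apply: fpos_ext (@opsys_fpos_one _ _ So unit) _ => -[] []; rewrite eqxx mulr1n.
Qed.

Lemma pos1_proper x : pos1 x -> pos1 (- x) -> x = 0.
Proof.
move=> /(_ 1 (fun=> tt)) xp /(_ 1 (fun=> tt)) xn.
have : \matrix_(_ < 1, _ < 1) x = 0.
  apply: (os_pos_proper So xp); move: xn; congr mo_pos.
  by apply/matrixP => a b; rewrite !mxE.
by move/matrixP/(_ 0 0); rewrite !mxE.
Qed.

Lemma pos1_mo x : mo_pos (\matrix_(_ < 1, _ < 1) x) -> pos1 x.
Proof.
move/(mo_fpos (opsys_mcone So))/(fpos_reindex (fun _ : unit => 0)).
by move/fpos_ext; apply => ? ?; rewrite mxE.
Qed.

Lemma pos1_unit x : star x = x -> exists2 r : R, 0 <= r & pos1 (r *' one + x).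
Proof.
move=> xh.
have Xh : star_mx (\matrix_(_ < 1, _ < 1) x) = \matrix_(_ < 1, _ < 1) x.
  by apply/matrixP => a b; rewrite !mxE.
have [r r0 rp] := os_order_unit So Xh.
have rE : ((complex.Re r)%:C)%C = r by rewrite RRe_real // gtr0_real.
exists (complex.Re r); first by rewrite -ler0c rE ltW.
apply: pos1_mo; move: rp; congr mo_pos; apply/matrixP => a b.
by rewrite !mxE !ord1 eqxx mulr1n; congr (_ *: _ + _).
Qed.

Lemma pos1_arch x : star x = x ->
  (forall r : R, 0 < r -> pos1 (r *' one + x)) -> pos1 x.
Proof.
move=> xh xp; apply: pos1_mo; apply: (os_archimedean So).
  by apply/matrixP => a b; rewrite !mxE.
move=> r r0; have rE : ((complex.Re r)%:C)%C = r by rewrite RRe_real // gtr0_real.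
have := xp (complex.Re r); rewrite -ltcR rE => /(_ r0 1 (fun=> tt)).
congr mo_pos; apply/matrixP => a b; rewrite !mxE !ord1 eqxx mulr1n.
by congr (_ *: _ + _).
Qed.

Definition os_re (x : S) : S := 2^-1 *: (x + star x).

Lemma os_re_herm x : star (os_re x) = os_re x.
Proof.
by rewrite /os_re (starZ So) (starD So) (os_starK So) addrC fmorphV rmorph_nat.
Qed.

Lemma os_reD x y : os_re (x + y) = os_re x + os_re y.
Proof. by rewrite /os_re -scalerDr (starD So) addrACA. Qed.

Lemma os_reZ (t : R) x : os_re (t *' x) = t *' os_re x.
Proof.
rewrite /os_re (starZ So) (CrealP _) ?complex_real //.
by rewrite -scalerDr !scalerA mulrC.
Qed.

Lemma os_reN x : os_re (- x) = - os_re x.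
Proof. by rewrite /os_re (starN So) -opprD scalerN. Qed.

Lemma os_re_id x : star x = x -> os_re x = x.
Proof.
by move=> xh; rewrite /os_re xh -mulr2n -[x *+ 2]scaler_nat scalerA mulVf ?scale1r.
Qed.

Lemma os_re_im x : x = os_re x - 'i *: os_re ('i *: x).
Proof.
rewrite /os_re (starZ So) conjCi !scalerA !scalerDr !scalerA.
have -> : 'i / 2 * 'i = - 2^-1 :> C by rewrite mulrAC -expr2 sqrCi mulN1r.
have -> : 'i / 2 * - 'i = 2^-1 :> C.
  by rewrite mulrN mulrAC -expr2 sqrCi mulN1r opprK.
rewrite opprD scaleNr opprK addrACA subrr addr0 -scalerDl -[LHS]scale1r.
by congr (_ *: _); field.
Qed.

Lemma pos1_ge0 (t : R) : one != 0 -> pos1 (t *' one) -> 0 <= t.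
Proof.
move=> o0 tp; rewrite leNgt; apply/negP => t0; move/eqP: o0; apply.
have nt : 0 <= ((- t^-1)%:C)%C :> C by rewrite ler0c oppr_ge0 invr_le0 ltW.
apply: (pos1_proper pos1_one); have := pos1Z nt tp.
by rewrite scalerA -rmorphM mulNr mulVf ?lt_eqF // rmorphN rmorph1 scaleN1r.
Qed.

Definition os_gauge (x : S) : R := inf [set s : R | pos1 (s *' one - os_re x)].

(** The hypothesis excludes the zero space, where every s is admissible and
    the infimum is meaningless. *)
Lemma os_gaugeP : one != 0 ->
  [/\ sublinear os_gauge,
      forall x, pos1 (- os_re x) -> os_gauge x <= 0 &
      forall x, os_gauge x <= 0 -> pos1 (- os_re x)].
Proof.
move=> o0.
pose A x := [set s : R | pos1 (s *' one - os_re x)].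
have An x : A x !=set0.
  have [|r r0 h] := @pos1_unit (- os_re x); last by exists r.
  by rewrite (starN So) os_re_herm.
have Al x : has_lbound (A x).
  have [r r0 rp] := pos1_unit (os_re_herm x).
  exists (- r) => s /(pos1D rp).
  by rewrite addrACA subrr addr0 -scalerDl -rmorphD => /(pos1_ge0 o0); lra.
have gA x s : A x s -> os_gauge x <= s by move=> xs; exact: (ge_inf (Al x)).
have gN x : pos1 (- os_re x) -> os_gauge x <= 0.
  by move=> h; apply: gA; rewrite /A /= rmorph0 scale0r add0r.
split=> //; last first.
  move=> x x0; apply: pos1_arch; first by rewrite (starN So) os_re_herm.
  move=> r r0; have : os_gauge x < r by exact: le_lt_trans r0.
  move/(inf_lt (An x)) => [s sx sr].
  have rs : 0 <= ((r - s)%:C)%C :> C by rewrite ler0c subr_ge0 ltW.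
  have := pos1D (pos1Z rs pos1_one) sx.
  by rewrite addrA -scalerDl -rmorphD subrK.
split=> [x y|t x].
  rewrite -lerBlDr; apply: (lb_le_inf (An x)) => s sx.
  rewrite lerBlDr -lerBlDl; apply: (lb_le_inf (An y)) => u uy.
  rewrite lerBlDl; apply: gA; have := pos1D sx uy.
  by rewrite /A /= os_reD rmorphD scalerDl opprD addrACA.
rewrite le0r => /predU1P[->|t0].
  by rewrite mul0r; apply: gN; rewrite os_reZ rmorph0 scale0r oppr0;
    have := pos1Z (lexx 0) pos1_one; rewrite scale0r.
rewrite mulrC -ler_pdivrMr //; apply: (lb_le_inf (An x)) => s sx.
rewrite ler_pdivrMr //; apply: gA.
have t0' : 0 <= (t%:C)%C :> C by rewrite ler0c ltW.
have := pos1Z t0' sx.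
by rewrite /A /= os_reZ scalerBr scalerA -rmorphM mulrC.
Qed.

(** If x is nonzero, the gauge is positive at one of x, -x, 'i x, -'i x; extend
    from there to a real functional g below the gauge, and complexify by
    g z - 'i g ('i z). *)
Lemma pos1_separate (x : S) : x != 0 ->
  exists f : {linear S -> C^o}, f x != 0 /\ forall y, pos1 y -> 0 <= f y.
Proof.
move=> x0.
have o0 : one != 0.
  apply: contra x0 => /eqP o0.
  have h0 z : star z = z -> z = 0.
    move=> zh; have [r _] := pos1_unit zh; rewrite o0 scaler0 add0r => zp.
    have zh' : star (- z) = - z by rewrite (starN So) zh.
    have [s _] := pos1_unit zh'; rewrite o0 scaler0 add0r.
    exact: pos1_proper.
  apply/eqP; rewrite (os_re_im x) (h0 _ (os_re_herm x)).
  by rewrite (h0 _ (os_re_herm _)) scaler0 subr0.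
have [ps pN Np] := os_gaugeP o0.
(* otherwise the real and imaginary parts of x vanish by properness *)
have [y [y1 y0]] : exists y, (y = x \/ y = - x \/ y = 'i *: x \/ y = - ('i *: x))
    /\ 0 < os_gauge y.
  apply: contrapT => h; move/eqP: x0; apply.
  have {}h y : (y = x \/ y = - x \/ y = 'i *: x \/ y = - ('i *: x)) ->
      pos1 (- os_re y).
    by move=> yx; apply: Np; rewrite leNgt; apply/negP => y0; apply: h; exists y.
  have h2 y : pos1 (- os_re y) -> pos1 (- os_re (- y)) -> os_re y = 0.
    by rewrite os_reN opprK => yn yp; apply: pos1_proper.
  have e1 : os_re x = 0 by apply: h2; apply: h; [left|right; left].
  have e2 : os_re ('i *: x) = 0.
    by apply: h2; apply: h; right; right; [left|right].
  by rewrite (os_re_im x) e1 e2 scaler0 subr0.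
pose vs := [seq vbas i | i : 'I_(dim S)] ++ [seq 'i *: vbas (S := S) i | i : 'I_(dim S)].
have span (P : S -> Prop) : (forall v, v \in vs -> P v) -> P 0 ->
    (forall x y, P x -> P y -> P (x + y)) ->
    (forall t z, P z -> P (t *' z)) -> forall z, P z.
  move=> Pv P0 PD PZ z.
  rewrite (vbas_sum z); elim/big_rec: _ => // i w _ Pw; apply: (PD) => //.
  rewrite [X in X *: _]complexE scalerDl; apply: (PD).
    by apply: PZ; apply: Pv; rewrite mem_cat map_f ?mem_enum.
  rewrite mulrC -scalerA; apply: PZ; apply: Pv.
  by rewrite mem_cat [X in _ || X]map_f ?mem_enum ?orbT.
have [g [gD gZ gp gy]] := hahn_banach_span y ps span.
pose f (z : S) : C := (g z)%:C%C - 'i * (g ('i *: z))%:C%C.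
have fZ (t : R) z : f (t *' z) = (t%:C)%C * f z.
  have -> : f (t *' z) = (g (t *' z))%:C%C - 'i * (g (t *' ('i *: z)))%:C%C.
    by rewrite /f; congr (_ - _ * (g _)%:C%C); rewrite !scalerA mulrC.
  by rewrite !gZ !rmorphM /f; ring.
have fi z : f ('i *: z) = 'i * f z.
  have -> : f ('i *: z) = (g ('i *: z))%:C%C - 'i * (g ((-1) *' z))%:C%C.
    by rewrite /f scalerA -expr2 sqrCi rmorphN rmorph1.
  have i2 : 'i * 'i = -1 :> C by rewrite -expr2 sqrCi.
  by rewrite gZ rmorphM rmorphN rmorph1 /f mulrBr (mulrA 'i 'i) i2; ring.
have fD z w : f (z + w) = f z + f w.
  by rewrite /f scalerDr !gD !rmorphD /=; ring.
have flin : linear (f : S -> C^o).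
  move=> c z w; rewrite fD; congr (_ + _).
  rewrite [c in LHS]complexE complexiE scalerDl fD fZ -scalerA fi fZ.
  by rewrite [c in RHS]complexE complexiE /GRing.scale /=; ring.
pose F := HB.pack (f : S -> C^o) (GRing.isLinear.Build C S C^o *:%R f flin) : {linear S -> C^o}.
exists F; split; last first.
  move=> z zp; have zh : star z = z := opsys_fpos_herm So tt tt zp.
  have g0 w : os_re w = 0 -> g w <= 0.
    move=> w0; apply: le_trans (gp _) _; apply: pN; rewrite w0 oppr0.
    by have := pos1Z (lexx 0) pos1_one; rewrite scale0r.
  have gN w : g (- w) = - g w.
    by have := gZ (-1) w; rewrite rmorphN rmorph1 scaleN1r mulN1r.
  have iz0 : os_re ('i *: z) = 0.
    by rewrite /os_re (starZ So) zh conjCi scaleNr subrr scaler0.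
  have giz : g ('i *: z) = 0.
    apply/eqP; rewrite eq_le g0 //= -oppr_le0 -gN g0 // os_reN iz0 oppr0 //.
  rewrite /F /= /f giz rmorph0 mulr0 subr0 ler0c -oppr_le0 -gN.
  apply: le_trans (gp _) _; apply: pN.
  by rewrite os_reN opprK os_re_id.
have fy : f y != 0.
  apply: contraTneq y0 => fy0; rewrite -gy -leNgt.
  have /(congr1 (@complex.Re R)) : f y = 0 := fy0.
  by rewrite /f -complexiE /= !(mul0r, mul1r, subr0, mulr0, oppr0, addr0) => ->.
apply: contra fy => /eqP fx0; have {}fx0 : f x = 0 := fx0.
have fN w : f (- w) = - f w by have := fZ (-1) w; rewrite rmorphN rmorph1 scaleN1r mulN1r.
by case: y1 => [|[|[]]] ->; rewrite ?fN ?fi fx0 ?mulr0 ?oppr0.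
Qed.

End Separation.

(** * Finite sums of a Hilbert space *)

Section HilbertSum.
Context {R : realType}.
Notation C := R[i].
Variable H : hilbert R.
Local Notation ip := (hs_ip H).

Lemma ipC (x y : H) : ip y x = Num.conj (ip x y).
Proof. by rewrite (hermC (hs_ip H)) expr0 mul1r. Qed.

Lemma ipZl c (x y : H) : ip (c *: x) y = c * ip x y.
Proof. exact: linearZl_LR. Qed.

Lemma ipZr c (x y : H) : ip x (c *: y) = Num.conj c * ip x y.
Proof. exact: linearZr_LR. Qed.

Lemma ip_suml I (r : seq I) (P : pred I) (F : I -> H) y :
  ip (\sum_(i <- r | P i) F i) y = \sum_(i <- r | P i) ip (F i) y.
Proof. exact: linear_sumlz. Qed.

Lemma ip_sumr I (r : seq I) (P : pred I) (F : I -> H) y :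
  ip y (\sum_(i <- r | P i) F i) = \sum_(i <- r | P i) ip y (F i).
Proof. exact: linear_sumr. Qed.

Lemma ip_ge0 (x : H) : 0 <= ip x x.
Proof. by rewrite hs_normE exprn_ge0. Qed.

Lemma ip_eq0 (x : H) : ip x x = 0 -> x = 0.
Proof. by rewrite hs_normE => /eqP; rewrite expf_eq0 /= normr_eq0 => /eqP. Qed.

Variable k : nat.
Implicit Types x y z : 'I_k -> H.

Definition hip x y : C := \sum_a ip (x a) (y a).

Definition mxact (M : 'M[C]_k) x : 'I_k -> H := fun a => \sum_b M a b *: x b.

Lemma hipC x y : hip y x = Num.conj (hip x y).
Proof. by rewrite /hip rmorph_sum; apply: eq_bigr => a _; exact: ipC. Qed.

Lemma hipDl x y z : hip (fun a => x a + y a) z = hip x z + hip y z.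
Proof. by rewrite -big_split; apply: eq_bigr => a _; exact: linearDl. Qed.

Lemma hipDr x y z : hip z (fun a => x a + y a) = hip z x + hip z y.
Proof. by rewrite -big_split; apply: eq_bigr => a _; exact: linearDr. Qed.

Lemma hipZl c x y : hip (fun a => c *: x a) y = c * hip x y.
Proof. by rewrite mulr_sumr; apply: eq_bigr => a _; exact: ipZl. Qed.

Lemma hipZr c x y : hip x (fun a => c *: y a) = Num.conj c * hip x y.
Proof. by rewrite mulr_sumr; apply: eq_bigr => a _; exact: ipZr. Qed.

Lemma hip_ge0 x : 0 <= hip x x.
Proof. by apply: sumr_ge0 => a _; exact: ip_ge0. Qed.

Lemma hip_eq0 x : hip x x = 0 -> forall a, x a = 0.
Proof.
move/eqP; rewrite psumr_eq0 => [/allP h a|a _]; last exact: ip_ge0.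
by apply/ip_eq0/eqP; apply: h; rewrite mem_index_enum.
Qed.

Lemma hip_l2norm x : hip x x = ((l2norm x ^+ 2)%:C)%C.
Proof.
rewrite sqr_sqrtr ?sumr_ge0 // => [|a _]; last exact: sqr_ge0.
rewrite rmorph_sum; apply: eq_bigr => a _.
by rewrite hs_normE rmorphXn /= RRe_real.
Qed.

Lemma l2norm_ge0 x : 0 <= l2norm x. Proof. exact: sqrtr_ge0. Qed.

Lemma l2norm_le x y : (l2norm x <= l2norm y) = (hip x x <= hip y y).
Proof. by rewrite !hip_l2norm lecR ler_sqr ?nnegrE ?l2norm_ge0. Qed.

Lemma l2normZ (t : R) x : 0 <= t -> l2norm (fun a => (t%:C)%C *: x a) = t * l2norm x.
Proof.
move=> t0; apply/eqP; rewrite -(eqrXn2 (n := 2)) ?mulr_ge0 ?l2norm_ge0 //.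
apply/eqP/(@complexI R); rewrite -hip_l2norm hipZl hipZr (CrealP _) ?complex_real //.
by rewrite hip_l2norm -!rmorphM; congr (_%:C)%C; ring.
Qed.

Lemma coord_l2norm x a : complex.Re `|x a| <= l2norm x.
Proof.
have h : 0 <= complex.Re `|x a| by rewrite -ler0c RRe_real.
rewrite -ler_sqr ?nnegrE ?l2norm_ge0 // sqr_sqrtr ?sumr_ge0 // => [|b _].
  rewrite (bigD1 a) //= lerDl sumr_ge0 // => b _; exact: sqr_ge0.
exact: sqr_ge0.
Qed.

Lemma hip_mxact M x y :
  hip (mxact M x) y = hip x (mxact (map_mx Num.conj M)^T y).
Proof.
rewrite /hip /mxact; under eq_bigr do rewrite ip_suml.
rewrite exchange_big; apply: eq_bigr => b _; rewrite ip_sumr.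
by apply: eq_bigr => a _; rewrite ipZl ipZr !mxE conjCK.
Qed.

Lemma mxact_mul M N x : mxact (M *m N) x = mxact M (mxact N x).
Proof.
apply/funext => a; rewrite /mxact.
under eq_bigr do rewrite mxE scaler_suml.
rewrite exchange_big; apply: eq_bigr => b _; rewrite scaler_sumr.
by apply: eq_bigr => c _; rewrite scalerA.
Qed.

Lemma mxact1 x : mxact 1%:M x = x.
Proof.
apply/funext => a; rewrite /mxact (sum_only (i0 := a)) => [|b ba].
  by rewrite mxE eqxx scale1r.
by rewrite mxE eq_sym (negPf ba) scale0r.
Qed.

Lemma mxactD M N x : mxact (M + N) x = (fun a => mxact M x a + mxact N x a).
Proof.
by apply/funext => a; rewrite /mxact -big_split; apply: eq_bigr => b _; rewrite mxE scalerDl.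
Qed.

Lemma mxact_scalar c x : mxact c%:M x = (fun a => c *: x a).
Proof.
rewrite -scalemx1 /mxact; apply/funext => a.
rewrite -[in RHS](mxact1 x) /mxact scaler_sumr; apply: eq_bigr => b _.
by rewrite !mxE scalerA.
Qed.

Lemma amp_op_mx n (e : 'I_n -> {linear H -> H}) (A : 'I_n -> 'M[C]_k)
    (M N : 'M[C]_k) x :
  amp_op (fun i => e i) (fun i => M *m A i *m N) x =
  mxact M (amp_op (fun i => e i) A (mxact N x)).
Proof.
have h (B : 'M[C]_k) i y a :
    \sum_b (M *m B *m N) a b *: e i (y b) = \sum_b M a b *:
      (\sum_c B b c *: e i (mxact N y c)).
  transitivity (mxact (M *m B *m N) (fun b => e i (y b)) a) => //.
  rewrite !mxact_mul; congr (mxact _ (mxact _ _) _); apply/funext => c.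
  by rewrite /mxact linear_sum; apply: eq_bigr => b _; rewrite linearZ.
apply/funext => a; rewrite /amp_op /mxact; under eq_bigr do rewrite h.
rewrite exchange_big; apply: eq_bigr => b _; rewrite scaler_sumr.
by apply: eq_bigr.
Qed.

Lemma amp_op_adj n (e f : 'I_n -> {linear H -> H}) (A : 'I_n -> 'M[C]_k) x y :
  (forall i u v, ip (e i u) v = ip u (f i v)) ->
  hip (amp_op (fun i => e i) A x) y =
  hip x (amp_op (fun i => f i) (fun i => (map_mx Num.conj (A i))^T) y).
Proof.
move=> ef; rewrite /hip /amp_op.
under eq_bigr do (rewrite ip_suml; under eq_bigr do rewrite ip_suml).
under [RHS]eq_bigr do (rewrite ip_sumr; under eq_bigr do rewrite ip_sumr).
rewrite exchange_big [RHS]exchange_big; apply: eq_bigr => i _.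
rewrite exchange_big; apply: eq_bigr => b _; apply: eq_bigr => a _.
by rewrite ipZl ipZr !mxE conjCK ef.
Qed.

End HilbertSum.

(** * Contractions in OH(n) *)

Section OHNorm.
Context {R : realType}.
Notation C := R[i].
Variables (n : nat) (E : OHrep R n) (k : nat).
Local Notation amp A := (amp_op (fun i => oh_e E i) A).

Lemma oh_e_bound i : exists K : R, 0 <= K /\
  forall u : E, complex.Re `|oh_e E i u| <= K * complex.Re `|u|.
Proof.
have := (linear_bounded_continuous (oh_e E i)).2 (@oh_e_bounded _ _ E i).
move/(linear_boundedP (oh_e E i)).1.
move/pinfty_ex_gt0 => [K K0 h].
have KE : ((complex.Re K)%:C)%C = K by rewrite RRe_real // gtr0_real.
exists (complex.Re K); split; first by rewrite -ler0c KE ltW.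
move=> u; rewrite -lecR rmorphM /= KE !RRe_real //; exact: h.
Qed.

(** Needed because [sup] of an unbounded set is 0. *)
Lemma amp_bound (A : 'I_n -> 'M[C]_k) : exists K : R,
  forall x : 'I_k -> E, l2norm x <= 1 -> l2norm (amp A x) <= K.
Proof.
have [K Kp] := choice oh_e_bound.
pose M a := \sum_i \sum_b complex.Re `|A i a b| * K i.
exists (Num.sqrt (\sum_a (M a) ^+ 2)) => x x1.
rewrite /l2norm ler_sqrt; last by rewrite sumr_ge0 // => a _; exact: sqr_ge0.
apply: ler_sum => a _.
have h0 (z : C) : 0 <= complex.Re `|z| by rewrite -ler0c RRe_real.
have h0' (z : E) : 0 <= complex.Re `|z| by rewrite -ler0c RRe_real.
have hM : complex.Re `|amp A x a| <= M a.
  rewrite -lecR RRe_real // rmorph_sum.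
  apply: le_trans (ler_norm_sum _ _ _) _; apply: ler_sum => i _.
  rewrite rmorph_sum; apply: le_trans (ler_norm_sum _ _ _) _.
  apply: ler_sum => b _; rewrite normrZ.
  have e : ((complex.Re `|A i a b| * K i)%:C)%C = `|A i a b| * ((K i)%:C)%C.
    by rewrite rmorphM; congr (_ * _); exact: RRe_real.
  rewrite -[X in _ <= X]/((complex.Re `|A i a b| * K i)%:C)%C e.
  rewrite ler_wpM2l // -[`|oh_e _ _ _|]RRe_real // lecR.
  apply: le_trans ((Kp i).2 _) _; rewrite ler_piMr ?(Kp i).1 //.
  exact: le_trans (coord_l2norm _ _) x1.
by rewrite ler_sqr ?nnegrE // (le_trans _ hM).
Qed.

Definition ampcontr (A : 'I_n -> 'M[C]_k) : Prop :=
  forall x : 'I_k -> E, l2norm (amp A x) <= l2norm x.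

(** By Pisier's formula, whether sum_i A_i (x) e_i is a contraction does not
    depend on the chosen copy of OH(n). *)
Lemma ampcontrP (A : 'I_n -> 'M[C]_k) :
  ampcontr A <-> mx_opnorm (\sum_i (A i *t map_mx Num.conj (A i))) <= 1.
Proof.
have amp0 : amp A (fun=> 0) = (fun=> 0).
  apply/funext => a; rewrite /amp_op big1 // => i _.
  by rewrite big1 // => b _; rewrite linear0 scaler0.
have l20 : l2norm (fun _ : 'I_k => 0 : E) = 0.
  by rewrite /l2norm big1 ?sqrtr0 // => a _; rewrite normr0 /= expr0n.
have -> : (mx_opnorm (\sum_i (A i *t map_mx Num.conj (A i))) <= 1) =
    (l2opnorm (amp A) <= 1).
  by rewrite oh_norm -[in RHS]sqrtr1 ler_sqrt.
pose B := [set l2norm (amp A x) | x in [set x : 'I_k -> E | l2norm x <= 1]].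
have Bn : B !=set0 by exists (l2norm (amp A (fun=> 0))), (fun=> 0) => //=; rewrite l20.
split=> [h|h x].
  by apply: (ge_sup Bn) => _ [x x1 <-]; exact: le_trans (h x) x1.
have Bu : has_ubound B.
  by have [K Kp] := amp_bound A; exists K => _ [y y1 <-]; exact: Kp.
have [x0|x0] := eqVneq (l2norm x) 0.
  have xE : x = fun=> 0.
    by apply/funext => a; apply: (hip_eq0 (x := x)); rewrite hip_l2norm x0 expr0n.
  by rewrite xE amp0.
have xp : 0 < l2norm x by rewrite lt_def x0 l2norm_ge0.
have si : 0 <= (l2norm x)^-1 by rewrite invr_ge0 ltW.
have ampZ (t : R) : amp A (fun a => (t%:C)%C *: x a) = fun a => (t%:C)%C *: amp A x a.
  apply/funext => a; rewrite /amp_op scaler_sumr; apply: eq_bigr => i _.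
  rewrite scaler_sumr; apply: eq_bigr => b _.
  by rewrite linearZ scalerA mulrC -scalerA.
have : l2norm (amp A (fun a => ((l2norm x)^-1%:C)%C *: x a)) <= 1.
  apply: le_trans h; apply: (ub_le_sup Bu).
  by eexists; [|reflexivity]; rewrite /= l2normZ // mulVf.
by rewrite ampZ l2normZ // ler_pdivrMl // mulr1.
Qed.

End OHNorm.

(** * Positivity in SOH(n) *)

Section SOHPos.
Context {R : realType}.
Notation C := R[i].

Lemma ge0_of_eps (q h : C) : 0 <= h ->
  (forall e : R, 0 < e -> 0 <= q + (e%:C)%C * h) -> 0 <= q.
Proof.
case: q h => a b [c d]; rewrite lecE /= => /andP[/eqP d0 c0] h.
have hE e : 0 < e -> b = 0 /\ 0 <= a + e * c.
  move=> /h; rewrite lecE /= d0 !mul0r mulr0 subr0 !addr0.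
  by case/andP => /eqP -> ->.
rewrite lecE /= (hE 1 ltr01).1 eqxx /=; apply/ler_addgt0Pr => e e0.
have c1 : 0 < c + 1 by rewrite ltr_wpDl.
have [|_] := hE (e / (c + 1)); first by rewrite divr_gt0.
move/le_trans; apply; rewrite lerD2l mulrAC ler_pdivrMr // ler_pM2l //; lra.
Qed.

Lemma conjmx_trK k l (M : 'M[C]_(k, l)) :
  (map_mx Num.conj (map_mx Num.conj M)^T)^T = M.
Proof. by apply/matrixP => i j; rewrite !mxE conjCK. Qed.

(** Adding e to a positive semidefinite matrix makes its square root
    invertible, which allows A_0 to be normalized to 1. *)
Lemma posdef_factor k (A : 'M[C]_k) (e : R) : 0 < e -> fpsd (fun i j => A i j) ->
  exists2 G : 'M[C]_k, G \in unitmx & A + ((e%:C)%C)%:M = (map_mx Num.conj G)^T *m G.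
Proof.
move=> e0 Ap; set B := A + _.
have e0' : 0 < (e%:C)%C :> C by rewrite ltcR.
have BE x : \sum_i \sum_j Num.conj (x i) * B i j * x j =
    \sum_i \sum_j Num.conj (x i) * A i j * x j + (e%:C)%C * \sum_i Num.conj (x i) * x i.
  rewrite mulr_sumr -big_split; apply: eq_bigr => i _ /=.
  under eq_bigr do rewrite !mxE mulrDr mulrDl.
  rewrite big_split /=; congr (_ + _); rewrite (sum_only (i0 := i)) => [|j ji].
    by rewrite eqxx mulr1n; ring.
  by rewrite eq_sym (negPf ji) mulr0n mulr0 mul0r.
have xx0 (x : 'I_k -> C) i : 0 <= Num.conj (x i) * x i by rewrite mulrC mul_conjC_ge0.
have Bp : fpsd (fun i j => B i j).
  move=> x; rewrite BE addr_ge0 // mulr_ge0 ?(ltW e0') // sumr_ge0 //.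
have [G GE] := psd_factor Bp; exists G => //.
rewrite unitmxE unitfE; apply/negP => /eqP G0.
have /det0P[v v0 vB] : \det B == 0 by rewrite GE det_mulmx G0 mulr0.
move/eqP: v0; apply; pose x i := Num.conj (v 0 i).
have : \sum_i \sum_j Num.conj (x i) * B i j * x j = 0.
  rewrite exchange_big big1 // => j _; rewrite -mulr_suml.
  have /matrixP/(_ 0 j) := vB; rewrite !mxE => vBj.
  rewrite [X in X * _](_ : _ = 0) ?mul0r // -[RHS]vBj.
  by apply: eq_bigr => i _; rewrite conjCK.
rewrite BE => /eqP; rewrite paddr_eq0 ?Ap // => [|]; last first.
  by rewrite mulr_ge0 ?(ltW e0') // sumr_ge0.
case/andP => _; rewrite mulf_eq0 gt_eqF //= psumr_eq0 // => /allP h.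
apply/rowP => i; rewrite mxE.
have := h i; rewrite mem_index_enum => /(_ isT).
by rewrite mulf_eq0 !conjC_eq0 orbb => /eqP.
Qed.

Section OneRep.
Variables (n : nat) (E : OHrep R n).
Local Notation amp A := (amp_op (fun i => oh_e E i) A).
Local Notation ampadj A := (amp_op (fun i => oh_e_adj E i) A).
Local Notation ip := (hs_ip E).

Lemma oh_adjE' i (x y : E) : ip (oh_e_adj E i x) y = ip x (oh_e E i y).
Proof. by rewrite ipC -oh_adjE -ipC. Qed.

Lemma soh_op1 u (z : E * E) : (soh_op u z).1 =
  u 0 ord0 *: z.1 + \sum_i u 0 (lift ord0 i) *: oh_e E i z.2.
Proof.
rewrite /soh_op (raddf_sum (@fst E E)) big_ord_recl /= /soh_gen unlift_none.
by congr (_ + _); apply: eq_bigr => i _; rewrite liftK.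
Qed.

Lemma soh_op2 u (z : E * E) : (soh_op u z).2 =
  u 0 ord0 *: z.2 + \sum_i u 0 (lift ord0 i) *: oh_e_adj E i z.1.
Proof.
rewrite /soh_op (raddf_sum (@snd E E)) big_ord_recl /= /soh_gen unlift_none.
by congr (_ + _); apply: eq_bigr => i _; rewrite liftK.
Qed.

Definition soh_coef0 m k (X : 'M['rV[C]_m.+1]_k) : 'M[C]_k :=
  \matrix_(a, b) X a b 0 ord0.
Definition soh_coef m k (X : 'M['rV[C]_m.+1]_k) (i : 'I_m) : 'M[C]_k :=
  \matrix_(a, b) X a b 0 (lift ord0 i).

Section Mx.
Variables (k : nat) (X : 'M['rV[C]_n.+1]_k).
Let A0 := soh_coef0 X.
Let A := soh_coef X.

(** The quadratic form of sum_i A_i (x) H_i at the vector (x, y) of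
    H^k (+) H^k. *)
Definition soh_form (x y : 'I_k -> E) : C :=
  hip (mxact A0 x) x + hip (mxact A0 y) y +
  (hip (amp A y) x + hip (ampadj A x) y).

Lemma soh_posE : mo_pos (X : 'M[SOH E]_k) <-> forall x y, 0 <= soh_form x y.
Proof.
have QE z : \sum_a \sum_b ip2 (soh_op (X a b) (z b)) (z a) =
    soh_form (fun a => (z a).1) (fun a => (z a).2).
  rewrite /soh_form /hip -!big_split; apply: eq_bigr => a _ /=.
  rewrite /mxact /amp_op [X in _ + (_ (X : E) _ + _)]exchange_big.
  rewrite [X in _ + (_ + _ (X : E) _)]exchange_big.
  rewrite !ip_suml -!big_split; apply: eq_bigr => b _ /=.
  rewrite /ip2 soh_op1 soh_op2 !linearDl /= !mxE.
  rewrite [RHS]addrACA; congr (_ + _ + (_ + _)).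
    by congr (ip _ _); apply: eq_bigr => i _; rewrite mxE.
  by congr (ip _ _); apply: eq_bigr => i _; rewrite mxE.
split=> h.
  by move=> x y; have := h (fun a => (x a, y a)); rewrite QE.
by move=> z; rewrite QE.
Qed.

Hypothesis n_gt0 : (0 < n)%N.
Hypothesis Xp : mo_pos (X : 'M[SOH E]_k).

Lemma oh_nontrivial : exists u : E, 0 < ip u u.
Proof.
apply: contrapT => h.
have E0 (u : E) : u = 0.
  have := ip_ge0 u; rewrite le0r => /orP[/eqP/ip_eq0 //|u0].
  by exfalso; apply: h; exists u.
have /(_ (Ordinal n_gt0))/eqP := @OHrep_coord_eq0 _ _ E (fun=> 1) (fun y => E0 _).
by rewrite oner_eq0.
Qed.

Lemma hip0l (x : 'I_k -> E) : hip (fun=> 0 : E) x = 0 :> C.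
Proof. by rewrite /hip big1 // => a _; exact: linear0l. Qed.

Lemma hip0r (x : 'I_k -> E) : hip x (fun=> 0 : E) = 0 :> C.
Proof. by rewrite /hip big1 // => a _; exact: linear0r. Qed.

(** Evaluate the form at vectors (c_a u, 0). *)
Lemma soh_coef0_psd : fpsd (fun a b => A0 a b).
Proof.
have [u u0] := oh_nontrivial; move=> c.
have := soh_posE.1 Xp (fun a => c a *: u) (fun=> 0).
rewrite /soh_form !hip0r !addr0.
have -> : amp A (fun=> 0) = (fun=> 0).
  apply/funext => a; rewrite /amp_op big1 // => i _.
  by rewrite big1 // => b _; rewrite linear0 scaler0.
rewrite hip0l addr0 => h; rewrite -(pmulr_lge0 _ u0); apply: ge0_eq h _.
rewrite mulr_suml; apply: eq_bigr => a _; rewrite ip_suml mulr_suml.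
by apply: eq_bigr => b _; rewrite scalerA ipZl ipZr; ring.
Qed.

(** A form with real values is hermitian, so sum_i A_i (x) e_i and
    sum_i (adjoint of A_i) (x) e_i coincide; then e_1, ..., e_n are linearly
    independent. *)
Lemma soh_coef_herm i : (map_mx Num.conj (A i))^T = A i.
Proof.
pose B i := (map_mx Num.conj (A i))^T.
have AB (x y : 'I_k -> E) : hip x (amp B y) = hip x (amp A y).
  have h := soh_posE.1 Xp.
  have z0 : mxact A0 (fun=> 0 : E) = (fun=> 0).
    by apply/funext => a; rewrite /mxact big1 // => b _; rewrite scaler0.
  have am0 : ampadj A (fun=> 0) = (fun=> 0).
    apply/funext => a; rewrite /amp_op big1 // => j _.
    by rewrite big1 // => b _; rewrite linear0 scaler0.
  have r0 (w : 'I_k -> E) : hip (mxact A0 w) w \is Num.real.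
    by have := h (fun=> 0) w; rewrite /soh_form am0 z0 !hip0r !hip0l add0r !addr0 => /ger0_real.
  have iE (w : 'I_k -> E) : mxact A0 (fun a => 'i *: w a) = fun a => 'i *: (mxact A0 w a) :> E.
    apply/funext => a; rewrite /mxact scaler_sumr; apply: eq_bigr => b _.
    by rewrite !scalerA mulrC.
  have aE : amp A (fun a => 'i *: y a) = fun a => 'i *: amp A y a.
    apply/funext => a; rewrite /amp_op scaler_sumr; apply: eq_bigr => j _.
    rewrite scaler_sumr; apply: eq_bigr => b _.
    by rewrite linearZ !scalerA mulrC.
  have := @polar_conj _ _ _ _ _ (r0 x) (r0 y) (ger0_real (h x y)).
  have := ger0_real (h x (fun a => 'i *: y a)).
  rewrite /soh_form iE aE hipZl hipZl !hipZr conjCi mulrA mulrN -expr2 sqrCi opprK mul1r.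
  rewrite mulNr => h1 /(_ h1).
  rewrite -hipC => <-.
  by rewrite (amp_op_adj _ _ _ oh_adjE').
have ampAB (y : 'I_k -> E) a : amp B y a = amp A y a.
  apply/eqP; rewrite -subr_eq0; apply/eqP.
  pose d a : E := amp B y a - amp A y a.
  apply: (hip_eq0 (x := d)).
  have -> : d = fun a => amp B y a + (-1) *: amp A y a.
    by apply/funext => c; rewrite scaleN1r.
  by rewrite hipDr hipZr AB rmorphN1 mulN1r subrr.
apply/matrixP => a b; apply/eqP; rewrite -subr_eq0; apply/eqP.
pose c i := B i a b - A i a b.
apply: (@OHrep_coord_eq0 _ _ E c _ i) => v.
have := ampAB (fun b' => if b' == b then v else 0) a.
have ampE D : amp D (fun b' => if b' == b then v else 0) a = \sum_j D j a b *: oh_e E j v.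
  apply: eq_bigr => j _; rewrite (sum_only (i0 := b)) ?eqxx // => b' /negPf ->.
  by rewrite linear0 scaler0.
rewrite !ampE => /eqP; rewrite -subr_eq0 -sumrB => /eqP h; rewrite -[RHS]h.
by apply: eq_bigr => j _; rewrite scalerBl.
Qed.

End Mx.

(** With A_0 + e = (adjoint of G) G and K the inverse of G, the change of
    variables by K turns the form perturbed by e into that of the operator
    matrix with 1 on the diagonal and sum_i (adjoint of K) A_i K (x) e_i off
    the diagonal. *)
Lemma soh_form_subst k (X : 'M['rV[C]_n.+1]_k) (e : R) (G K : 'M[C]_k)
    (xi eta : 'I_k -> E) (v := amp (fun i => (map_mx Num.conj K)^T *m soh_coef X i *m K) eta) :
  (forall i, (map_mx Num.conj (soh_coef X i))^T = soh_coef X i) ->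
  G *m K = 1%:M ->
  soh_coef0 X + ((e%:C)%C)%:M = (map_mx Num.conj G)^T *m G ->
  soh_form X (mxact K xi) (mxact K eta) + (e%:C)%C *
    (hip (mxact K xi) (mxact K xi) + hip (mxact K eta) (mxact K eta)) =
  hip xi xi + hip eta eta + (hip v xi + Num.conj (hip v xi)).
Proof.
move=> Xh GK1 GE; set u := hip v xi; set x := mxact K xi; set y := mxact K eta.
have hK (z : 'I_k -> E) : hip (mxact (soh_coef0 X) (mxact K z)) (mxact K z) +
    (e%:C)%C * hip (mxact K z) (mxact K z) = hip z z.
  have GK : mxact G (mxact K z) = z by rewrite -mxact_mul GK1 mxact1.
  have := hip_mxact (map_mx Num.conj G)^T (mxact G (mxact K z)) (mxact K z).
  rewrite conjmx_trK -mxact_mul -GE GK => <-; rewrite mxactD.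
  by rewrite mxact_scalar hipDl hipZl.
have uE : hip (amp (soh_coef X) y) x = u.
  rewrite /u /v amp_op_mx hip_mxact; congr (hip _ (mxact _ _)).
  by rewrite conjmx_trK.
have vE : hip (ampadj (soh_coef X) x) y = Num.conj u.
  rewrite -uE -hipC (amp_op_adj _ _ _ oh_adjE'); congr (hip _ (amp_op _ _ _)).
  by apply/funext.
rewrite /soh_form uE vE -(hK xi) -(hK eta) -/x -/y; ring.
Qed.

End OneRep.

(** An operator matrix with diagonal 1 and corner v is positive iff v is a
    contraction, so after the normalization of [soh_form_subst] positivity
    depends only on the tensor sum_i A_i (x) conj(A_i), by [ampcontrP]. *)
Lemma soh_transfer n N (E : OHrep R n) (F : OHrep R N) k
    (X : 'M['rV[C]_n.+1]_k) (Y : 'M['rV[C]_N.+1]_k) :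
  (0 < n)%N -> soh_coef0 Y = soh_coef0 X ->
  ((forall i, (map_mx Num.conj (soh_coef X i))^T = soh_coef X i) ->
    forall j, (map_mx Num.conj (soh_coef Y j))^T = soh_coef Y j) ->
  \sum_j (soh_coef Y j *t map_mx Num.conj (soh_coef Y j)) =
    \sum_i (soh_coef X i *t map_mx Num.conj (soh_coef X i)) ->
  mo_pos (X : 'M[SOH E]_k) -> mo_pos (Y : 'M[SOH F]_k).
Proof.
move=> n0 YX0 XhYh YX Xp.
have Xh := soh_coef_herm Xp; have {XhYh} Yh := XhYh Xh.
apply/soh_posE => x y.
apply: (@ge0_of_eps _ (hip x x + hip y y)); first by rewrite addr_ge0 ?hip_ge0.
move=> e e0; have [G Gu GE] := posdef_factor e0 (soh_coef0_psd n0 Xp).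
have GX : soh_coef0 X + ((e%:C)%C)%:M = (map_mx Num.conj G)^T *m G.
  by rewrite -GE; congr (_ + _); apply/matrixP => a b; rewrite !mxE.
pose K := invmx G; have GK : G *m K = 1%:M by exact: mulmxV.
pose Ks := (map_mx Num.conj K)^T.
pose CX i := Ks *m soh_coef X i *m K; pose CY j := Ks *m soh_coef Y j *m K.
have tensE m (B : 'I_m -> 'M[C]_k) :
    \sum_i ((Ks *m B i *m K) *t map_mx Num.conj (Ks *m B i *m K)) =
    (Ks *t map_mx Num.conj Ks) *m (\sum_i (B i *t map_mx Num.conj (B i))) *m
    (K *t map_mx Num.conj K).
  rewrite mulmx_sumr mulmx_suml; apply: eq_bigr => i _.
  by rewrite !map_mxM !tensmx_mul.
(* at xi = - v, where v is the image of w, the form is |w|^2 - |v|^2 *)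
have cX : ampcontr E CX.
  move=> w; rewrite l2norm_le -subr_ge0.
  set v := amp_op _ _ _.
  have Xf := soh_posE E X; have := soh_form_subst (fun a => (-1) *: v a) w Xh GK GX.
  rewrite -/Ks -/CX -/v hipZr hipZl hipZr rmorphN1 => h.
  have : 0 <= (-1) * (-1 * hip v v) + hip w w +
     (-1 * hip v v + Num.conj (-1 * hip v v)).
    rewrite -h addr_ge0 ?(Xf.1 Xp) // mulr_ge0 ?addr_ge0 ?hip_ge0 //.
    by rewrite ler0c ltW.
  have cv : Num.conj (-1 * hip v v) = -1 * hip v v.
    by rewrite rmorphM rmorphN1 [in RHS](hipC v v).
  by rewrite cv => h2; apply: ge0_eq h2 _; ring.
have cY : ampcontr F CY.
  apply/ampcontrP; rewrite /CY tensE YX -tensE; exact: (ampcontrP E CX).1 cX.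
have GY : soh_coef0 Y + ((e%:C)%C)%:M = (map_mx Num.conj G)^T *m G by rewrite YX0.
have := soh_form_subst (mxact G x) (mxact G y) Yh GK GY.
rewrite -!mxact_mul mulVmx // !mxact1 => ->.
set xi := mxact G x; set eta := mxact G y.
rewrite -/Ks -/CY; set v := amp_op _ _ _.
(* complete the square: |xi + v|^2 + (|eta|^2 - |v|^2) *)
have := hip_ge0 (fun a => xi a + v a); rewrite hipDl !hipDr => h1.
have h2 : 0 <= hip eta eta - hip v v by rewrite subr_ge0 -l2norm_le; exact: cY.
by apply: ge0_eq (addr_ge0 h1 h2) _; rewrite [hip xi v]hipC; ring.
Qed.

Lemma SOH_mcone n (E : OHrep R n) : mcone (SOH E).
Proof.
have opZ c (x y : 'rV[C]_n.+1) z : soh_op (E := E) (c *: x + y) z =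
    c *: soh_op x z + soh_op y z.
  rewrite /soh_op scaler_sumr -big_split; apply: eq_bigr => i _ /=.
  by rewrite !mxE scalerDl scalerA.
have ip2l c (u v w : E * E) : ip2 (c *: u + v) w = c * ip2 u w + ip2 v w.
  rewrite /ip2.
  have -> : hs_ip E (c *: u + v).1 w.1 = c * hs_ip E u.1 w.1 + hs_ip E v.1 w.1.
    exact: linearPl.
  have -> : hs_ip E (c *: u + v).2 w.2 = c * hs_ip E u.2 w.2 + hs_ip E v.2 w.2.
    exact: linearPl.
  ring.
have ip2C (u v : E * E) : ip2 v u = Num.conj (ip2 u v).
  by rewrite /ip2 rmorphD [hs_ip E v.1 _]ipC [hs_ip E v.2 _]ipC.
have opZz (x : 'rV[C]_n.+1) c u v : soh_op (E := E) x (c *: u + v) =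
    c *: soh_op x u + soh_op x v.
  rewrite /soh_op scaler_sumr -big_split; apply: eq_bigr => i _ /=.
  rewrite /soh_gen; case: unlift => [j|]; last first.
    by rewrite scalerDr !scalerA mulrC.
  apply/pair_equal_spec; split => /=.
    by rewrite linearP scalerDr !scalerA mulrC.
  by rewrite linearP scalerDr !scalerA mulrC.
have op0 x : soh_op (E := E) x 0 = 0.
  by have := opZz x (-1) 0 0; rewrite scaler0 addr0 scaleN1r addNr.
have op0x z : soh_op (E := E) 0 z = 0.
  by have := opZ (-1) 0 0 z; rewrite scaler0 addr0 scaleN1r addNr.
have ip20 w : ip2 (0 : E * E) w = 0.
  by have := ip2l (-1) 0 0 w; rewrite scaler0 addr0 mulN1r addNr.
have op_sum (I : Type) (r : seq I) (c : I -> C) (z : I -> E * E) x :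
    soh_op (E := E) x (\sum_(i <- r) c i *: z i) = \sum_(i <- r) c i *: soh_op x (z i).
  by elim/big_rec2: _ => // i u v _ <-.
have op_suml (I : Type) (r : seq I) (c : I -> C) (x : I -> 'rV[C]_n.+1) z :
    soh_op (E := E) (\sum_(i <- r) c i *: x i) z = \sum_(i <- r) c i *: soh_op (x i) z.
  by elim/big_rec2: _ => // i u v _ <-.
have ip2_suml (I : Type) (r : seq I) (c : I -> C) (z : I -> E * E) w :
    ip2 (\sum_(i <- r) c i *: z i) w = \sum_(i <- r) c i * ip2 (z i) w.
  by elim/big_rec2: _ => // i u v _ <-.
have ip2_sumr (I : Type) (r : seq I) (c : I -> C) (z : I -> E * E) w :
    ip2 w (\sum_(i <- r) c i *: z i) = \sum_(i <- r) Num.conj (c i) * ip2 w (z i).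
  rewrite ip2C ip2_suml rmorph_sum; apply: eq_bigr => i _.
  by rewrite rmorphM [in RHS]ip2C.
split=> [k z|k X Y Xp Yp z|k l al X Xp z].
- rewrite big1 // => a _; rewrite big1 // => b _.
  by rewrite mxE op0x ip20.
- apply: ge0_eq (addr_ge0 (Xp z) (Yp z)) _.
  rewrite -big_split; apply: eq_bigr => a _; rewrite -big_split.
  apply: eq_bigr => b _ /=; rewrite mxE -[X a b]scale1r opZ ip2l mul1r.
  by rewrite scale1r.
pose w (c : 'I_k) := \sum_a al c a *: z a.
apply: ge0_eq (Xp w) _; rewrite /w.
transitivity (\sum_a \sum_c Num.conj (al c a) *
    \sum_b \sum_d al d b * ip2 (soh_op (X c d) (z b)) (z a)).
  rewrite [RHS]exchange_big /=; apply: eq_bigr => c _.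
  under eq_bigr do rewrite ip2_sumr.
  rewrite exchange_big; apply: eq_bigr => a _; rewrite -mulr_sumr; congr (_ * _).
  rewrite exchange_big; apply: eq_bigr => d _.
  by rewrite op_sum ip2_suml.
apply: eq_bigr => a _; rewrite /congr_mx.
under eq_bigr do rewrite mulr_sumr.
rewrite exchange_big; apply: eq_bigr => b _ /=; rewrite mxE.
under [in RHS]eq_bigr do under eq_bigr do rewrite -scalerA.
under [in RHS]eq_bigr do rewrite -scaler_sumr.
rewrite op_suml ip2_suml; apply: eq_bigr => c _; congr (_ * _).
by rewrite op_suml ip2_suml.
Qed.

End SOHPos.

(** * Real partial isometries act on SOH *)

Section SOHMap.
Context {R : realType}.
Notation C := R[i].

Definition soh_map m N (t : 'M[R]_(N, m)) (x : 'rV[C]_m.+1) : 'rV[C]_N.+1 :=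
  \row_j (if unlift ord0 j is Some j'
          then \sum_i (t j' i)%:C%C * x 0 (lift ord0 i) else x 0 ord0).

Lemma soh_map_linear m N (t : 'M[R]_(N, m)) : linear (soh_map t).
Proof.
move=> a x y; apply/rowP => j; rewrite !mxE; case: unlift => [j'|//].
rewrite mulr_sumr -big_split; apply: eq_bigr => i _ /=.
by rewrite !mxE; ring.
Qed.

HB.instance Definition _ m N (t : 'M[R]_(N, m)) :=
  GRing.isLinear.Build C 'rV[C]_m.+1 'rV[C]_N.+1 *:%R (soh_map t) (soh_map_linear t).

Lemma soh_map0 m N (t : 'M[R]_(N, m)) x : soh_map t x 0 ord0 = x 0 ord0.
Proof. by rewrite mxE unlift_none. Qed.

Lemma soh_mapS m N (t : 'M[R]_(N, m)) x j : soh_map t x 0 (lift ord0 j) =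
  \sum_i (t j i)%:C%C * x 0 (lift ord0 i).
Proof. by rewrite mxE liftK. Qed.

Lemma soh_ext m (x y : 'rV[C]_m.+1) : x 0 ord0 = y 0 ord0 ->
  (forall i, x 0 (lift ord0 i) = y 0 (lift ord0 i)) -> x = y.
Proof. by move=> h0 hS; apply/rowP => i; case: (unliftP ord0 i) => [j|] ->. Qed.

Lemma soh_mapM m N p (s : 'M[R]_(p, N)) (t : 'M[R]_(N, m)) x :
  soh_map s (soh_map t x) = soh_map (s *m t) x.
Proof.
apply: soh_ext => [|i]; first by rewrite !soh_map0.
rewrite !soh_mapS; under eq_bigr do rewrite soh_mapS mulr_sumr.
rewrite exchange_big; apply: eq_bigr => j _ /=.
rewrite mxE rmorph_sum mulr_suml; apply: eq_bigr => l _.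
by rewrite mulrA -rmorphM.
Qed.

Lemma soh_map1 m (x : 'rV[C]_m.+1) : soh_map 1%:M x = x.
Proof.
apply: soh_ext => [|i]; first by rewrite !soh_map0.
rewrite soh_mapS (sum_only (i0 := i)) => [|j ji]; first by rewrite mxE eqxx mul1r.
by rewrite mxE eq_sym (negPf ji) mul0r.
Qed.

Lemma mcone_posZ (V : moSpace R) k (r : C) (X : 'M[V]_k) : mcone V -> 0 <= r ->
  mo_pos X -> mo_pos (map_mx ( *:%R r) X).
Proof. by move=> Vc r0 Xp; rewrite -congr_scalar //; exact: mcone_congr. Qed.

Lemma isom_sum m N (t : 'M[R]_(N, m)) (al be : 'I_m -> C) :
  (forall i, \sum_j ((t^T *m t) i j)%:C%C * be j = be i) ->
  \sum_j (\sum_i (t j i)%:C%C * al i) * Num.conj (\sum_i (t j i)%:C%C * be i) =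
  \sum_i al i * Num.conj (be i).
Proof.
move=> tb.
transitivity (\sum_j \sum_i al i * ((t j i)%:C%C *
    Num.conj (\sum_i (t j i)%:C%C * be i))).
  by apply: eq_bigr => j _; rewrite mulr_suml; apply: eq_bigr => i _; ring.
rewrite exchange_big; apply: eq_bigr => i _; rewrite -mulr_sumr; congr (_ * _).
rewrite -[in RHS]tb [in RHS]rmorph_sum.
under eq_bigr do rewrite rmorph_sum mulr_sumr.
rewrite exchange_big; apply: eq_bigr => l _ /=.
have cr (r : R) : Num.conj (r%:C)%C = (r%:C)%C :> C by apply/CrealP; rewrite complex_real.
rewrite rmorphM /= cr mxE rmorph_sum mulr_suml; apply: eq_bigr => j _.
by rewrite !rmorphM /= cr mxE mulrA.
Qed.

(** On elements fixed by its initial projection, t preserves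
    sum_i A_i (x) conj(A_i). *)
Lemma soh_map_pos_isom n N (E : OHrep R n) (F : OHrep R N) (t : 'M[R]_(N, n))
    k (X : 'M[SOH E]_k) : (0 < n)%N ->
  (forall a b, soh_map (t^T *m t) (X a b) = X a b) ->
  mo_pos X -> mo_pos (map_mx (soh_map t) X : 'M[SOH F]_k).
Proof.
move=> n0 tX; apply: soh_transfer => //.
- by apply/matrixP => a b; rewrite !mxE unlift_none.
- move=> Xh j; apply/matrixP => a b; rewrite !mxE liftK rmorph_sum.
  apply: eq_bigr => i _; rewrite rmorphM /=.
  have /matrixP/(_ a b) := Xh i; rewrite !mxE => ->; congr (_ * _).
  by apply/CrealP; rewrite complex_real.
apply/matrixP => a b; rewrite !summxE.
under eq_bigr do rewrite !mxE liftK.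
under [RHS]eq_bigr do rewrite !mxE.
apply: isom_sum => i; rewrite -soh_mapS; by rewrite tX.
Qed.

(** The initial projection P is the average of the identity and the
    reflection 2 P - 1, which is orthogonal; after P, t acts isometrically. *)
Lemma cp_soh_map n N (E : OHrep R n) (F : OHrep R N) (t : 'M[R]_(N, n)) :
  (0 < n)%N -> t *m t^T *m t = t -> cp (V := SOH E) (W := SOH F) (soh_map t).
Proof.
move=> n0 tt k X Xp.
pose P := t^T *m t.
have PP : P *m P = P by rewrite /P -mulmxA (mulmxA t) tt.
have PT : P^T = P by rewrite /P trmx_mul trmxK.
pose s := P + P - 1%:M.
have sT : s^T = s by rewrite /s linearB linearD /= PT trmx1.
have ss : s *m s = 1%:M.
  rewrite /s mulmxBr mulmx1 mulmxBl mul1mx mulmxDl mulmxDr PP.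
  by rewrite addrK opprB addrC subrK.
have h : mo_pos (X + map_mx (soh_map s) X : 'M[SOH E]_k).
  apply: (mconeD (SOH_mcone E)) => //; apply: soh_map_pos_isom => // a b.
  by rewrite sT ss soh_map1.
have h2 : 0 <= 2^-1 :> C by rewrite invr_ge0 ler0n.
have PE x : 2^-1 *: (x + soh_map s x) = soh_map P x.
  apply: soh_ext => [|i]; rewrite !mxE ?unlift_none ?liftK.
    by field.
  have -> : \sum_j ((s i j)%:C)%C * x 0 (lift ord0 j) =
      2 * \sum_j ((P i j)%:C)%C * x 0 (lift ord0 j) - x 0 (lift ord0 i).
    have e : x 0 (lift ord0 i) = \sum_j (i == j)%:R * x 0 (lift ord0 j).
      rewrite (sum_only (i0 := i)) ?eqxx ?mul1r // => j /negPf ji.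
      by rewrite eq_sym ji mul0r.
    rewrite mulr_sumr [X in _ - X]e.
    rewrite -sumrB; apply: eq_bigr => j _; rewrite /s !mxE !rmorphB !rmorphD /=.
    by rewrite rmorph_nat; ring.
  by field.
have Zp : mo_pos (map_mx (soh_map P) X : 'M[SOH E]_k).
  have := mcone_posZ (SOH_mcone E) h2 h; congr mo_pos; apply/matrixP => a b.
  by rewrite !mxE PE.
have tP a b : soh_map (t^T *m t) (map_mx (soh_map P) X a b) = map_mx (soh_map P) X a b.
  by rewrite mxE soh_mapM PP.
have := @soh_map_pos_isom _ _ E F t k _ n0 tP Zp; congr mo_pos; apply/matrixP => a b.
by rewrite !mxE soh_mapM /P mulmxA tt.
Qed.

End SOHMap.

(** * Exact factorizations *)

Section Exact.
Context {R : realType}.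
Notation C := R[i].
Variable oh : forall n, OHrep R n.

Record soh_factor (D T : moSpace R) := SOHFactor {
  sf_p : nat;
  sf_n : nat;
  sf_in : {linear D -> ampMO sf_p (SOH (oh sf_n))};
  sf_out : {linear ampMO sf_p (SOH (oh sf_n)) -> T};
  sf_p_gt0 : (0 < sf_p)%N;
  sf_n_gt0 : (0 < sf_n)%N;
  sf_in_cp : cp sf_in;
  sf_out_cp : cp sf_out }.

Definition factors_exactly (D T : moSpace R) (h : D -> T) : Prop :=
  exists F : soh_factor D T, forall f, h f = sf_out F (sf_in F f).

Lemma mo_pos_eq (V : moSpace R) k (X Y : 'M[V]_k) : mo_pos X -> X = Y -> mo_pos Y.
Proof. by move=> + <-. Qed.

Lemma cp_comp (U V W : moSpace R) (f : U -> V) (g : V -> W) :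
  cp f -> cp g -> cp (g \o f).
Proof. by move=> fcp gcp k X Xp; rewrite map_mx_comp; apply/gcp/fcp. Qed.

Lemma exact_comp (D D' T T' : moSpace R) (rho : {linear D' -> D})
    (ka : {linear T -> T'}) (h : D -> T) : cp rho -> cp ka ->
  factors_exactly h -> factors_exactly (fun f => ka (h (rho f))).
Proof.
move=> rcp kcp [F hF].
have cin : cp (sf_in F \o rho) by exact: cp_comp (@sf_in_cp _ _ F).
have cout : cp (ka \o sf_out F) by exact: cp_comp (@sf_out_cp _ _ F) kcp.
exists (@SOHFactor _ _ _ _ (sf_in F \o rho) (ka \o sf_out F)
  (sf_p_gt0 F) (sf_n_gt0 F) cin cout) => f /=.
by rewrite hF.
Qed.

Lemma exact_cp (D T : moSpace R) (h : D -> T) : factors_exactly h -> cp h.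
Proof.
move=> [F hF] k X Xp; apply: mo_pos_eq (sf_out_cp (sf_in_cp Xp)) _.
by apply/matrixP => a b; rewrite !mxE hF.
Qed.

Lemma exact_zero (D T : moSpace R) : mcone T -> factors_exactly (fun _ : D => 0 : T).
Proof.
move=> Tc.
pose phi : {linear D -> ampMO 1 (SOH (oh 1))} := \0.
pose psi : {linear ampMO 1 (SOH (oh 1)) -> T} := \0.
have c1 : cp phi.
  move=> k X Xp; apply: mo_pos_eq (mcone0 (amp_mcone (SOH_mcone (oh 1)) 1) k) _.
  by apply/matrixP => a b; rewrite !mxE.
have c2 : cp psi.
  move=> k X Xp; apply: mo_pos_eq (mcone0 Tc k) _.
  by apply/matrixP => a b; rewrite !mxE.
by exists (@SOHFactor _ _ _ _ phi psi isT isT c1 c2).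
Qed.

Section Direct.
Variables (D : moSpace R) (n1 n2 p1 p2 : nat).
Local Notation V1 := (SOH (oh n1)).
Local Notation V2 := (SOH (oh n2)).
Local Notation V := (SOH (oh (n1 + n2))).
Hypotheses (n1_gt0 : (0 < n1)%N) (n2_gt0 : (0 < n2)%N).

Let t1 : 'M[R]_(n1 + n2, n1) := col_mx 1%:M 0.
Let t2 : 'M[R]_(n1 + n2, n2) := col_mx 0 1%:M.

Lemma dsum_t1K : t1^T *m t1 = 1%:M.
Proof. by rewrite tr_col_mx mul_row_col trmx1 mul1mx mulmx0 addr0. Qed.
Lemma dsum_t2K : t2^T *m t2 = 1%:M.
Proof. by rewrite tr_col_mx mul_row_col trmx1 mul1mx mulmx0 add0r. Qed.

(** The retract of a direct sum M_p1(SOH(n1)) (+) M_p2(SOH(n2)) into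
    M_(p1 + p2)(SOH(n1 + n2)): block diagonal in the matrix index, orthogonal
    coordinates in the SOH index. *)
Definition dsum_in (A1 : ampMO p1 V1) (A2 : ampMO p2 V2) : ampMO (p1 + p2) V :=
  [ffun ij => match fintype.split ij.1, fintype.split ij.2 with
   | inl i, inl j => soh_map t1 ((A1 : {ffun _ -> 'rV[C]_n1.+1}) (i, j))
   | inr i, inr j => soh_map t2 ((A2 : {ffun _ -> 'rV[C]_n2.+1}) (i, j))
   | _, _ => 0 end].

Definition dsum_out1 (A : ampMO (p1 + p2) V) : ampMO p1 V1 :=
  [ffun ij => soh_map t1^T
    ((A : {ffun _ -> 'rV[C]_(n1 + n2).+1}) (lshift p2 ij.1, lshift p2 ij.2))].
Definition dsum_out2 (A : ampMO (p1 + p2) V) : ampMO p2 V2 :=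
  [ffun ij => soh_map t2^T
    ((A : {ffun _ -> 'rV[C]_(n1 + n2).+1}) (rshift p1 ij.1, rshift p1 ij.2))].

Lemma dsum_out1_linear : linear dsum_out1.
Proof. by move=> c A B; apply/ffunP => ij; rewrite !ffunE linearP. Qed.
Lemma dsum_out2_linear : linear dsum_out2.
Proof. by move=> c A B; apply/ffunP => ij; rewrite !ffunE linearP. Qed.
HB.instance Definition _ := GRing.isLinear.Build C (ampMO (p1 + p2) V) (ampMO p1 V1)
  *:%R dsum_out1 dsum_out1_linear.
HB.instance Definition _ := GRing.isLinear.Build C (ampMO (p1 + p2) V) (ampMO p2 V2)
  *:%R dsum_out2 dsum_out2_linear.

Lemma dsum_in_linear c A1 A2 B1 B2 :
  dsum_in (c *: A1 + B1) (c *: A2 + B2) = c *: dsum_in A1 A2 + dsum_in B1 B2.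
Proof.
apply/ffunP => ij; rewrite !ffunE.
by case: (fintype.split ij.1) => i; case: (fintype.split ij.2) => j;
  rewrite ?scaler0 ?addr0 // !ffunE linearP.
Qed.

Lemma dsum_inK1 A1 A2 : dsum_out1 (dsum_in A1 A2) = A1.
Proof.
apply/ffunP => -[i j]; rewrite !ffunE /=.
by rewrite (unsplitK (inl _ i)) (unsplitK (inl _ j)) soh_mapM dsum_t1K soh_map1.
Qed.

Lemma dsum_inK2 A1 A2 : dsum_out2 (dsum_in A1 A2) = A2.
Proof.
apply/ffunP => -[i j]; rewrite !ffunE /=.
by rewrite (unsplitK (inr _ i)) (unsplitK (inr _ j)) soh_mapM dsum_t2K soh_map1.
Qed.

Lemma fpos_dsum_in (I : finType) (X1 : I -> I -> ampMO p1 V1) (X2 : I -> I -> ampMO p2 V2) :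
  fpos X1 -> fpos X2 -> fpos (fun i j => dsum_in (X1 i j) (X2 i j)).
Proof.
move=> /(fpos_ampE (SOH_mcone _)) h1 /(fpos_ampE (SOH_mcone _)) h2.
apply/(fpos_ampE (SOH_mcone _)).
have k1 : cp (V := V1) (W := V) (soh_map t1).
  by apply: cp_soh_map => //; rewrite -mulmxA dsum_t1K mulmx1.
have k2 : cp (V := V2) (W := V) (soh_map t2).
  by apply: cp_soh_map => //; rewrite -mulmxA dsum_t2K mulmx1.
have := fpos_blockdiag (SOH_mcone (oh (n1 + n2))) (cp_fpos k1 h1) (cp_fpos k2 h2).
move/(fpos_reindex (fun s : I * 'I_(p1 + p2) => match fintype.split s.2 with
   | inl i => inl (s.1, i) | inr i => inr (s.1, i) end)).
move/fpos_ext; apply => -[a i] [b j]; rewrite ffunE /=.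
by case: (fintype.split i) => i'; case: (fintype.split j) => j'.
Qed.

Lemma cp_dsum_out1 : cp dsum_out1.
Proof.
apply: (cp_from_fpos (amp_mcone (SOH_mcone _) _)) => I X.
move=> /(fpos_ampE (SOH_mcone _)) h; apply/(fpos_ampE (SOH_mcone _)).
have k1 : cp (V := V) (W := V1) (soh_map t1^T).
  apply: cp_soh_map; first by rewrite addn_gt0 n1_gt0.
  by rewrite trmxK dsum_t1K mul1mx.
move: h => /(fpos_reindex (fun s : I * 'I_p1 => (s.1, lshift p2 s.2))).
by move/(cp_fpos k1)/fpos_ext; apply => s t; rewrite ffunE.
Qed.

Lemma cp_dsum_out2 : cp dsum_out2.
Proof.
apply: (cp_from_fpos (amp_mcone (SOH_mcone _) _)) => I X.
move=> /(fpos_ampE (SOH_mcone _)) h; apply/(fpos_ampE (SOH_mcone _)).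
have k2 : cp (V := V) (W := V2) (soh_map t2^T).
  apply: cp_soh_map; first by rewrite addn_gt0 n1_gt0.
  by rewrite trmxK dsum_t2K mul1mx.
move: h => /(fpos_reindex (fun s : I * 'I_p2 => (s.1, rshift p1 s.2))).
by move/(cp_fpos k2)/fpos_ext; apply => s t; rewrite ffunE.
Qed.

End Direct.

Lemma exactD (D T : moSpace R) (h1 h2 : D -> T) : mcone T ->
  factors_exactly h1 -> factors_exactly h2 -> factors_exactly (fun f => h1 f + h2 f).
Proof.
move=> Tc [F1 hF1] [F2 hF2].
have n1 := sf_n_gt0 F1; have n2 := sf_n_gt0 F2.
pose phi f := dsum_in (sf_in F1 f) (sf_in F2 f).
have phil : linear phi by move=> c f g; rewrite /phi !linearP dsum_in_linear.
pose Phi := HB.pack phi (GRing.isLinear.Build C D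
  (ampMO (sf_p F1 + sf_p F2) (SOH (oh (sf_n F1 + sf_n F2)))) *:%R phi phil) :
  {linear D -> ampMO (sf_p F1 + sf_p F2) (SOH (oh (sf_n F1 + sf_n F2)))}.
pose Psi : {linear ampMO (sf_p F1 + sf_p F2) (SOH (oh (sf_n F1 + sf_n F2))) -> T} :=
  (sf_out F1 \o @dsum_out1 (sf_n F1) (sf_n F2) (sf_p F1) (sf_p F2)) \+
  (sf_out F2 \o @dsum_out2 (sf_n F1) (sf_n F2) (sf_p F1) (sf_p F2)).
have c1 : cp Phi.
  move=> k X Xp.
  have h1' := mo_fpos (amp_mcone (SOH_mcone _) _) (sf_in_cp (s := F1) Xp).
  have h2' := mo_fpos (amp_mcone (SOH_mcone _) _) (sf_in_cp (s := F2) Xp).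
  apply: fpos_mo; apply: fpos_ext (fpos_dsum_in n1 n2 h1' h2') _ => i j.
  by rewrite !mxE.
have c2 : cp Psi.
  move=> k X Xp.
  apply: mo_pos_eq (mconeD Tc (sf_out_cp (s := F1) (cp_dsum_out1 n1 Xp))
    (sf_out_cp (s := F2) (cp_dsum_out2 n1 Xp))) _.
  by apply/matrixP => a b; rewrite !mxE.
have pq : (0 < sf_p F1 + sf_p F2)%N by rewrite addn_gt0 (sf_p_gt0 F1).
have nm : (0 < sf_n F1 + sf_n F2)%N by rewrite addn_gt0 n1.
exists (@SOHFactor _ _ _ _ Phi Psi pq nm c1 c2) => f /=.
by rewrite /phi dsum_inK1 dsum_inK2 hF1 hF2.
Qed.

(** M_p is a retract of M_p(SOH(1)): tensor with H_0, and come back by reading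
    the coefficient of H_0, which is completely positive by [soh_coef0_psd]. *)
Lemma exact_scalar (D T : moSpace R) p (phi : {linear D -> scalarMat p})
    (psi : {linear scalarMat p -> T}) : (0 < p)%N -> cp phi -> cp psi ->
  factors_exactly (fun f => psi (phi f)).
Proof.
move=> p0 cphi cpsi.
pose V := SOH (oh 1).
pose e0 : V := \row_j (j == ord0)%:R.
have soh_e0 (z : oh 1 * oh 1) : soh_op (E := oh 1) e0 z = z.
  have e00 : e0 0 ord0 = 1 by rewrite mxE eqxx.
  have e0S i : e0 0 (lift ord0 i) = 0 by rewrite mxE.
  rewrite [RHS]surjective_pairing [LHS]surjective_pairing soh_op1 soh_op2.
  by rewrite e00 !scale1r !big1 ?addr0 // => i _; rewrite e0S scale0r.
have e0p : fpos (fun _ _ : unit => e0).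
  move=> k g z.
  have /ge0_eq := addr_ge0 (ip_ge0 (\sum_a (z a).1)) (ip_ge0 (\sum_a (z a).2)); apply.
  rewrite !ip_sumr -big_split; apply: eq_bigr => a _ /=.
  rewrite !ip_suml -big_split; apply: eq_bigr => b _ /=.
  by rewrite mxE soh_e0.
pose io (A : scalarMat p) : ampMO p V :=
  [ffun ij => (A : 'M[C]_p) ij.1 ij.2 *: (e0 : 'rV[C]_2)].
pose st (Z : ampMO p V) : scalarMat p :=
  (\matrix_(i, j) ((Z : {ffun _ -> 'rV[C]_2}) (i, j)) 0 ord0 : 'M[C]_p).
have iol : linear io.
  by move=> c A B; apply/ffunP => ij; rewrite !ffunE !mxE scalerDl scalerA.
have stl : linear st.
  by move=> c A B; apply/matrixP => i j; rewrite !mxE !ffunE !mxE.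
pose Io := HB.pack io (GRing.isLinear.Build C (scalarMat p) (ampMO p V) *:%R io iol) :
  {linear scalarMat p -> ampMO p V}.
pose St := HB.pack st (GRing.isLinear.Build C (ampMO p V) (scalarMat p) *:%R st stl) :
  {linear ampMO p V -> scalarMat p}.
have cIo : cp Io.
  move=> k X /mo_scalarP/fpos_scalarE Xp; apply: fpos_mo.
  apply/(fpos_ampE (SOH_mcone _)).
  have := fpos_tens (SOH_mcone (oh 1)) Xp e0p.
  move/(fpos_reindex (fun s => (s, tt)))/fpos_ext; apply => s t.
  by rewrite mxE ffunE.
have cSt : cp St.
  apply: (cp_from_fpos (amp_mcone (SOH_mcone _) _)) => I X.
  move=> /(fpos_ampE (SOH_mcone _)) h; apply/fpos_scalarE => x.
  have /ge0_eq := fpsd_reindex enum_rank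
    (@soh_coef0_psd _ _ (oh 1) _ _ isT (h #|{: I * 'I_p}| enum_val)) x; apply.
  apply: eq_bigr => s _; apply: eq_bigr => t _.
  by rewrite !mxE !enum_rankK.
have cin : cp (Io \o phi) by exact: cp_comp cphi cIo.
have cout : cp (psi \o St) by exact: cp_comp cSt cpsi.
exists (@SOHFactor _ _ _ _ (Io \o phi) (psi \o St) p0 isT cin cout) => f /=.
congr (psi _); apply/matrixP => i j.
by rewrite !mxE ffunE !mxE eqxx mulr1.
Qed.

End Exact.

(** * Approximate factorizations *)

Section Approx.
Context {R : realType}.
Notation C := R[i].
Variable oh : forall n, OHrep R n.

(** Approximation on finite sets, without nets; see [factors_SOH_approx] and
    [approx_factors_SOH]. *)
Definition factors_approx (D : moSpace R) (T : osData R) (h : D -> T) : Prop :=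
  forall (s : seq D) (e : R), 0 < e -> exists h' : D -> T,
    factors_exactly oh h' /\ forall f, f \in s -> onear e (h' f - h f).

Section Factors.
Variables (S T : osData R) (To : is_opsys T).
Local Notation D := (dualMO S).

Lemma factors_SOH_approx (h : D -> T) : factors_SOH oh h -> factors_approx h.
Proof.
move=> [L [le [p [n [phi [psi [[[l0] lerr letr ledir] pn cphi cpsi lim]]]]]]].
move=> s e e0.
have [l ls] : exists l, forall l', le l l' -> forall f, f \in s ->
    os_norm (psi l' (phi l' f) - h f) < e.
  elim: s => [|f s [l ls]]; first by exists l0.
  have [l1 l1f] := lim f e e0.
  have [l2 [l2l l2l1]] := ledir l l1.
  exists l2 => l' l2l' g; rewrite inE => /predU1P[->|gs].
    by apply: l1f; exact: letr l2l1 l2l'.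
  by apply: ls => //; exact: letr l2l l2l'.
exists (fun f => psi l (phi l f)); split.
  by exists (SOHFactor (pn l).1 (pn l).2 (cphi l) (cpsi l)).
move=> f fs; have /(os_norm_lt To)[r re rn] := ls l (lerr l) f fs.
exact: (onear_le To (ltW re)).
Qed.

(** Index the net by finite sets of functionals paired with a precision. *)
Lemma approx_factors_SOH (h : D -> T) : factors_approx h -> factors_SOH oh h.
Proof.
move=> ha.
have F0 : soh_factor oh D T.
  by have [h' [/cid[F _] _]] := cid (ha [::] 1 ltr01); exact: F.
pose L : Type := (seq D * nat)%type.
have /choice [F FP] : forall l : L, exists F : soh_factor oh D T,
    forall f, f \in l.1 -> onear l.2.+1%:R^-1 (sf_out F (sf_in F f) - h f).
  move=> l; have [|h' [[F hF] hn]] := ha l.1 l.2.+1%:R^-1.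
    by rewrite invr_gt0 ltr0n.
  by exists F => f fl; rewrite -hF; exact: hn.
exists L, (fun l l' => {subset l.1 <= l'.1} /\ (l.2 <= l'.2)%N).
exists (fun l => sf_p (F l)), (fun l => sf_n (F l)).
exists (fun l => sf_in (F l)), (fun l => sf_out (F l)).
split.
- split; first by split; exact: ([::], 0%N).
  + by move=> l; split.
  + move=> a b c [ab ab'] [bc bc']; split; last exact: leq_trans ab' bc'.
    by move=> x /ab/bc.
  move=> a b; exists (a.1 ++ b.1, maxn a.2 b.2); split; split => /=.
  + by move=> x xa; rewrite mem_cat xa.
  + exact: leq_maxl.
  + by move=> x xb; rewrite mem_cat xb orbT.
  exact: leq_maxr.
- by move=> l; split; [exact: sf_p_gt0|exact: sf_n_gt0].
- by move=> l; exact: sf_in_cp.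
- by move=> l; exact: sf_out_cp.
move=> f e e0; pose N := Num.trunc e^-1.
exists ([:: f], N) => l [fl Nl]; apply/(os_norm_lt To).
exists l.2.+1%:R^-1; last by apply: FP; apply: fl; rewrite mem_head.
rewrite invf_plt ?posrE ?ltr0n //.
apply: lt_le_trans (_ : N.+1%:R <= _); last by rewrite ler_nat ltnS.
by rewrite truncnS_gt.
Qed.

End Factors.

Section Closure.
Variables (D : moSpace R) (T : osData R) (To : is_opsys T).

Lemma approx_exact (h : D -> T) : factors_exactly oh h -> factors_approx h.
Proof.
move=> hx s e e0; exists h; split=> // f _; rewrite subrr.
by apply: (onear0 To); exact: ltW.
Qed.

Lemma approx_ext (h h' : D -> T) : factors_approx h -> h =1 h' -> factors_approx h'.
Proof. by move=> + hh'; rewrite (funext hh'). Qed.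

Lemma approxD (h1 h2 : D -> T) : factors_approx h1 -> factors_approx h2 ->
  factors_approx (fun f => h1 f + h2 f).
Proof.
move=> a1 a2 s e e0; have e2 : 0 < e / 2 by rewrite divr_gt0.
have [g1 [x1 n1]] := a1 s _ e2; have [g2 [x2 n2]] := a2 s _ e2.
exists (fun f => g1 f + g2 f); split; first exact: exactD (opsys_mcone To) _ _.
move=> f fs; rewrite [e]splitr opprD addrACA.
by apply: (onearD To); [exact: n1|exact: n2].
Qed.

Lemma approx_cp (h : D -> T) : factors_approx h -> cp h.
Proof.
move=> ha k X Xp; apply: (opsys_closed To) => e e0.
have [h' [hx hn]] := ha [seq X ab.1 ab.2 | ab : 'I_k * 'I_k] e e0.
exists (map_mx h' X); first exact: exact_cp hx _ _ Xp.
move=> a b; rewrite !mxE; apply: hn.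
by apply/mapP; exists (a, b); rewrite ?mem_enum.
Qed.

(** The term with coefficient r is small on any given finite set as soon as r
    is small. *)
Lemma approx_arch (h u : D -> T) :
  (forall r : R, 0 < r -> factors_approx (fun f => (r%:C)%C *: u f + h f)) -> factors_approx h.
Proof.
move=> ha s e e0.
have [M M0 Mu] : exists2 M : R, 0 < M & forall f, f \in s -> onear M (u f).
  elim: s => [|f s [M M0 Mu]]; first by exists 1.
  have [r rf] := onear_ex To (u f).
  exists (M + r); first by rewrite ltr_wpDr // (onear_ge0 rf).
  move=> g; rewrite inE => /predU1P[->|gs].
    by apply: (onear_le To) rf; rewrite lerDr ltW.
  by apply: (onear_le To) (Mu g gs); rewrite lerDl (onear_ge0 rf).
pose r := e / 2 / M.
have e2 : 0 < e / 2 by rewrite divr_gt0.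
have r0 : 0 < r by rewrite divr_gt0.
have [h' [hx hn]] := ha r r0 s _ e2.
exists h'; split=> // f fs.
have -> : h' f - h f = (h' f - ((r%:C)%C *: u f + h f)) + (r%:C)%C *: u f.
  by rewrite (addrC (_ *: _) (h f)) opprD addrA subrK.
rewrite [e]splitr; apply: (onearD To); first exact: hn.
have := onearZ To (r%:C)%C (Mu f fs); rewrite ger0_norm ?ler0c ?(ltW r0) //=.
by rewrite /r divfK ?gt_eqF.
Qed.

End Closure.

Lemma approx_comp (D D' : moSpace R) (T T' : osData R) (To : is_opsys T)
    (To' : is_opsys T') (rho : {linear D' -> D}) (ka : {linear T -> T'}) (h : D -> T) :
  cp rho -> cp ka -> factors_approx h -> factors_approx (fun f => ka (h (rho f))).
Proof.
move=> rcp kcp ha s e e0.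
have [c c0 hc] := onear_cp To To' kcp.
have c1 : 0 < c + 1 by rewrite ltr_wpDl.
have ec : 0 < e / (c + 1) by rewrite divr_gt0.
have [h' [hx hn]] := ha (map rho s) _ ec.
exists (fun f => ka (h' (rho f))); split; first exact: exact_comp.
move=> f fs; rewrite -linearB.
have := hc _ _ (hn _ (map_f rho fs)); apply: (onear_le To').
by rewrite mulrCA ler_piMr ?(ltW e0) // ler_pdivrMr // mul1r lerDl.
Qed.

End Approx.

(** * The map attached to a tensor *)

Section Hat.
Context {R : realType}.
Notation C := R[i].

(** Values are taken in C and not in C^o, so that they multiply as scalars. *)
Definition ev (S : moSpace R) (f : dualMO S) (x : S) : C := (f : 'Hom(S, C^o)) x.

Lemma evD (S : moSpace R) (f : dualMO S) x y : ev f (x + y) = ev f x + ev f y.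
Proof. by rewrite /ev linearD. Qed.
Lemma evN (S : moSpace R) (f : dualMO S) x : ev f (- x) = - ev f x.
Proof. by rewrite /ev linearN. Qed.
Lemma evZ (S : moSpace R) (f : dualMO S) c x : ev f (c *: x) = c * ev f x.
Proof. by rewrite /ev linearZ. Qed.
Lemma ev_linear (S : moSpace R) c (f g : dualMO S) x :
  ev (c *: f + g) x = c * ev f x + ev g x.
Proof.
have := add_lfunE (c *: (f : 'Hom(S, C^o))) (g : 'Hom(S, C^o)) x.
by rewrite scale_lfunE.
Qed.
Lemma ev_suml (S : moSpace R) (I : Type) (r : seq I) (P : pred I) (F : I -> S) f :
  ev f (\sum_(i <- r | P i) F i) = \sum_(i <- r | P i) ev f (F i).
Proof. by rewrite /ev linear_sum. Qed.

Section HatLinear.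
Variables (S T : osData R).
Implicit Types (u v : tensor S T) (f : dualMO S).

Lemma hatD u v f : hat (u + v) f = hat u f + hat v f.
Proof. by rewrite /hat linearD. Qed.
Lemma hatN u f : hat (- u) f = - hat u f.
Proof. by rewrite /hat linearN. Qed.
Lemma hatZ c u f : hat (c *: u) f = c *: hat u f.
Proof. by rewrite /hat linearZ. Qed.
Lemma hat_sum (I : Type) (r : seq I) (P : pred I) (F : I -> tensor S T) f :
  hat (\sum_(i <- r | P i) F i) f = \sum_(i <- r | P i) hat (F i) f.
Proof. by rewrite /hat linear_sum. Qed.
Lemma hatMn u n f : hat (u *+ n) f = hat u f *+ n.
Proof. by rewrite /hat linearMn. Qed.
Lemma hat_tensE x y f : hat (tens x y : tensor S T) f = ev f x *: y.
Proof. exact: hat_tens. Qed.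

Lemma tensor_bas u : u = \sum_i \sum_j u i j *: tens (vbas (S := S) i) (vbas (S := T) j).
Proof.
rewrite [LHS]matrix_sum_delta; apply: eq_bigr => i _; apply: eq_bigr => j _.
by rewrite tens_bas.
Qed.

Lemma hatE u f : hat u f = \sum_i \sum_j u i j *: (ev f (vbas i) *: vbas j).
Proof. by []. Qed.

Lemma tensDl (x w : S) (y : T) : tens (x + w) y = tens x y + tens w y.
Proof. by rewrite /tens !linearD mulmxDl. Qed.
Lemma tensZr c (x : S) (y : T) : tens x (c *: y) = c *: tens x y.
Proof. by rewrite /tens linearZ /= -scalemxAr. Qed.
Lemma tensZl c (x : S) (y : T) : tens (c *: x) y = c *: tens x y.
Proof. by rewrite /tens !linearZ /= -scalemxAl. Qed.
Lemma tens_sumr (I : Type) (r : seq I) (x : S) (y : I -> T) :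
  tens x (\sum_(i <- r) y i) = \sum_(i <- r) tens x (y i).
Proof. by rewrite /tens linear_sum mulmx_sumr. Qed.

End HatLinear.

Section TensorMatrices.
Variables (S T : osData R).

Definition hatmx k (U : 'M[tensor S T]_k) (f : dualMO S) : ampOS k T :=
  [ffun ab => hat (U ab.1 ab.2) f].

(** The identification of M_k(S (x) T) with S (x) M_k(T) acts entrywise on the
    attached maps. *)
Lemma hat_tensor_amp k (U : 'M[tensor S T]_k) f :
  hat (tensor_amp U) f = hatmx U f.
Proof.
have tl (a b : 'I_k) (v : tensor S T) :
    hat (tlift (fun (x : S) (y : T) =>
      tens x ([ffun ij => y *+ (ij == (a, b))] : ampOS k T)) v) f =
    [ffun ij => hat v f *+ (ij == (a, b))].
  rewrite /tlift hat_sum; apply/ffunP => ij; rewrite sum_ffunE ffunE hatE -sumrMnl.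
  apply: eq_bigr => i _; rewrite hat_sum sum_ffunE -sumrMnl.
  apply: eq_bigr => j _; rewrite hatZ hat_tensE !ffunE.
  by rewrite -!scalerMnr.
apply/ffunP => -[a b]; rewrite ffunE /tensor_amp hat_sum sum_ffunE.
rewrite (sum_only (i0 := a)) => [|c /negPf ca]; last first.
  rewrite hat_sum sum_ffunE big1 // => d _; rewrite tl ffunE.
  by rewrite xpair_eqE eq_sym ca.
rewrite hat_sum sum_ffunE (sum_only (i0 := b)) => [|d /negPf db]; last first.
  by rewrite tl ffunE xpair_eqE [b == d]eq_sym db andbF.
by rewrite tl ffunE eqxx.
Qed.

End TensorMatrices.

Lemma vbas_coord (V : vectType C) i l : v2r (vbas (S := V) i) 0 l = (i == l)%:R.
Proof. by rewrite /vbas r2vK mxE eqxx eq_sym. Qed.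

Lemma sum_pair1 (V : nmodType) k (F : 'I_k * 'I_1 -> V) :
  \sum_s F s = \sum_a F (a, ord0).
Proof.
rewrite (eq_bigr (fun s => F (s.1, s.2))) => [|[] //].
by rewrite -(pair_bigA _ (fun a i => F (a, i))); apply: eq_bigr => a _; rewrite big_ord1.
Qed.

Section Positive.
Variable S : osData R.
Hypothesis So : is_opsys S.

Definition posfun (f : dualMO S) : Prop := mo_pos (const_mx f : 'M[dualMO S]_1).

(** A positive functional is completely positive: compress to 1 x 1. *)
Lemma posfunP (f : dualMO S) : posfun f <-> forall x, pos1 x -> 0 <= ev f x.
Proof.
split=> [fp x xp|fp k X Xp].
  have := cp_fpos fp xp; move/fpos_scalarE => /(_ (fun=> 1)).
  rewrite (sum_only (i0 := (tt, 0))) => [|[[] i]]; last by rewrite (ord1 i) eqxx.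
  rewrite (sum_only (i0 := (tt, 0))) => [|[[] i]]; last by rewrite (ord1 i) eqxx.
  by rewrite rmorph1 mul1r mulr1 !mxE.
apply/mo_scalarP/fpos_scalarE => x.
have := fpos_congr (opsys_mcone So) (fun (c : 'I_k) (_ : unit) => x (c, 0))
  (mo_fpos (opsys_mcone So) Xp).
move=> /fp /ge0_eq; apply.
rewrite ev_suml sum_pair1; apply: eq_bigr => a _.
rewrite ev_suml sum_pair1; apply: eq_bigr => b _.
by rewrite evZ !mxE /ev; ring.
Qed.

(** Apply f to the positive 2 x 2 matrix with corner x. *)
Lemma posfun_star (f : dualMO S) x : posfun f -> ev f (os_star x) = Num.conj (ev f x).
Proof.
move=> fp; have [r [_ h]] := onear_ex So x.
have := cp_fpos fp h; move/fpos_scalarE/(@fpsd_herm _ _ _ (false, 0) (true, 0)).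
by rewrite !mxE.
Qed.

Lemma posfun_separate (x : S) : (forall f, posfun f -> ev f x = 0) -> x = 0.
Proof.
move=> h; apply/eqP; apply: contraT => /(pos1_separate So)[f [fx fp]].
have fE y : ev (linfun f : dualMO S) y = f y by rewrite /ev lfunE.
have : ev (linfun f : dualMO S) x = 0.
  by apply/h/posfunP => y yp; rewrite fE; exact: fp.
by rewrite fE => fx0; move: fx; rewrite fx0 eqxx.
Qed.

Lemma hat_separate (T : osData R) (u : tensor S T) :
  (forall f, posfun f -> hat u f = 0) -> u = 0.
Proof.
move=> h.
have xj j : \sum_i u i j *: vbas (S := S) i = 0.
  apply: posfun_separate => f fp; have := h f fp; rewrite hatE exchange_big /=.
  move/(congr1 v2r); rewrite linear0 => /rowP/(_ j); rewrite mxE.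
  rewrite linear_sum summxE (sum_only (i0 := j)) => [<-|l lj].
    rewrite ev_suml linear_sum summxE; apply: eq_bigr => i _.
    by rewrite evZ !linearZ !mxE /= vbas_coord eqxx mulr1.
  rewrite linear_sum summxE big1 // => i _.
  by rewrite !linearZ !mxE /= vbas_coord (negPf lj) !mulr0.
apply/matrixP => i j; have /(congr1 v2r) := xj j; rewrite linear0.
move/rowP/(_ i); rewrite linear_sum summxE (sum_only (i0 := i)) => [|l li].
  by rewrite linearZ [X in X = _]mxE /= vbas_coord eqxx mulr1 !mxE.
by rewrite linearZ [LHS]mxE /= vbas_coord (negPf li) mulr0.
Qed.

End Positive.
End Hat.

(** * The involution *)

Section Star.
Context {R : realType}.
Notation C := R[i].
Variables S T : fdOpSys R.
Local Notation tstar := (@tensor_star R S T).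

Lemma tensor_star_antilinear (a : C) (u v : tensor S T) :
  tstar (a *: u + v) = Num.conj a *: tstar u + tstar v.
Proof.
rewrite /tensor_star -linearP; congr (tlift _ _).
by apply/matrixP => i j; rewrite !mxE rmorphD rmorphM.
Qed.

Lemma tensor_star0 : tstar 0 = 0.
Proof.
have := tensor_star_antilinear 1 0 0.
by rewrite !rmorph1 !scale1r addr0 => /eqP; rewrite -subr_eq0 opprD addNKr
  oppr_eq0 => /eqP.
Qed.

Lemma tensor_star_sum (I : Type) (r : seq I) (c : I -> C) (u : I -> tensor S T) :
  tstar (\sum_(i <- r) c i *: u i) = \sum_(i <- r) Num.conj (c i) *: tstar (u i).
Proof.
by elim/big_rec2: _ => [|i u1 v _ <-]; [exact: tensor_star0|exact: tensor_star_antilinear].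
Qed.


Lemma tensor_starE (u : tensor S T) : tstar u =
  \sum_i \sum_j Num.conj (u i j) *: tens (os_star (vbas (S := S) i)) (os_star (vbas (S := T) j)).
Proof.
rewrite [in LHS](tensor_bas u) -[in LHS](eq_bigr _ (fun i _ => scale1r _)).
rewrite tensor_star_sum; apply: eq_bigr => i _; rewrite rmorph1 scale1r.
by rewrite tensor_star_sum; apply: eq_bigr => j _; rewrite tensor_star_tens.
Qed.

Lemma tensor_starK (u : tensor S T) : tstar (tstar u) = u.
Proof.
rewrite (tensor_starE u) -[in LHS](eq_bigr _ (fun i _ => scale1r _)).
rewrite tensor_star_sum [RHS]tensor_bas; apply: eq_bigr => i _; rewrite rmorph1 scale1r.
rewrite tensor_star_sum; apply: eq_bigr => j _; rewrite conjCK.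
by rewrite tensor_star_tens !os_starK //; exact: fd_opsys.
Qed.

Lemma hat_star (u : tensor S T) (f : dualMO S) : posfun f ->
  hat (tstar u) f = os_star (hat u f).
Proof.
move=> fp; have To := fd_opsys T.
rewrite tensor_starE hat_sum hatE (star_sum To); apply: eq_bigr => i _.
rewrite hat_sum (star_sum To); apply: eq_bigr => j _.
rewrite hatZ hat_tensE !(starZ To) (posfun_star (fd_opsys S)) //.
Qed.

End Star.

(** * Elementary tensors and the order unit *)

Section Ingredients.
Context {R : realType}.
Notation C := R[i].
Variable oh : forall n, OHrep R n.

(** Evaluation of functionals at a positive P in M_n(S) is completely positive
    into M_n, by definition of the dual cones. *)
Lemma exact_tens (S : osData R) (W : moSpace R) n (P : 'M[S]_n)
    (psi : {linear scalarMat n -> W}) : (0 < n)%N -> is_opsys S ->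
  mo_pos P -> cp psi ->
  factors_exactly oh (fun f : dualMO S => psi (map_mx (ev f) P)).
Proof.
move=> n0 So Pp cpsi.
pose phi (f : dualMO S) : scalarMat n := map_mx (ev f) P : 'M[C]_n.
have phil : linear phi.
  by move=> c f g; apply/matrixP => i j; rewrite !mxE ev_linear.
pose Phi := HB.pack phi (GRing.isLinear.Build C (dualMO S) (scalarMat n) *:%R phi phil)
  : {linear dualMO S -> scalarMat n}.
have cphi : cp Phi.
  move=> k F Fp; apply/mo_scalarP/fpos_scalarE.
  have /mo_scalarP/fpos_scalarE h := Fp _ _ Pp.
  move=> x; have /ge0_eq := fpsd_reindex (fun s : 'I_k * 'I_n => (s.2, s.1)) h x; apply.
  by apply: eq_bigr => s _; apply: eq_bigr => t _; rewrite !mxE.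
exact: exact_scalar n0 cphi cpsi.
Qed.

Lemma exact_pure (S W : osData R) (p : S) (q : W) : is_opsys S -> is_opsys W ->
  pos1 p -> pos1 q -> factors_exactly oh (fun f : dualMO S => ev f p *: q).
Proof.
move=> So Wo pp qp.
pose psi (A : scalarMat 1) : W := (A : 'M[C]_1) 0 0 *: q.
have psil : linear psi.
  by move=> c A B; rewrite /psi !mxE scalerDl scalerA.
pose Psi := HB.pack psi (GRing.isLinear.Build C (scalarMat 1) W *:%R psi psil)
  : {linear scalarMat 1 -> W}.
have cPsi : cp Psi.
  move=> k X /mo_scalarP/fpos_scalarE h; apply: fpos_mo.
  have := fpos_tens (opsys_mcone Wo) h qp.
  move/(fpos_reindex (fun i => ((i, 0), tt)))/fpos_ext; apply => i j.
  by rewrite mxE.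
have := exact_tens (ltn0Sn 0) So (pp 1 (fun=> tt)) cPsi.
by move=> [F hF]; exists F => f; rewrite -hF /= /psi !mxE.
Qed.

Lemma exactZ (D : moSpace R) (W : osData R) (r : C) (h : D -> W) : is_opsys W -> 0 <= r ->
  factors_exactly oh h -> factors_exactly oh (fun f => r *: h f).
Proof.
move=> Wo r0.
have c1 : cp (idfun : {linear D -> D}).
  by move=> k X Xp; apply: mo_pos_eq Xp _; apply/matrixP => a b; rewrite mxE.
pose ka : {linear W -> W} := *:%R r.
have c2 : cp ka by move=> k X Xp; exact: (os_posZ Wo).
exact: exact_comp c1 c2.
Qed.

Lemma exact_sum (D : moSpace R) (W : osData R) (J : Type) (s : seq J) (h : J -> D -> W) :
  is_opsys W -> (forall j, factors_exactly oh (h j)) ->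
  factors_exactly oh (fun f => \sum_(j <- s) h j f).
Proof.
move=> Wo hx; have Wc := opsys_mcone Wo.
elim: s => [|j s ih].
  by have [F hF] := exact_zero oh D Wc; exists F => f; rewrite big_nil -hF.
have [F hF] := exactD Wc (hx j) ih.
by exists F => f; rewrite big_cons -hF.
Qed.

(** Choose a and b with -a <= h <= a and -b <= z <= b, and expand
    (a + h) (x) (b + z) + (a - h) (x) (b - z). *)
Lemma exact_unit (S W : osData R) (h : S) (z : W) : is_opsys S -> is_opsys W ->
  os_star h = h -> os_star z = z -> exists2 r : R, 0 <= r &
  factors_exactly oh (fun f : dualMO S =>
    (r%:C)%C *: (ev f (os_one S) *: os_one W) + ev f h *: z).
Proof.
move=> So Wo hh zh.
have sym (V : osData R) (x : V) : is_opsys V -> os_star x = x -> exists2 a : R, 0 <= a &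
    pos1 ((a%:C)%C *: os_one V + x) /\ pos1 ((a%:C)%C *: os_one V - x).
  move=> Vo xh; have [a a0 ap] := pos1_unit Vo xh.
  have nh : os_star (- x) = - x by rewrite (starN Vo) xh.
  have [b b0 bp] := pos1_unit Vo nh.
  have a0' : 0 <= (a%:C)%C :> C by rewrite ler0c.
  have b0' : 0 <= (b%:C)%C :> C by rewrite ler0c.
  exists (a + b); first exact: addr_ge0.
  rewrite rmorphD scalerDl; split.
    by rewrite addrAC; exact: (pos1D Vo ap (pos1Z Vo b0' (pos1_one Vo))).
  by rewrite -addrA; exact: (pos1D Vo (pos1Z Vo a0' (pos1_one Vo)) bp).
have [a a0 [ap an]] := sym S h So hh.
have [b b0 [bp bn]] := sym W z Wo zh.
exists (a * b); first exact: mulr_ge0.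
have h2 : 0 <= 2^-1 :> C by rewrite invr_ge0 ler0n.
have := exactZ Wo h2 (exactD (opsys_mcone Wo) (exact_pure So Wo ap bp) (exact_pure So Wo an bn)).
move=> [F hF]; exists F => f; rewrite -hF !evD evN !evZ.
have e (A B : C) (o w : W) : A *: (o + w) + B *: (o - w) = (A + B) *: o + (A - B) *: w.
  by rewrite scalerDr scalerBr addrACA -scalerDl -scalerBl.
rewrite e scalerDr !scalerA.
by congr (_ *: _ + _ *: _); rewrite ?rmorphM /=; field.
Qed.

End Ingredients.

(** * The cones of the tensor product *)

Section Gamma.
Context {R : realType}.
Notation C := R[i].
Variable oh : forall n, OHrep R n.
Local Notation tau := (fun S T : fdOpSys R => @gamma_soh R oh S T).

Section Pair.
Variables S T : fdOpSys R.
Let So := fd_opsys S.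
Let To := fd_opsys T.
Local Notation gamma X := (gamma_soh oh (S := S) (T := T) X).

Lemma gammaP k (X : 'M[tensor S T]_k) : gamma X <-> factors_approx oh (hatmx X).
Proof.
have -> : hatmx X = hat (tensor_amp X) by apply/funext => f; rewrite hat_tensor_amp.
split; first exact: (factors_SOH_approx (amp_opsys k To)).
exact: (approx_factors_SOH (amp_opsys k To)).
Qed.

Lemma gamma_cp k (X : 'M[tensor S T]_k) : gamma X -> cp (hatmx X).
Proof. by move/gammaP; apply: approx_cp; exact: amp_opsys. Qed.

Lemma gamma_pos1 k (X : 'M[tensor S T]_k) (f : dualMO S) : gamma X -> posfun f ->
  pos1 (hatmx X f).
Proof.
move=> /gamma_cp Xcp fp; apply: (pos1_mo (amp_opsys k To)).
by apply: mo_pos_eq (Xcp _ _ fp) _; apply/matrixP => a b; rewrite !mxE.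
Qed.

Lemma gamma_herm k (X : 'M[tensor S T]_k) : gamma X ->
  star_mx (S := tensorOS tau S T) X = X.
Proof.
move=> Xg; apply/matrixP => a b; rewrite !mxE; apply/eqP; rewrite -subr_eq0; apply/eqP.
apply: (hat_separate So) => f fp; rewrite hatD hatN /= hat_star //.
have := opsys_fpos_herm (amp_opsys k To) tt tt (gamma_pos1 Xg fp).
move/ffunP/(_ (a, b)); rewrite !ffunE /= => ->; exact: subrr.
Qed.

Lemma gammaD k (X Y : 'M[tensor S T]_k) : gamma X -> gamma Y -> gamma (X + Y).
Proof.
move=> /gammaP Xg /gammaP Yg; apply/gammaP.
apply: approx_ext (approxD (amp_opsys k To) Xg Yg) _ => f.
by apply/ffunP => ab; rewrite !ffunE mxE hatD.
Qed.

Lemma gamma_congr k l (al : 'M[C]_(k, l)) (X : 'M[tensor S T]_k) :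
  gamma X -> gamma (congr_mx al X).
Proof.
move=> /gammaP Xg; apply/gammaP.
pose ka (A : ampOS k T) : ampOS l T :=
  [ffun ab => \sum_c \sum_d (Num.conj (al c ab.1) * al d ab.2) *:
     (A : {ffun 'I_k * 'I_k -> T}) (c, d)].
have kal : linear ka.
  move=> a A B; apply/ffunP => ab; rewrite !ffunE scaler_sumr -big_split.
  apply: eq_bigr => c _; rewrite scaler_sumr -big_split; apply: eq_bigr => d _ /=.
  by rewrite !ffunE scalerDr !scalerA mulrC.
pose Ka := HB.pack ka (GRing.isLinear.Build C (ampOS k T) (ampOS l T) *:%R ka kal)
  : {linear ampOS k T -> ampOS l T}.
have cid : cp (idfun : {linear dualMO S -> dualMO S}).
  by move=> m Y Yp; apply: mo_pos_eq Yp _; apply/matrixP => a b; rewrite mxE.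
have cKa : cp Ka.
  apply: (cp_from_fpos (opsys_mcone (amp_opsys k To))) => I Y.
  move=> /(fpos_ampE (opsys_mcone To)) h; apply/(fpos_ampE (opsys_mcone To)).
  have := fpos_congr (opsys_mcone To) (fun (s : I * 'I_k) (t : I * 'I_l) =>
    (s.1 == t.1)%:R * al s.2 t.2) h.
  move/fpos_ext; apply => -[i a] [j b]; rewrite ffunE /=.
  rewrite -(pair_bigA _ (fun i' c => \sum_d (Num.conj ((i' == i)%:R * al c a) *
     ((d.1 == j)%:R * al d.2 b)) *: (Y i' d.1 : {ffun _ -> T}) (c, d.2))) /=.
  rewrite (sum_only (i0 := i)) => [|i' /negPf ii]; last first.
    by rewrite big1 // => c _; rewrite big1 // => d _; rewrite ii mul0r rmorph0 mul0r scale0r.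
  apply: eq_bigr => c _.
  rewrite -(pair_bigA _ (fun j' d => (Num.conj ((i == i)%:R * al c a) *
     ((j' == j)%:R * al d b)) *: (Y i j' : {ffun _ -> T}) (c, d))) /=.
  rewrite (sum_only (i0 := j)) => [|j' /negPf jj]; last first.
    by rewrite big1 // => d _; rewrite jj mul0r mulr0 scale0r.
  by apply: eq_bigr => d _; rewrite !eqxx !mul1r.
apply: approx_ext (approx_comp (amp_opsys k To) (amp_opsys l To) cid cKa Xg) _ => f.
apply/ffunP => -[a b]; rewrite !ffunE mxE hat_sum; apply: eq_bigr => c _.
rewrite hat_sum; apply: eq_bigr => d _.
by rewrite hatZ ffunE.
Qed.

Lemma gamma_scale k (r : C) (X : 'M[tensor S T]_k) : 0 <= r ->
  gamma X -> gamma (map_mx ( *:%R r) X).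
Proof.
move=> r0 Xg; have := gamma_congr (sqrtC r)%:M Xg; congr (gamma _).
exact: (congr_scalar X r0).
Qed.

Lemma gamma_proper k (X : 'M[tensor S T]_k) : gamma X -> gamma (- X) -> X = 0.
Proof.
move=> Xp Xn; apply/matrixP => a b; rewrite mxE; apply: (hat_separate So) => f fp.
have hn : hatmx (- X) f = - hatmx X f.
  by apply/ffunP => ab; rewrite !ffunE mxE hatN.
have := gamma_pos1 Xn fp; rewrite hn => h.
have := pos1_proper (amp_opsys k To) (gamma_pos1 Xp fp) h.
by move/ffunP/(_ (a, b)); rewrite !ffunE.
Qed.

Lemma hatmx_unit k r (X : 'M[tensor S T]_k) f :
  hatmx (map_mx ( *:%R r) (diag_one (tensorOS tau S T) k) + X) f =
  r *: (ev f (os_one S) *: os_one (ampOS k T)) + hatmx X f.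
Proof.
apply/ffunP => -[a b]; rewrite !ffunE !mxE hatD hatZ hatMn hat_tensE /=.
by congr (_ *: _ + _); rewrite scalerMnr.
Qed.

Lemma gamma_arch k (X : 'M[tensor S T]_k) :
  (forall r : C, 0 < r ->
     gamma (map_mx ( *:%R r) (diag_one (tensorOS tau S T) k) + X)) -> gamma X.
Proof.
move=> Xp; apply/gammaP.
apply: (approx_arch (amp_opsys k To) (u := fun f => ev f (os_one S) *: os_one (ampOS k T))).
move=> r r0; have r0' : 0 < (r%:C)%C :> C by rewrite ltcR.
have /gammaP h := Xp _ r0'; apply: approx_ext h _ => f; exact: hatmx_unit.
Qed.

(** Real and imaginary parts of a basis of S form a hermitian spanning family,
    so all coefficients can be moved to T. *)
Lemma tensor_herm_decomp : exists (J : finType) (h : J -> S),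
  (forall j, os_star (h j) = h j) /\
  forall u : tensor S T, exists y : J -> T, u = \sum_j tens (h j) (y j).
Proof.
pose b i := vbas (S := S) i.
exists ('I_(dim S) + 'I_(dim S))%type, (fun s => match s with
   | inl i => os_re (b i) | inr i => os_re ('i *: b i) end).
split=> [[i|i]|u]; try exact: (os_re_herm So).
pose y i := \sum_j u i j *: vbas (S := T) j.
exists (fun s => match s with inl i => y i | inr i => - 'i *: y i end).
rewrite big_sumType /= -big_split [LHS]tensor_bas; apply: eq_bigr => i _ /=.
rewrite tensZr -tensZl -tensDl scaleNr -(os_re_im So) /y tens_sumr.
by apply: eq_bigr => j _; rewrite tensZr.
Qed.

(** Averaging X and its adjoint makes the coefficients of the hermitian family
    hermitian; then [exact_unit] applies term by term. *)
Lemma gamma_order_unit k (X : 'M[tensor S T]_k) :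
  star_mx (S := tensorOS tau S T) X = X ->
  exists2 r : C, 0 < r &
    gamma (map_mx ( *:%R r) (diag_one (tensorOS tau S T) k) + X).
Proof.
move=> Xh; have [J [h [hh dec]]] := tensor_herm_decomp.
have /choice [Y YE] : forall ab : 'I_k * 'I_k, exists y : J -> T,
  X ab.1 ab.2 = \sum_j tens (h j) (y j) by move=> ab; exact: dec.
pose z j : ampOS k T := [ffun ab => 2^-1 *: (Y ab j + os_star (Y (ab.2, ab.1) j))].
have Wo := amp_opsys k To.
have zh j : os_star (z j) = z j.
  apply/ffunP => -[a b]; rewrite !ffunE /= (starZ To) (starD To) (os_starK To).
  by rewrite addrC fmorphV rmorph_nat.
have hatX f : hatmx X f = \sum_j ev f (h j) *: z j.
  apply/ffunP => -[a b]; rewrite ffunE sum_ffunE /=.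
  have e1 : hat (X a b) f = \sum_j ev f (h j) *: Y (a, b) j.
    by rewrite (YE (a, b)) hat_sum; apply: eq_bigr => j _; exact: hat_tensE.
  have e2 : hat (X a b) f = \sum_j ev f (h j) *: os_star (Y (b, a) j).
    have /matrixP/(_ a b) := Xh; rewrite !mxE /= => <-.
    rewrite (YE (b, a)) -[X in tensor_star X](eq_bigr _ (fun j _ => scale1r _)).
    rewrite tensor_star_sum hat_sum; apply: eq_bigr => j _.
    by rewrite rmorph1 scale1r tensor_star_tens hh hat_tensE.
  have half (v : T) : v = 2^-1 *: (v + v).
    by rewrite -mulr2n -[v *+ 2]scaler_nat scalerA mulVf ?scale1r ?pnatr_eq0.
  rewrite (half (hat _ _)) {1}e1 e2 -big_split scaler_sumr; apply: eq_bigr => j _ /=.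
  by rewrite !ffunE /= -scalerDr !scalerA mulrC.
have /choice [r rP] : forall j, exists r : R, 0 <= r /\ factors_exactly oh
    (fun f : dualMO S => (r%:C)%C *: (ev f (os_one S) *: os_one (ampOS k T)) +
       ev f (h j) *: z j).
  by move=> j; have [r r0 rx] := exact_unit oh So Wo (hh j) (zh j); exists r.
have r0 : 0 < \sum_j r j + 1.
  by rewrite ltr_wpDl // sumr_ge0 // => j _; exact: (rP j).1.
exists ((\sum_j r j + 1)%:C)%C; first by rewrite ltcR.
have Ex := exactD (opsys_mcone Wo)
  (exact_sum (index_enum J) Wo (fun j => (rP j).2))
  (exact_pure oh So Wo (pos1_one So) (pos1_one Wo)).
apply/gammaP; apply: approx_ext (approx_exact Wo Ex) _ => f /=.
rewrite hatmx_unit hatX big_split /= -scaler_suml rmorphD rmorph_sum scalerDl.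
by rewrite rmorph1 scale1r addrAC.
Qed.

Lemma gamma_opsys : is_opsys (tensorOS tau S T).
Proof.
split.
- exact: tensor_star_antilinear.
- exact: tensor_starK.
- exact: gamma_herm.
- exact: gammaD.
- exact: gamma_scale.
- exact: gamma_proper.
- exact: gamma_congr.
- by rewrite /= tensor_star_tens !os_one_herm.
- exact: gamma_order_unit.
- by move=> k X _; exact: gamma_arch.
Qed.

Lemma gamma_tens n m (P : 'M[S]_n) (Q : 'M[T]_m) :
  mo_pos P -> mo_pos Q -> gamma (tens_mx P Q).
Proof.
move=> Pp Qp; apply/gammaP.
have [n0|n0] := posnP n.
  apply: approx_ext (approx_exact (amp_opsys _ To)
    (exact_zero oh _ (opsys_mcone (amp_opsys _ To)))) _ => f.
  apply/ffunP => -[[a an] b]; exfalso.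
  by have := an; rewrite n0 mul0n.
pose psi (A : scalarMat n) : ampOS (n * m) T := [ffun ab =>
  (A : 'M[C]_n) (mxtens_unindex ab.1).1 (mxtens_unindex ab.2).1 *:
  Q (mxtens_unindex ab.1).2 (mxtens_unindex ab.2).2].
have psil : linear psi.
  by move=> c A B; apply/ffunP => ab; rewrite !ffunE !mxE scalerDl scalerA.
pose Psi := HB.pack psi (GRing.isLinear.Build C (scalarMat n) (ampOS (n * m) T) *:%R
  psi psil) : {linear scalarMat n -> ampOS (n * m) T}.
have cPsi : cp Psi.
  move=> k X /mo_scalarP/fpos_scalarE h; apply: fpos_mo.
  apply/(fpos_ampE (opsys_mcone To)).
  have := fpos_tens (opsys_mcone To) h (mo_fpos (opsys_mcone To) Qp).
  move/(fpos_reindex (fun s : 'I_k * 'I_(n * m) =>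
    ((s.1, (mxtens_unindex s.2).1), (mxtens_unindex s.2).2))).
  by move/fpos_ext; apply => s t; rewrite mxE ffunE.
apply: approx_ext (approx_exact (amp_opsys _ To) (exact_tens oh n0 So Pp cPsi)) _ => f.
by apply/ffunP => ab; rewrite !ffunE !mxE hat_tensE.
Qed.

(** The entries of phi form a positive element F of M_n of the dual of S, and
    phi (x) psi is psi applied to the image of F under the completely positive
    map attached to X. *)
Lemma gamma_ucp n k (phi : {linear S -> 'M[C]_n}) (psi : {linear T -> 'M[C]_k}) l
    (X : 'M[tensor S T]_l) :
  cp (V := S) (W := scalarMat n) phi -> cp (V := T) (W := scalarMat k) psi ->
  gamma X ->
  mo_pos (map_mx (tensor_map_mx phi psi) X : 'M[scalarMat (n * k)]_l).
Proof.
move=> cphi cpsi /gamma_cp Xcp.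
have Fl i j : linear (fun v => phi v i j : C^o).
  by move=> c u v; rewrite linearP !mxE.
pose f i j : {linear S -> C^o} := HB.pack (fun v => phi v i j : C^o)
  (GRing.isLinear.Build C S C^o *:%R _ (Fl i j)).
pose F : 'M[dualMO S]_n := \matrix_(i, j) linfun (f i j).
have FE i j v : ev (F i j) v = phi v i j by rewrite mxE /ev lfunE.
have Fp : mo_pos F.
  move=> m Y Yp; apply: mo_pos_eq (cphi _ _ Yp) _.
  by apply/matrixP => a b; rewrite !mxE; apply/matrixP => i j; rewrite [RHS]mxE -FE.
have := mo_fpos (opsys_mcone (amp_opsys l To)) (Xcp _ _ Fp).
move=> /(fpos_ampE (opsys_mcone To)) h.
have /fpos_scalarE h2 := cp_fpos cpsi h.
apply/mo_scalarP/fpos_scalarE => x.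
have /ge0_eq := fpsd_reindex (fun s : 'I_l * 'I_(n * k) =>
  (((mxtens_unindex s.2).1, s.1), (mxtens_unindex s.2).2)) h2 x; apply.
have tE (u : tensor S T) s t : tensor_map_mx phi psi u s t =
    psi (hat u (F (mxtens_unindex s).1 (mxtens_unindex t).1))
      (mxtens_unindex s).2 (mxtens_unindex t).2.
  rewrite /tensor_map_mx /tlift /= hatE !linear_sum !summxE; apply: eq_bigr => i _.
  rewrite !linear_sum !summxE; apply: eq_bigr => j _.
  by rewrite !linearZ FE !mxE.
apply: eq_bigr => s _; apply: eq_bigr => t _; rewrite [in RHS]mxE tE.
by congr (_ * (psi _) _ _ * _); rewrite mxE ffunE.
Qed.

End Pair.

(** The map attached to (rho (x) ka) u is ka o h o rho', with h attached to u
    and rho' the transpose of rho. *)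
Lemma gamma_functorial (S T V W : fdOpSys R) (rho : {linear S -> V})
    (ka : {linear T -> W}) k (X : 'M[tensor S T]_k) : cp rho -> cp ka ->
  gamma_soh oh (S := S) (T := T) X ->
  gamma_soh oh (S := V) (T := W) (map_mx (tensor_map rho ka) X).
Proof.
move=> crho cka /gammaP Xg; apply/gammaP.
have To := fd_opsys T; have Wo := fd_opsys W.
pose rd (g : dualMO V) : dualMO S := ((g : 'Hom(V, C^o)) \o linfun rho)%VF.
have rdE g x : ev (rd g) x = ev g (rho x) by rewrite /ev comp_lfunE lfunE.
have rdl : linear rd.
  move=> c g h; apply/lfunP => x; rewrite -[LHS]/(ev _ x) -[RHS]/(ev _ x).
  by rewrite ev_linear !rdE ev_linear.
pose Rd := HB.pack rd (GRing.isLinear.Build C (dualMO V) (dualMO S) *:%R rd rdl)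
  : {linear dualMO V -> dualMO S}.
have cRd : cp Rd.
  move=> m F Fp l Y Yp; apply: mo_pos_eq (Fp _ _ (crho _ _ Yp)) _.
  apply/matrixP => a b; rewrite !mxE; apply/matrixP => i j; rewrite !mxE.
  by rewrite -[RHS]/(ev _ _) rdE.
pose kk (A : ampOS k T) : ampOS k W := [ffun ab => ka ((A : {ffun _ -> T}) ab)].
have kkl : linear kk by move=> c A B; apply/ffunP => ab; rewrite !ffunE linearP.
pose Kk := HB.pack kk (GRing.isLinear.Build C (ampOS k T) (ampOS k W) *:%R kk kkl)
  : {linear ampOS k T -> ampOS k W}.
have cKk : cp Kk.
  apply: (cp_from_fpos (opsys_mcone (amp_opsys k To))) => I Y.
  move=> /(fpos_ampE (opsys_mcone To)) h; apply/(fpos_ampE (opsys_mcone Wo)).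
  by apply: fpos_ext (cp_fpos cka h) _ => s t; rewrite ffunE.
apply: approx_ext (approx_comp (amp_opsys k To) (amp_opsys k Wo) cRd cKk Xg) _ => g.
apply/ffunP => -[a b]; rewrite !ffunE mxE /tensor_map /tlift /= hat_sum hatE linear_sum.
apply: eq_bigr => i _; rewrite hat_sum linear_sum; apply: eq_bigr => j _.
by rewrite hatZ hat_tensE !(linearZ_LR ka) rdE.
Qed.

End Gamma.

Theorem theorem5p6 (R : realType) (oh : forall n : nat, OHrep R n) :
  tensor_structure (fun S T : fdOpSys R => @gamma_soh R oh S T) /\
  functorial (fun S T : fdOpSys R => @gamma_soh R oh S T).
Proof.
split; [split|].
- exact: gamma_opsys.
- by move=> S T n m P Q; exact: gamma_tens.
- move=> S T n k phi psi cphi phi1 cpsi psi1; split.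
    by move=> l X; exact: gamma_ucp.
  have -> : tensor_map_mx phi psi (tens (os_one S) (os_one T)) =
      phi (os_one S) *t psi (os_one T).
    apply: tlift_tens => [y a u v|x a u v]; apply/matrixP => i j.
      by rewrite linearP !mxE; ring.
    by rewrite linearP !mxE; ring.
  rewrite phi1 psi1; apply/matrixP => i j; rewrite !mxE.
  rewrite -natrM mulnb -xpair_eqE -!surjective_pairing.
  by rewrite (can_eq (@mxtens_unindexK n k)).
- by move=> S T V W rho ka crho cka k X; exact: gamma_functorial.
Qed.
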